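(* Let $a > 0$, $b \in \mathbb{R}$, $\alpha, \beta \in \mathbb{R}$, $\sigma_1, \sigma_2 > 0$, $\varrho \in (-1,1)$, and let $(Y_t, X_t)_{t \geq 0}$ be the unique strong solution of the Heston SDE $$ \begin{cases} dY_t = (a - bY_t)\,dt + \sigma_1 \sqrt{Y_t}\,dW_t,\\ dX_t = (\alpha - \beta Y_t)\,dt + \sigma_2\sqrt{Y_t}\,\bigl(\varrho\,dW_t + \sqrt{1-\varrho^2}\,dB_t\bigr), \end{cases}\qquad t \geq 0, $$ with $\mathbb{P}(Y_0 \in (0,\infty)) = 1$. Then for every $T > 0$, $$ \mathbb{P}\left( T\int_0^T Y_s^2\,ds > \left(\int_0^T Y_s\,ds\right)^2 \right) = 1, $$ so that the random vectors $$ \begin{bmatrix} \widehat a_T^{\mathrm{LSE}} \\ \widehat b_T^{\mathrm{LSE}} \end{bmatrix} := \begin{bmatrix} T & -\int_0^T Y_s\,ds \\ -\int_0^T Y_s\,ds & \int_0^T Y_s^2\,ds \end{bmatrix}^{-1} \begin{bmatrix} Y_T - Y_0 \\ -\int_0^T Y_s\,dY_s \end{bmatrix} = \frac{1}{T\int_0^T Y_s^2\,ds - \left(\int_0^T Y_s\,ds\right)^2} \begin{bmatrix} (Y_T - Y_0)\int_0^T Y_s^2\,ds - \int_0^T Y_s\,ds\int_0^T Y_s\,dY_s \\ (Y_T-Y_0)\int_0^T Y_s\,ds - T\int_0^T Y_s\,dY_s \end{bmatrix} $$ and $$ \begin{bmatrix} \widehat \alpha_T^{\mathrm{LSE}} \\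 \widehat \beta_T^{\mathrm{LSE}} \end{bmatrix} := \begin{bmatrix} T & -\int_0^T Y_s\,ds \\ -\int_0^T Y_s\,ds & \int_0^T Y_s^2\,ds \end{bmatrix}^{-1} \begin{bmatrix} X_T - X_0 \\ -\int_0^T Y_s\,dX_s \end{bmatrix} = \frac{1}{T\int_0^T Y_s^2\,ds - \left(\int_0^T Y_s\,ds\right)^2} \begin{bmatrix} (X_T - X_0)\int_0^T Y_s^2\,ds - \int_0^T Y_s\,ds\int_0^T Y_s\,dX_s \\ (X_T-X_0)\int_0^T Y_s\,ds - T\int_0^T Y_s\,dX_s \end{bmatrix} $$ exist almost surely, and $$ \bigl(\widehat a_{T,n}^{\mathrm{LSE,D}}, \widehat b_{T,n}^{\mathrm{LSE,D}}, \widehat\alpha_{T,n}^{\mathrm{LSE,D}}, \widehat\beta_{T,n}^{\mathrm{LSE,D}}\bigr) \longrightarrow \bigl(\widehat a_T^{\mathrm{LSE}}, \widehat b_T^{\mathrm{LSE}}, \widehat\alpha_T^{\mathrm{LSE}}, \widehat\beta_T^{\mathrm{LSE}}\bigr) \quad\text{in probability as } n \to \infty. $$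
   Context: $(W_t,B_t)_{t\ge 0}$ is a 2-dimensional standard Wiener process, and the (random) initial value $(Y_0,X_0)$ is independent of $(W_t,B_t)_{t\ge0}$. The filtration is the augmented filtration generated by $(W,B)$ and $(Y_0,X_0)$ (it satisfies the usual conditions). It is known that the SDE has a pathwise unique strong solution with $Y_t \geq 0$ for all $t\ge 0$ almost surely. Integrals $\int_0^T Y_s\,dY_s$ and $\int_0^T Y_s\,dX_s$ are Itô integrals. For $T>0$ and $n \in \mathbb{N}$ (with $\lfloor nT\rfloor \ge 2$), the least squares estimator based on the discrete time observations $(Y_{i/n}, X_{i/n})_{i\in\{0,1,\ldots,\lfloor nT\rfloor\}}$ is $$ \bigl(\widehat a_{T,n}^{\mathrm{LSE,D}}, \widehat b_{T,n}^{\mathrm{LSE,D}}, \widehat\alpha_{T,n}^{\mathrm{LSE,D}}, \widehat\beta_{T,n}^{\mathrm{LSE,D}}\bigr) := \operatorname*{arg\,min}_{(a,b,\alpha,\beta)\in\mathbb{R}^4} \sum_{i=1}^{\lfloor nT\rfloor} \left[ \left(Y_{\frac in} - Y_{\frac{i-1}{n}} - \tfrac1n\bigl(a - bY_{\frac{i-1}{n}}\bigr)\right)^2 + \left(X_{\frac in} - X_{\frac{i-1}{n}} - \tfrac1n\bigl(\alpha - \beta Y_{\frac{i-1}{n}}\bigr)\right)^2 \right]. $$ The minimizer is unique whenever $\lfloor nT\rfloor \sum_{i=1}^{\lfloor nT\rfloor} Y_{\frac{i-1}{n}}^2 > \bigl(\sum_{i=1}^{\lfloor nT\rfloor} Y_{\frac{i-1}{n}}\bigr)^2$,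 which is known to hold with probability one when $\lfloor nT\rfloor\ge2$; it is then given by $$ \begin{bmatrix} \widehat a_{T,n}^{\mathrm{LSE,D}} \\ \widehat b_{T,n}^{\mathrm{LSE,D}} \end{bmatrix} = n\, G_n^{-1}\begin{bmatrix} Y_{\lfloor nT\rfloor/n} - Y_0 \\ -\sum_{i=1}^{\lfloor nT\rfloor}(Y_{\frac in}-Y_{\frac{i-1}{n}})Y_{\frac{i-1}{n}}\end{bmatrix},\quad \begin{bmatrix} \widehat \alpha_{T,n}^{\mathrm{LSE,D}} \\ \widehat \beta_{T,n}^{\mathrm{LSE,D}} \end{bmatrix} = n\, G_n^{-1}\begin{bmatrix} X_{\lfloor nT\rfloor/n} - X_0 \\ -\sum_{i=1}^{\lfloor nT\rfloor}(X_{\frac in}-X_{\frac{i-1}{n}})Y_{\frac{i-1}{n}}\end{bmatrix}, $$ where $$ G_n = \begin{bmatrix} \lfloor nT\rfloor & -\sum_{i=1}^{\lfloor nT\rfloor} Y_{\frac{i-1}{n}} \\ -\sum_{i=1}^{\lfloor nT\rfloor} Y_{\frac{i-1}{n}} & \sum_{i=1}^{\lfloor nT\rfloor} Y_{\frac{i-1}{n}}^2 \end{bmatrix}. $$ The vector $(\widehat a_T^{\mathrm{LSE}}, \widehat b_T^{\mathrm{LSE}}, \widehat\alpha_T^{\mathrm{LSE}}, \widehat\beta_T^{\mathrm{LSE}})$ is by definition called the LSE of $(a,b,\alpha,\beta)$ based on continuous time observations $(X_t)_{t\in[0,T]}$. *)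

(* Defs.v *)
From HB Require Import structures.
From mathcomp Require Import all_boot all_order all_algebra.
From mathcomp Require Import all_classical all_reals all_analysis.

Set Implicit Arguments.
Unset Strict Implicit.
Unset Printing Implicit Defensive.
Import Order.TTheory GRing.Theory Num.Theory.
Import numFieldNormedType.Exports.
Local Open Scope classical_set_scope.
Local Open Scope ring_scope.

(** Processes are functions [Z : R -> Omega -> R]; only times [t >= 0] matter. *)

Section Probability.
Context {R : realType} {d : measure_display} {Omega : measurableType d}.
Variable P : probability Omega R.
Implicit Types (F : R -> set (set Omega)) (Z W B H : R -> Omega -> R).

Definition preimages (f : Omega -> R) : set (set Omega) :=
  preimage_set_system setT f measurable.

Definition sigma_process (J : set R) Z : set (set Omega) :=
  <<s \bigcup_(u in J) preimages (Z u) >>.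

Definition indep_systems (G K : set (set Omega)) : Prop :=
  forall A C, G A -> K C -> P (A `&` C) = (P A * P C)%E.

Definition continuous_paths Z : Prop :=
  {ae P, forall w, {within `[0, +oo[, continuous (Z ^~ w)}}.

Definition adapted F Z : Prop :=
  forall t, 0 <= t -> preimages (Z t) `<=` F t.

(** The second argument of [normal_prob] is the standard deviation. *)
Record wiener_process W : Prop := {
  wiener_measurable : forall t, 0 <= t -> measurable_fun setT (W t) ;
  wiener_start : {ae P, forall w, W 0 w = 0} ;
  wiener_indep : forall s t, 0 <= s -> s < t ->
    indep_systems (sigma_process `[0, s] W)
                  (preimages (fun w => W t w - W s w)) ;
  wiener_normal : forall s t, 0 <= s -> s < t ->
    forall V : set R, measurable V ->
      P [set w | V (W t w - W s w)] = normal_prob 0 (Num.sqrt (t - s)) V ;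
  wiener_continuous : continuous_paths W }.

Record wiener_process2 W B : Prop := {
  wiener2_fst : wiener_process W ;
  wiener2_snd : wiener_process B ;
  wiener2_indep : indep_systems (sigma_process `[0, +oo[ W)
                                (sigma_process `[0, +oo[ B) }.

Definition sigma_noise (J : set R) W B : set (set Omega) :=
  <<s sigma_process J W `|` sigma_process J B >>.

Definition sigma_initial (y0 x0 : Omega -> R) : set (set Omega) :=
  <<s preimages y0 `|` preimages x0 >>.

(** When [P] is complete, the [P]-negligible sets are measurable, so this is a
    filtration of sub-sigma-algebras. *)
Definition augmented_filtration W B (y0 x0 : Omega -> R) (t : R) :
    set (set Omega) :=
  <<s sigma_noise `[0, t] W B `|` sigma_initial y0 x0 `|` P.-negligible >>.

Definition cvg_in_probability {V : normedModType R}
    (Zn : nat -> Omega -> V) (Zoo : Omega -> V) : Prop :=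
  forall eps : R, 0 < eps ->
    (fun n => P [set w | eps <= `|Zn n w - Zoo w|]) @ \oo --> 0%E.

(** Simple processes [\sum_(i < N) xi_i 1_(]t_i, t_(i+1)])] with
    [0 <= t_0 <= t_1 <= ...] and [xi_i] bounded and [F t_i]-measurable. *)
Record simple_process F := SimpleProcess {
  simple_size : nat ;
  simple_time : nat -> R ;
  simple_coef : nat -> Omega -> R ;
  simple_time_ge0 : 0 <= simple_time 0 ;
  simple_time_nd : forall i, simple_time i <= simple_time i.+1 ;
  simple_coef_meas : forall i, preimages (simple_coef i) `<=` F (simple_time i) ;
  simple_coef_bnd : forall i, exists M, forall w, `|simple_coef i w| <= M }.

Definition simple_val F (S : simple_process F) (s : R) (w : Omega) : R :=
  \sum_(i < simple_size S)
    simple_coef S i w * \1_(`]simple_time S i, simple_time S i.+1]) s.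

Definition simple_integral F (S : simple_process F) W (t : R) (w : Omega) : R :=
  \sum_(i < simple_size S) simple_coef S i w *
    (W (Num.min (simple_time S i.+1) t) w - W (Num.min (simple_time S i) t) w).

(** [I] is (a version of) [\int_0^t H dW]: [H] is adapted with almost surely
    square integrable paths, and [I] is the limit in probability of the
    integrals of simple processes [S n] such that [\int_0^t (S n - H)^2 ds]
    tends to [0] in probability. *)
Record is_ito_integral F W H (t : R) (I : Omega -> R) : Prop := {
  ito_measurable : measurable_fun setT I ;
  ito_adapted : forall s, 0 <= s <= t -> preimages (H s) `<=` F s ;
  ito_paths : {ae P, forall w, measurable_fun `[0, t] (H ^~ w) /\
    lebesgue_measure.-integrable `[0, t] (fun s => (H s w ^+ 2)%:E)} ;
  ito_approx : exists2 S : nat -> simple_process F,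
    cvg_in_probability (V := R^o)
      (fun n w => \int[lebesgue_measure]_(s in `[0, t])
                     (simple_val (S n) s w - H s w) ^+ 2)
      (fun=> 0) &
    cvg_in_probability (V := R^o) (fun n => simple_integral (S n) W t) I }.

(** The Ito integral as a random variable, defined up to a null set; the value
    [0] is used when the integral does not exist. *)
Definition ito_integral F W H (t : R) : Omega -> R :=
  xget (fun=> 0) [set I | is_ito_integral F W H t I].

Definition ito_diff F W B (mu phi psi : R -> Omega -> R) (t : R) (w : Omega) : R :=
  \int[lebesgue_measure]_(s in `[0, t]) mu s w
  + ito_integral F W phi t w + ito_integral F B psi t w.

(** [\int_0^t H dZ] for the Ito process [dZ = mu ds + phi dW + psi dB]. *)
Definition ito_diff_integral F W B H (mu phi psi : R -> Omega -> R) (t : R) :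
    Omega -> R :=
  ito_diff F W B (fun s w => H s w * mu s w) (fun s w => H s w * phi s w)
    (fun s w => H s w * psi s w) t.

End Probability.

Section Heston.
Context {R : realType} {d : measure_display} {Omega : measurableType d}.
Variable P : probability Omega R.
Variables (a b alpha beta sigma1 sigma2 rho : R) (W B Y X : R -> Omega -> R).

Let F := augmented_filtration P W B (Y 0) (X 0).

Definition heston_driftY (s : R) (w : Omega) : R := a - b * Y s w.
Definition heston_driftX (s : R) (w : Omega) : R := alpha - beta * Y s w.
Definition heston_diffYW (s : R) (w : Omega) : R := sigma1 * Num.sqrt (Y s w).
Definition heston_diffYB (s : R) (w : Omega) : R := 0.
Definition heston_diffXW (s : R) (w : Omega) : R :=
  sigma2 * Num.sqrt (Y s w) * rho.
Definition heston_diffXB (s : R) (w : Omega) : R :=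
  sigma2 * Num.sqrt (Y s w) * Num.sqrt (1 - rho ^+ 2).

Record heston_solution : Prop := {
  heston_adaptedY : adapted F Y ;
  heston_adaptedX : adapted F X ;
  heston_continuousY : continuous_paths P Y ;
  heston_continuousX : continuous_paths P X ;
  heston_ge0 : {ae P, forall w, forall t, 0 <= t -> 0 <= Y t w} ;
  heston_eqY : forall t, 0 <= t -> {ae P, forall w,
    Y t w = Y 0 w +
      ito_diff P F W B heston_driftY heston_diffYW heston_diffYB t w} ;
  heston_eqX : forall t, 0 <= t -> {ae P, forall w,
    X t w = X 0 w +
      ito_diff P F W B heston_driftX heston_diffXW heston_diffXB t w} }.

Definition int_Y_dY (T : R) : Omega -> R :=
  ito_diff_integral P F W B Y heston_driftY heston_diffYW heston_diffYB T.
Definition int_Y_dX (T : R) : Omega -> R :=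
  ito_diff_integral P F W B Y heston_driftX heston_diffXW heston_diffXB T.

End Heston.

Section LeastSquares.
Context {R : realType} {Omega : Type}.
Variables (Y X : R -> Omega -> R).

Definition col2 (u v : R) : 'cV[R]_2 := \col_(i < 2) [:: u; v]`_i.

Definition mx22 (p q r s : R) : 'M[R]_2 :=
  \matrix_(i < 2, j < 2) (nth [::] [:: [:: p; q]; [:: r; s]] i)`_j.

Definition int_Y (T : R) (w : Omega) : R :=
  \int[lebesgue_measure]_(s in `[0, T]) Y s w.

Definition int_Y2 (T : R) (w : Omega) : R :=
  \int[lebesgue_measure]_(s in `[0, T]) (Y s w ^+ 2).

Definition lse_matrix (T : R) (w : Omega) : 'M[R]_2 :=
  mx22 T (- int_Y T w) (- int_Y T w) (int_Y2 T w).

(** Continuous-time estimator of the intercept and slope for an observed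
    process [Z], where [IYZ] stands for [\int_0^T Y dZ]. *)
Definition lse_pair (Z : R -> Omega -> R) (IYZ : Omega -> R) (T : R)
    (w : Omega) : 'cV[R]_2 :=
  invmx (lse_matrix T w) *m col2 (Z T w - Z 0 w) (- IYZ w).

Definition lse (IYY IYX : Omega -> R) (T : R) (w : Omega) : R * R * R * R :=
  let ab := lse_pair Y IYY T w in
  let cd := lse_pair X IYX T w in
  (ab 0 0, ab 1 0, cd 0 0, cd 1 0).

Definition lse_contrast (T : R) (n : nat) (w : Omega) (theta : R * R * R * R) : R :=
  let: (a, b, alpha, beta) := theta in
  let y i := Y (i%:R / n%:R) w in
  let x i := X (i%:R / n%:R) w in
  \sum_(1 <= i < (Num.truncn (n%:R * T)).+1)
    ((y i - y i.-1 - n%:R^-1 * (a - b * y i.-1)) ^+ 2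
     + (x i - x i.-1 - n%:R^-1 * (alpha - beta * y i.-1)) ^+ 2).

(** A minimizer of the contrast; which one is taken matters only on the event
    where it is not unique. *)
Definition lse_discrete (T : R) (n : nat) (w : Omega) : R * R * R * R :=
  xget 0 [set theta | forall theta',
    lse_contrast T n w theta <= lse_contrast T n w theta'].

End LeastSquares.

(* Main.v *)
(** A stochastic sum satisfies P(|sum xi_k (W_(k+1) - W_k)| >= e) <=
    P(sum xi_k^2 D_k > c) + 6 c / e^2, by switching xi_k off once the quadratic
    variation exceeds c.  Hence every continuous adapted process has an Ito
    integral, the limit in probability of its left-point sums, and
    sum_i Y_(i/n) (Z_((i+1)/n) - Z_(i/n)) converges in probability to the Ito
    integral of Y with respect to Z.  Over a short interval [[t - h, t]] the process
    Y moves by sigma1 sqrt(Y_(t-h)) times a Gaussian variable independent of the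
    past, up to o(sqrt h); since this variable has no atom, Y_t <> Y_0 almost
    surely.  So the Gram determinants, discrete and continuous, are positive and
    the discrete estimator is a continuous function of quantities that converge
    in probability. *)

Require Import Defs.
From HB Require Import structures.
From mathcomp Require Import all_boot all_order all_algebra.
From mathcomp Require Import all_classical all_reals all_analysis.
From mathcomp Require Import measurable_realfun ring lra.
Import Order.TTheory GRing.Theory Num.Theory.
Import numFieldNormedType.Exports.
Local Open Scope classical_set_scope.
Local Open Scope ring_scope.

Set Implicit Arguments.
Unset Strict Implicit.
Unset Printing Implicit Defensive.

(** * Convergence in outer probability *)

(** [ito_integral] is picked by [xget] for each time separately: nothing in its definition relates
    the versions at two times, and neither linearity, isometry nor path regularity comes with it.
    What ties the versions together is that the same left-point simple processes approximate all of
    them. Each error to be estimated is therefore replaced, by a diagonal choice, by the integral of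
    a [step] integrand, which is a finite sum; it then suffices that the squared integrand tends to
    0 in Lebesgue integral along almost every path.

    Conditional expectations do not appear: an increment of [W] is integrated out with the past
    frozen, and the cross term of the square disappears by symmetry of the Gaussian law. The
    variance enters only up to a factor, the 6 of [normal_second_moment]. Completeness of [P] makes
    almost sure limits and the augmented sigma-algebras measurable. Positivity of [Y 0] excludes a
    return of [Y] to its starting value, because the diffusion coefficient would be positive at the
    time of return. *)

Section OuterProbability.
Context {R : realType} {d : measure_display} {Omega : measurableType d}.
Variable P : probability Omega R.
Implicit Types (A B : set Omega) (f g h : nat -> Omega -> R) (u v : Omega -> R).

Definition outer_le A (r : R) : Prop :=
  exists B, [/\ measurable B, A `<=` B & (P B <= r%:E)%E].

(* Outer probabilities make sense for arbitrary maps, so that limits can be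
   computed before any measurability is known; on a non-measurable set the
   value of [P] itself carries no information. *)
Definition cip f u : Prop := forall e r : R, 0 < e -> 0 < r ->
  \forall n \near \oo, outer_le [set w | e <= `|f n w - u w|] r.

Lemma outer_leS A B r s : A `<=` B -> r <= s -> outer_le B r -> outer_le A s.
Proof.
move=> AB rs [C [mC BC PC]]; exists C; split => //; first exact: subset_trans BC.
by rewrite (le_trans PC)// lee_fin.
Qed.

Lemma outer_leU A B r s : outer_le A r -> outer_le B s ->
  outer_le (A `|` B) (r + s).
Proof.
move=> [C [mC AC PC]] [D [mD BD PD]]; exists (C `|` D); split.
- exact: measurableU.
- exact: setUSS.
- by rewrite (le_trans (measureU2 _ _ _))// EFinD leeD.
Qed.

Lemma outer_le_null A r : P.-negligible A -> 0 <= r -> outer_le A r.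
Proof. by move=> [B [mB PB AB]] r0; exists B; split => //; rewrite PB lee_fin. Qed.

Lemma outer_leP A r : measurable A -> outer_le A r -> (P A <= r%:E)%E.
Proof.
move=> mA [B [mB AB PB]]; apply: le_trans PB.
by apply: le_measure => //; rewrite inE.
Qed.

Lemma outer_le_meas A r : measurable A -> (P A <= r%:E)%E -> outer_le A r.
Proof. by move=> mA PA; exists A; split. Qed.

Lemma outer_le_ae A B r s : {ae P, forall w, A w -> B w} ->
  r < s -> outer_le B r -> outer_le A s.
Proof.
move=> AB rs Br.
have := outer_leU Br (@outer_le_null _ (s - r) AB _); rewrite subrKC => H.
apply: (outer_leS _ _ (H _)) => //; last by rewrite subr_ge0 ltW.
by move=> w Aw; have [Bw|nBw] := pselect (B w); [left|right => /=; apply: contra_not nBw; apply].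
Qed.

(** The intersection of the hulls for the bounds [1 / (k + 1)] is a measurable null set containing
    [A]. Estimates for every [r] thus become almost sure statements. *)
Lemma outer_le0 A : (forall r, 0 < r -> outer_le A r) -> P.-negligible A.
Proof.
move=> H; have k0 (k : nat) : (0 : R) < k.+1%:R^-1 by [].
pose B k := sval (cid (H _ (k0 k))).
have BP k : [/\ measurable (B k), A `<=` B k & (P (B k) <= (k.+1%:R^-1)%:E)%E].
  by rewrite /B; case: cid.
exists (\bigcap_k B k); split.
- by apply: bigcapT_measurable => k; have [] := BP k.
- apply/eqP; rewrite eq_le measure_ge0 andbT; apply/lee_addgt0Pr => e e0.
  rewrite add0e; have [k ke] : exists k : nat, k.+1%:R^-1 < e.
    have [k] := ltr_add_invr (y := 0) (x := e) e0.
    by rewrite add0r => ?; exists k.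
  have [mB _ PB] := BP k.
  apply: (@le_trans _ _ (P (B k))).
    apply: le_measure; rewrite ?inE//; last exact: bigcap_inf.
    by apply: bigcapT_measurable => j; have [] := BP j.
  by rewrite (le_trans PB)// lee_fin ltW.
- by move=> w Aw k _; have [_ + _] := BP k; apply.
Qed.

Lemma cip_ae_eq f g u v : (forall n, {ae P, forall w, f n w = g n w}) ->
  {ae P, forall w, u w = v w} -> cip f u -> cip g v.
Proof.
move=> fg uv fu e r e0 r0.
have r2 : 0 < r / 2 by rewrite divr_gt0.
apply: filterS (fu e (r / 2) e0 r2) => n; apply: outer_le_ae; last first.
  by rewrite gtr_pMr// invf_lt1// ltr1n.
by apply: filterS2 (fg n) uv => w /= -> ->.
Qed.

Lemma cipD f g u v : cip f u -> cip g v ->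
  cip (fun n w => f n w + g n w) (fun w => u w + v w).
Proof.
move=> fu gv e r e0 r0; have e2 : 0 < e / 2 by rewrite divr_gt0.
have r2 : 0 < r / 2 by rewrite divr_gt0.
apply: filterS2 (fu _ _ e2 r2) (gv _ _ e2 r2) => n A B.
apply: outer_leS (outer_leU A B) => [w /=|]; last by rewrite -splitr.
move=> ew; have [?|f2] := leP (e / 2) `|f n w - u w|; [by left|right].
by have := ler_normD (f n w - u w) (g n w - v w); rewrite [_ - _ + _](_ : _ = f n w + g n w - (u w + v w)); [lra|ring].
Qed.

Lemma cip_cst u : cip (fun=> u) u.
Proof.
move=> e r e0 r0; apply: nearW => n; apply: outer_le_null; last exact: ltW.
rewrite [X in _.-negligible X](_ : _ = set0); first exact: negligible_set0.
by rewrite -subset0 => w /=; rewrite subrr normr0 leNgt e0.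
Qed.

Lemma cip0 f u : cip f u <-> cip (fun n w => f n w - u w) (fun=> 0).
Proof. by split=> H e r e0 r0; apply: filterS (H e r e0 r0) => n; apply: outer_leS => // w /=; rewrite subr0. Qed.

Lemma cipN f u : cip f u -> cip (fun n w => - f n w) (fun w => - u w).
Proof.
move=> H e r e0 r0; apply: filterS (H e r e0 r0) => n.
by apply: outer_leS => // w /=; rewrite opprK addrC distrC.
Qed.

Lemma cipB f g u v : cip f u -> cip g v ->
  cip (fun n w => f n w - g n w) (fun w => u w - v w).
Proof. by move=> fu /cipN; exact: cipD. Qed.

Lemma cip_subseq f u (m : nat -> nat) : m @ \oo --> \oo -> cip f u ->
  cip (fun n => f (m n)) u.
Proof. by move=> mo fu e r e0 r0; exact: (mo _ (fu e r e0 r0)). Qed.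

Lemma cip_le f g : (forall n, {ae P, forall w, `|f n w| <= g n w}) ->
  cip g (fun=> 0) -> cip f (fun=> 0).
Proof.
move=> fg H e r e0 r0.
have r2 : 0 < r / 2 by rewrite divr_gt0.
apply: filterS (H e (r / 2) e0 r2) => n; apply: outer_le_ae; last first.
  by rewrite gtr_pMr// invf_lt1// ltr1n.
apply: filterS (fg n) => w /=; rewrite !subr0 => fgw ef.
by rewrite (le_trans ef)// (le_trans fgw)// ler_norm.
Qed.

End OuterProbability.

(** The convention [0^-1 = 0] makes inversion total; it is continuous off the point 0, which is
    split off as a measurable piece. *)
Lemma measurable_inv (R : realType) : measurable_fun setT (fun x : R => x^-1).
Proof.
have m0 : measurable [set 0 : R] by exact: measurable_set1.
have -> : [set: R] = [set 0] `|` ~` [set 0] by rewrite setUv.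
apply/measurable_funU => //; first exact: measurableC.
split.
  apply: (eq_measurable_fun (cst (0 : R))) => // x; rewrite inE/= => ->.
  by rewrite invr0.
apply: open_continuous_measurable_fun.
  by rewrite openC; apply: accessible_closed_set1; exact: hausdorff_accessible.
by move=> x; rewrite inE/= => /eqP x0; exact: inv_continuous.
Qed.

(** * Limits in probability of measurable maps on a complete space *)

Section MeasurableConvergence.
Context {R : realType} {d : measure_display} {Omega : measurableType d}.
Variable P : probability Omega R.
Hypothesis complete_P : measure_is_complete P.
Implicit Types (A B : set Omega) (f g h : nat -> Omega -> R) (u v : Omega -> R).

Lemma ae_eq_measurable u v : measurable_fun setT u ->
  {ae P, forall w, u w = v w} -> measurable_fun setT v.
Proof.
move=> mu uv; apply/measurable_EFinP.
apply: (@ae_measurable_fun _ _ _ P complete_P _ (EFin \o u)).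
  by apply: filterS uv => w + _ /=; move=> ->.
exact/measurable_EFinP.
Qed.

(** The upper limit of the [f n] is measurable everywhere and equals [u] almost everywhere;
    completeness transfers measurability to [u]. *)
Lemma ae_lim_measurable f u : (forall n, measurable_fun setT (f n)) ->
  {ae P, forall w, f ^~ w @ \oo --> u w} -> measurable_fun setT u.
Proof.
move=> mf fu; apply/measurable_EFinP.
apply: (@ae_measurable_fun _ _ _ P complete_P _
  (fun w => limn_esup (fun n => (f n w)%:E))).
  apply: filterS fu => w fuw _ /=.
  have fuw' : (f n w)%:E @[n --> \oo] --> (u w)%:E by apply: cvg_EFin => //; exact: nearW.
  rewrite is_cvg_limn_esupE; last by apply/cvg_ex; exists (u w)%:E; exact: fuw'.
  exact/cvg_lim.
by apply: measurable_fun_limn_esup => n; exact/measurable_EFinP.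
Qed.

Lemma measurable_ge_dist u v (e : R) : measurable_fun setT u ->
  measurable_fun setT v -> measurable [set w | e <= `|u w - v w|].
Proof.
move=> mu mv.
have mn : measurable_fun setT (fun w => `|u w - v w|).
  by apply: measurableT_comp => //; exact: measurable_funB.
have := mn measurableT _ (measurable_itv `[e, +oo[).
rewrite setTI (_ : _ @^-1` _ = [set w | e <= `|u w - v w|])//.
by apply/seteqP; split => w /=; rewrite in_itv/= andbT.
Qed.

(** The unions of the bad events from index [n] on decrease to their upper limit, a null set by
    pointwise convergence. Continuity from above makes these unions small, and they serve as
    hulls. *)
Lemma ae_cip f u : (forall n, measurable_fun setT (f n)) ->
  {ae P, forall w, f ^~ w @ \oo --> u w} -> cip P f u.
Proof.
move=> mf fu e r e0 r0.
have mu := ae_lim_measurable mf fu.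
pose F n := [set w | e <= `|f n w - u w|].
have mF n : measurable (F n) by exact: measurable_ge_dist.
have limF : P (lim_sup_set F) = 0%E.
  apply/negligibleP.
    by apply: bigcap_measurable => // k _; exact: bigcup_measurable.
  apply: negligibleS fu => w Fw /= fuw.
  have /cvgrPdist_lt/(_ _ e0)[N _ NF] := fuw.
  have [k Nk] := Fw N I; rewrite /F /= leNgt distrC => /negP; apply.
  exact: NF.
have oo : (P (\bigcup_(k >= 0) F k) < +oo)%E.
  by rewrite (le_lt_trans (probability_le1 _ _)) ?ltry//; exact: bigcup_measurable.
have := lim_sup_set_cvg P F mF oo; rewrite [X in _ --> X](_ : _ = 0%E)//.
move=> /fine_cvgP[_ /cvgrPdist_lt/(_ _ r0)].
apply: filterS => n; rewrite sub0r normrN => Hn.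
exists (\bigcup_(k >= n) F k); split; first exact: bigcup_measurable.
- by move=> w Fw; exists n => /=.
- rewrite -[leLHS]fineK ?fin_num_measure//; last exact: bigcup_measurable.
  by rewrite lee_fin (le_trans (ler_norm _))// ltW.
Qed.

(** [u / (n + 1)] tends to 0 everywhere, hence in probability; the event where it has modulus at
    least 1 is [n + 1 <= |u|]. *)
Lemma tight u r : measurable_fun setT u -> 0 < r ->
  exists2 M, 0 < M & outer_le P [set w | M <= `|u w|] r.
Proof.
move=> mu r0.
have H : cip P (fun n w => u w / n.+1%:R) (fun=> 0).
  apply: ae_cip => [n|]; first exact: measurable_funM.
  apply: aeW => w; rewrite -[X in _ --> X](mulr0 (u w)).
  by apply: cvgMr; exact: cvg_harmonic.
have [n _ /(_ _ (leqnn _)) Hn] := H _ _ (@ltr01 R) r0.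
exists n.+1%:R => //; apply: outer_leS Hn => // w /=.
by rewrite subr0 normrM normfV normr_nat ler_pdivlMr// mul1r.
Qed.

Lemma tight_inv u r : measurable_fun setT u -> {ae P, forall w, u w != 0} ->
  0 < r -> exists2 k, 0 < k & outer_le P [set w | `|u w| <= k] r.
Proof.
move=> mu u0 r0.
have mV : measurable_fun setT (fun w => (u w)^-1).
  by apply: measurableT_comp mu; exact: measurable_inv.
have r2 : 0 < r / 2 by rewrite divr_gt0.
have [M M0 HM] := tight mV r2.
exists M^-1; first by rewrite invr_gt0.
apply: outer_le_ae HM; last by rewrite gtr_pMr// invf_lt1// ltr1n.
apply: filterS u0 => w /= uw; rewrite normfV.
by rewrite -[M in _ -> M <= _]invrK lef_pV2 ?posrE ?invr_gt0 ?normr_gt0.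
Qed.

(** Off small events [|g n| < M + 1], where [M] bounds [|u|], so [|f n| < e / (M + 1)] is enough. *)
Lemma cipM0 f g u : measurable_fun setT u -> cip P f (fun=> 0) -> cip P g u ->
  cip P (fun n w => f n w * g n w) (fun=> 0).
Proof.
move=> mu f0 gu e r e0 r0.
have r3 : 0 < r / 3 by rewrite divr_gt0.
have [M M0 HM] := tight mu r3.
have eM : 0 < e / (M + 1) by rewrite divr_gt0// ltr_wpDr.
apply: filterS2 (f0 _ _ eM r3) (gu _ _ ltr01 r3) => n A B.
apply: outer_leS (outer_leU (outer_leU A B) HM) => [w /=|]; last lra.
rewrite !subr0 => efg.
have [?|fn] := leP (e / (M + 1)) `|f n w|; [by left; left|].
have [?|gn] := leP 1 `|g n w - u w|; [by left; right|right].
rewrite leNgt; apply/negP => uM; move: efg; rewrite leNgt => /negP; apply.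
have gM : `|g n w| < M + 1.
  by have := ler_normD (g n w - u w) (u w); rewrite subrK; lra.
rewrite normrM; have -> : e = (e / (M + 1)) * (M + 1) by rewrite divfK// gt_eqF// ltr_wpDr// ltW.
by apply: ltr_pM.
Qed.

(** Two applications of [cipM0], to [f g - u v = (f - u) g + (g - v) u]. *)
Lemma cipM f g u v : measurable_fun setT u -> measurable_fun setT v ->
  cip P f u -> cip P g v -> cip P (fun n w => f n w * g n w) (fun w => u w * v w).
Proof.
move=> mu mv fu gv; apply/cip0.
have H1 := cipM0 mv ((cip0 _ _ _).1 fu) gv.
have H2 := cipM0 mu ((cip0 _ _ _).1 gv) (cip_cst P u).
have := cipD H1 H2; apply: cip_ae_eq => [n|]; apply: aeW => w; ring.
Qed.

Lemma cipV f u : measurable_fun setT u -> {ae P, forall w, u w != 0} ->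
  cip P f u -> cip P (fun n w => (f n w)^-1) (fun w => (u w)^-1).
Proof.
move=> mu u0 fu e r e0 r0.
have r3 : 0 < r / 3 by rewrite divr_gt0.
have [k k0 Hk] := tight_inv mu u0 r3.
have k2 : 0 < k / 2 by rewrite divr_gt0.
(* Once [|u| > k] and [|f n| > k / 2], the inverses differ by at most [|f n - u| / (k ^ 2 / 2)],
   hence this threshold. *)
have ek : 0 < e * (k / 2) * k by rewrite !mulr_gt0.
apply: filterS2 (fu _ _ k2 r3) (fu _ _ ek r3) => n A B.
apply: outer_leS (outer_leU (outer_leU A B) Hk) => [w /=|]; last lra.
move=> efg.
have [?|fn] := leP (k / 2) `|f n w - u w|; [by left; left|].
have [?|gn] := leP (e * (k / 2) * k) `|f n w - u w|; [by left; right|right].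
rewrite leNgt; apply/negP => uk; move: efg; rewrite leNgt => /negP; apply.
have fk : k / 2 < `|f n w|.
  have := ler_normD (f n w) (u w - f n w); rewrite subrKC (distrC (u w)); lra.
have f0 : f n w != 0 by rewrite -normr_gt0 (lt_trans k2).
have uu : u w != 0 by rewrite -normr_gt0 (lt_trans k0).
have -> : (f n w)^-1 - (u w)^-1 = - (f n w - u w) / (f n w * u w) by field; rewrite uu f0.
rewrite normrM normrN normfV normrM ltr_pdivrMr ?mulr_gt0 ?normr_gt0//.
rewrite (lt_trans gn)// -mulrA ltr_pM2l//.
by apply: ltr_pM => //; exact: ltW.
Qed.

(** Along [m], successive differences reach [2 ^ -(k + 1)] with probability at most [2 ^ -(k + 1)].
    By Borel-Cantelli almost every path is eventually dominated by a geometric series, so it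
    converges. A limit along a subsequence is all that the definition of the Ito integral asks
    for. *)
Lemma cip_cauchy f : (forall n, measurable_fun setT (f n)) ->
  (forall e r : R, 0 < e -> 0 < r -> exists N, forall n m, (N <= n)%N -> (N <= m)%N ->
    outer_le P [set w | e <= `|f n w - f m w|] r) ->
  exists (m : nat -> nat) u, [/\ forall k, (k <= m k)%N,
    measurable_fun setT u & cip P (fun k => f (m k)) u].
Proof.
move=> mf fC.
pose e (k : nat) : R := 1 / (2 ^ (k + 1))%:R.
have e0 k : 0 < e k by rewrite divr_gt0// ltr0n expn_gt0.
pose N k := sval (cid (fC _ _ (e0 k) (e0 k))).
have NP k n m : (N k <= n)%N -> (N k <= m)%N ->
    outer_le P [set w | e k <= `|f n w - f m w|] (e k).
  by rewrite /N; case: cid => /= ? H; exact: H.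
(* The summand [k] gives [k <= m k]; the sum dominates every [N j] with [j <= k], so [m k] and
   [m k.+1] are both past [N k]. *)
pose m k := (k + \sum_(j < k.+1) N j)%N.
have Nm k j : (j <= k)%N -> (N j <= m k)%N.
  rewrite -ltnS => jk; rewrite /m (bigD1 (Ordinal jk))//=.
  by rewrite addnCA leq_addr.
pose g k := f (m k).
pose F k := [set w | e k <= `|g k.+1 w - g k w|].
have mF k : measurable (F k) by exact: (measurable_ge_dist _ (mf _) (mf _)).
have PF : P (lim_sup_set F) = 0%E.
  apply: lim_sup_set_cvg0 => //.
  apply: (@le_lt_trans _ _ (\sum_(n <oo) (e n)%:E)%E).
    apply: lee_nneseries => // k _.
    by apply: outer_leP => //; apply: NP; exact: Nm.
  rewrite (_ : limn _ = (1 / 2 ^+ 0)%:E) ?ltry//.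
  by apply: cvg_lim => //; exact: cvg_geometric_eseries_half.
have gcvg : {ae P, forall w, cvgn (g ^~ w)}.
  exists (lim_sup_set F); split => //.
    by apply: bigcap_measurable => // k _; exact: bigcup_measurable.
  move=> w; apply: contra_notP => /= /existsNP[K] /not_implyP[_ HK].
  have lt k : (K <= k)%N -> `|g k.+1 w - g k w| < e k.
    by move=> Kk; rewrite ltNge; apply/negP => ?; apply: HK; exists k.
  pose q n := g (n + K)%N w.
  have : cvgn q.
    have -> : q = series (telescope q) \+ cst (q 0%N).
      by rewrite telescopeK; apply/funext => n /=; rewrite subrK.
    apply: is_cvgD; last exact: is_cvg_cst.
    apply: normed_cvg.
    apply: (@series_le_cvg _ _ (geometric 1 (2^-1))) => [n|n|n|].
    - exact: normr_ge0.
    - exact: geometric_ge0.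
    - apply: le_trans (ltW (lt _ (leq_addl n K))) _; rewrite /e /=.
      rewrite div1r mul1r exprVn -natrX lef_pV2 ?posrE ?ltr0n ?expn_gt0//.
      by rewrite ler_nat leq_pexp2l// -addnA leq_addr.
    - apply: is_cvg_geometric_series; rewrite ger0_norm//.
      by rewrite invf_lt1// ltr1n.
  by move=> /cvg_ex[l] /= ql; apply/cvg_ex; exists l; rewrite -(cvg_shiftn K).
exists m, (fun w => lim (g ^~ w @ \oo)).
have gl : {ae P, forall w, g ^~ w @ \oo --> lim (g ^~ w @ \oo)}.
  by apply: filterS gcvg.
split; first by move=> k; rewrite leq_addr.
- by apply: ae_lim_measurable gl => k; exact: mf.
- by apply: ae_cip => // k; exact: mf.
Qed.

Lemma cip_cvg_in_probability f u : (forall n, measurable_fun setT (f n)) ->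
  measurable_fun setT u ->
  cip P f u <-> cvg_in_probability P (V := R^o) f u.
Proof.
move=> mf mu; pose A e n := [set w | e <= `|f n w - u w|].
have mA e n : measurable (A e n) by exact: measurable_ge_dist.
have fA e n : P (A e n) \is a fin_num by exact: fin_num_measure.
suff H e : 0 < e -> (forall r, 0 < r -> \forall n \near \oo, outer_le P (A e n) r)
    <-> (fun n => P (A e n)) @ \oo --> 0%E.
  by split => [fu e e0|fu e r e0 r0];
    [apply/(H e e0) => r; exact: fu|exact: ((H e e0).2 (fu e e0))].
move=> e0; split => [fu|/fine_cvgP[_ /cvgrPdist_le fu] r r0].
- apply/fine_cvgP; split; first exact: nearW.
  apply/cvgrPdist_le => r r0; apply: filterS (fu _ r0) => n H.
  rewrite sub0r normrN ger0_norm; last by rewrite fine_ge0.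
  by rewrite -lee_fin fineK//; exact: outer_leP.
- apply: filterS (fu r r0) => n; rewrite sub0r normrN => H; apply: outer_le_meas => //.
  by rewrite -(fineK (fA _ _)) lee_fin (le_trans (ler_norm _)).
Qed.

End MeasurableConvergence.

(** * Gaussian estimates *)

Section Density.
Context d (T : measurableType d) (R : realType).
Variables (mu nu : {measure set T -> \bar R}) (g : T -> R).
Hypotheses (mg : measurable_fun setT g) (g0 : forall x, 0 <= g x)
  (nuE : forall A, measurable A -> nu A = (\int[mu]_(x in A) (g x)%:E)%E).
Local Open Scope ereal_scope.
Import HBNNSimple.

Let integral_density_indic A : measurable A ->
  \int[nu]_x (\1_A x)%:E = \int[mu]_x ((\1_A x)%:E * (g x)%:E).
Proof.
move=> mA; rewrite integral_indic// setIT nuE// integral_mkcond.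
apply: eq_integral => x _; rewrite patchE indicE.
by case: (x \in A); rewrite ?mul1e ?mul0e.
Qed.

Let integral_density_nnsfun (f : {nnsfun T >-> R}) :
  \int[nu]_x (f x)%:E = \int[mu]_x ((f x)%:E * (g x)%:E).
Proof.
under [LHS]eq_integral do rewrite fimfunE -fsumEFin//.
rewrite [LHS]ge0_integral_fsum//; last 2 first.
  - by move=> r; exact/measurable_EFinP/measurableT_comp.
  - by move=> n x _; rewrite EFinM nnfun_muleindic_ge0.
under [RHS]eq_integral.
  move=> x xD; rewrite fimfunE -fsumEFin// ge0_mule_fsuml; last first.
    by move=> r; rewrite EFinM nnfun_muleindic_ge0.
  over.
rewrite [RHS]ge0_integral_fsum//; last 2 first.
  - move=> r; apply: emeasurable_funM; last exact/measurable_EFinP.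
    by apply/measurable_EFinP/measurableT_comp.
  - move=> n x _; rewrite EFinM mule_ge0//; last by rewrite lee_fin.
    by rewrite nnfun_muleindic_ge0.
apply: eq_fsbigr => r _.
under [RHS]eq_integral do rewrite EFinM -muleA.
rewrite integralZl_indic_nnsfun//= integral_density_indic//.
have [r0|r0] := leP 0%R r.
  rewrite ge0_integralZl//.
  - by apply: emeasurable_funM; exact/measurable_EFinP.
  - by move=> x _; rewrite mule_ge0// lee_fin.
rewrite preimage_nnfun0// integral0_eq ?mule0 => [|x _]; last first.
  by rewrite indicE in_set0 mul0e.
by rewrite integral0_eq// => x _; rewrite indicE in_set0 mul0e mule0.
Qed.

(** Indicators, then simple functions, then monotone limits. It turns integrals against
    [normal_prob], which is given by its density, into Lebesgue integrals. *)
Lemma ge0_integral_density (f : T -> \bar R) :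
  measurable_fun setT f -> (forall x, 0 <= f x) ->
  \int[nu]_x f x = \int[mu]_x (f x * (g x)%:E).
Proof.
move=> mf f0.
pose f_ := nnsfun_approx measurableT mf.
transitivity (lim (\int[nu]_x (f_ n x)%:E @[n --> \oo])).
  rewrite -monotone_convergence//=.
  - apply: eq_integral => ? /[!inE] xD; apply/esym/cvg_lim => //=.
    exact: cvg_nnsfun_approx.
  - by move=> n; exact/measurable_EFinP/measurable_funTS.
  - by move=> n ? _; rewrite lee_fin.
  - by move=> ? _ ? ? mn; rewrite lee_fin; exact/lefP/nd_nnsfun_approx.
transitivity (lim (\int[mu]_x ((f_ n x)%:E * (g x)%:E) @[n --> \oo])).
  by under eq_fun do rewrite integral_density_nnsfun.
rewrite -monotone_convergence//=.
- apply: eq_integral => x _; apply/cvg_lim => //; apply: cvgeZr => //.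
  exact: cvg_nnsfun_approx.
- move=> n; apply: emeasurable_funM; exact/measurable_EFinP.
- by move=> n ? _; rewrite mule_ge0// lee_fin.
- move=> x _ m n mn; rewrite lee_wpmul2r ?lee_fin//; exact/lefP/nd_nnsfun_approx.
Qed.

End Density.

Section Gaussian.
Context {R : realType}.
Local Notation mu := (@lebesgue_measure R).
Implicit Types (s x y z r : R).

(** Reflection keeps the length of half-open intervals, and these determine Lebesgue measure. *)
Lemma lebesgue_measure_opp (A : set R) : measurable A ->
  mu ((-%R) @^-1` A) = mu A.
Proof.
move=> mA.
pose opp_mixin := isMeasurableFun.Build _ _ (measurableTypeR R) (measurableTypeR R) (-%R : R -> R) (@oppr_measurable R setT).
pose opp : {mfun measurableTypeR R >-> measurableTypeR R} := HB.pack (-%R : R -> R) opp_mixin.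
transitivity (pushforward mu opp A); first by [].
suff H : forall X, ocitv X -> mu X = pushforward mu opp X by exact/esym/(lebesgue_measure_unique H).
move=> X [[a b] /= ab <-]; rewrite /pushforward/=.
rewrite (_ : _ @^-1` _ = `[- b, - a[%classic).
  rewrite !lebesgue_measure_itv/= !lte_fin ltrN2; case: ifP => // _.
  by rewrite -!EFinB opprK addrC.
by apply/seteqP; split => x /=; rewrite !in_itv/= lerNl ltrNr andbC.
Qed.

Lemma normal_pdf_opp s x : s != 0 -> normal_pdf 0 s (- x) = normal_pdf 0 s x.
Proof. by move=> s0; rewrite !normal_pdfE// /normal_fun !subr0 sqrrN. Qed.

Lemma normal_prob_opp s (A : set R) : s != 0 -> measurable A ->
  normal_prob 0 s ((-%R) @^-1` A) = normal_prob 0 s A.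
Proof.
move=> s0 mA; rewrite /normal_prob.
pose opp_mixin := isMeasurableFun.Build _ _ (measurableTypeR R) (measurableTypeR R) (-%R : R -> R) (@oppr_measurable R setT).
pose opp : {mfun measurableTypeR R >-> measurableTypeR R} := HB.pack (-%R : R -> R) opp_mixin.
have mp : measurable_fun setT (EFin \o normal_pdf 0 s).
  by apply/measurable_EFinP; exact: measurable_normal_pdf.
transitivity (\int[pushforward mu opp]_(x in A) (normal_pdf 0 s x)%:E)%E.
  rewrite ge0_integral_pushforward//=.
  - by apply: eq_integral => x _ /=; rewrite normal_pdf_opp.
  - exact: measurable_funTS.
  - by move=> x _; rewrite lee_fin normal_pdf_ge0.
by apply: eq_measure_integral => X mX XA; exact: lebesgue_measure_opp.
Qed.

(** The integrand is compared with [6 * s ^+ 2] times the density of standard deviation [2 s], whose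
    integral is 1. The quotient of the two densities is [2 * expR (- u)] with [u = 3 x^2 / (8 s^2)],
    and [u * expR (- u) <= 1] bounds [x^2] times it by [16 / 3 * s ^+ 2]. The later estimates only
    use the order [s ^+ 2]. *)
Lemma normal_second_moment s : 0 < s ->
  (\int[normal_prob 0 s]_x (x ^+ 2)%:E <= (6 * s ^+ 2)%:E)%E.
Proof.
move=> s0.
rewrite (ge0_integral_density (mu := mu) (nu := normal_prob 0 s) (measurable_normal_pdf 0 s)
  (normal_pdf_ge0 0 s) (fun _ _ => erefl)); last first.
- by move=> x; rewrite lee_fin sqr_ge0.
- by apply/measurable_EFinP; exact: measurable_funX.
have s20 : s *+ 2 != 0 by rewrite mulrn_eq0/= gt_eqF.
have -> : (6 * s ^+ 2)%:E = ((6 * s ^+ 2)%:E * \int[mu]_x (normal_pdf 0 (s *+ 2) x)%:E)%E.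
  by rewrite integral_normal_pdf mule1.
rewrite -ge0_integralZl//=; last 3 first.
- by apply/measurable_EFinP; exact: measurable_normal_pdf.
- by move=> x _; rewrite lee_fin normal_pdf_ge0.
- by rewrite lee_fin mulr_ge0// sqr_ge0.
apply: ge0_le_integral => //=.
- by move=> x _; rewrite lee_fin mulr_ge0 ?normal_pdf_ge0// sqr_ge0.
- apply/measurable_EFinP; apply: measurable_funM; [exact: measurable_funX|exact: measurable_normal_pdf].
- by apply/measurable_EFinP; apply: measurable_funM => //; exact: measurable_normal_pdf.
move=> x _; rewrite lee_fin !normal_pdfE ?gt_eqF// ?mulrn_wgt0//.
have -> : normal_peak s = 2 * normal_peak (s *+ 2).
  rewrite /normal_peak (_ : (s *+ 2) ^+ 2 * pi *+ 2 = 2 ^+ 2 * (s ^+ 2 * pi *+ 2)); last by ring.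
  rewrite (sqrtrM (s ^+ 2 * pi *+ 2)) ?sqr_ge0// sqrtr_sqr.
  by rewrite normr_nat invfM mulrA divff// mul1r.
rewrite /normal_fun !subr0.
set c := normal_peak _.
have c0 : 0 <= c by exact: normal_peak_ge0.
set u := 3 * x ^+ 2 / (8 * s ^+ 2).
have -> : - x ^+ 2 / (s ^+ 2 *+ 2) = - x ^+ 2 / ((s *+ 2) ^+ 2 *+ 2) - u.
  by rewrite /u; field; rewrite gt_eqF.
rewrite expRD; set E := expR (- x ^+ 2 / _).
have E0 : 0 <= E by exact: expR_ge0.
have ue : u * expR (- u) <= 1.
  rewrite expRN ler_pdivrMr ?expR_gt0// mul1r.
  by rewrite (le_trans _ (expR_ge1Dx u))// lerDr.
have -> : x ^+ 2 * (2 * c * (E * expR (- u))) =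
   (u * expR (- u)) * (16 / 3 * s ^+ 2) * (c * E).
  by rewrite /u; field; rewrite gt_eqF.
rewrite ler_wpM2r ?mulr_ge0//.
have s2 : 0 <= s ^+ 2 by exact: sqr_ge0.
rewrite (@le_trans _ _ (1 * (16 / 3 * s ^+ 2)))//; last by nra.
by rewrite ler_wpM2r// mulr_ge0.
Qed.

(** The density is at most its peak, which is at most [1 / s] since [2 pi >= 1], and the interval
    has length [2 r]. The centre [z] is arbitrary: this is the absence of atoms in quantitative
    form. *)
Lemma normal_prob_small_ball s z r : 0 < s -> 0 <= r ->
  (normal_prob 0 s `[(z - r)%R, (z + r)%R] <= (2 * r / s)%:E)%E.
Proof.
move=> s0 r0.
apply: (@le_trans _ _ (\int[mu]_(x in `[(z - r)%R, (z + r)%R]) (normal_peak s)%:E))%E.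
  apply: ge0_le_integral => //=.
  - by move=> x _; rewrite lee_fin normal_pdf_ge0.
  - by apply/measurable_EFinP/measurable_funTS; exact: measurable_normal_pdf.
  - by move=> x _; rewrite lee_fin normal_pdf_ub// gt_eqF.
rewrite integral_cst//= lebesgue_measure_itv/= lte_fin.
have pi20 : 0 < pi *+ 2 :> R by rewrite mulr2n addr_gt0 ?pi_gt0.
have ps : normal_peak s <= s^-1.
  rewrite /normal_peak lef_pV2 ?posrE// ?sqrtr_gt0.
    rewrite -mulrnAr sqrtrM ?sqr_ge0// sqrtr_sqr gtr0_norm// ler_peMr ?ltW//.
    rewrite -[ltLHS]sqrtr1 ltr_sqrt//.
    by have := @pi_ge2 R; rewrite mulr2n; lra.
  by rewrite -mulrnAr mulr_gt0// exprn_gt0.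
case: ifPn => _; last by rewrite mule0 lee_fin divr_ge0 ?mulr_ge0// ltW.
rewrite -EFinB -EFinM lee_fin; have -> : z + r - (z - r) = 2 * r by ring.
by rewrite mulrC ler_wpM2l// mulr_ge0.
Qed.

End Gaussian.

(** * Independence of the increments from the past *)

Section Freezing.
Context {R : realType} {d : measure_display} {Omega : measurableType d}
  (P : probability Omega R) d1 (E : measurableType d1) d2 (U : measurableType d2).
Variables (Z : Omega -> E) (D : Omega -> U) (nu : probability U R).
Hypotheses (mZ : measurable_fun setT Z) (mD : measurable_fun setT D)
  (ZD : forall A C, measurable A -> measurable C ->
    P (Z @^-1` A `&` D @^-1` C) = (P (Z @^-1` A) * nu C)%E).

(* The pair [(Z, D)] has the product law. *)
Lemma freezing (f : E * U -> \bar R) : measurable_fun setT f ->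
  (forall p, 0 <= f p)%E ->
  (\int[P]_w f (Z w, D w) = \int[P]_w \int[nu]_y f (Z w, y))%E.
Proof.
move=> mf f0.
pose Zm := isMeasurableFun.Build _ _ _ _ Z mZ.
pose Zp : {mfun Omega >-> E} := HB.pack Z Zm.
have mZD : measurable_fun setT (fun w => (Z w, D w)) by exact: measurable_fun_pair.
pose ZDm := isMeasurableFun.Build _ _ _ _ _ mZD.
pose ZDp : {mfun Omega >-> (E * U)%type} := HB.pack (fun w => (Z w, D w)) ZDm.
transitivity (\int[pushforward P ZDp]_p f p)%E.
  by rewrite ge0_integral_pushforward.
transitivity (\int[(distribution P Zp \x nu)%E]_p f p)%E.
  apply: eq_measure_integral => A mA _; apply/esym.
  apply: product_measure_unique mA => B C mB mC.
  exact: ZD.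
rewrite fubini_tonelli1// ge0_integral_pushforward//=.
  exact: measurable_fun_fubini_tonelli_F.
by move=> x _; apply: integral_ge0 => y _.
Qed.

End Freezing.

Section PiLambda.
Context {R : realType} {d : measure_display} {Omega : measurableType d}.
Variable P : probability Omega R.

(** Dynkin's argument: with [D] fixed, the measurable sets that satisfy the product formula form a
    lambda-system. *)
Lemma indep_generated (C : set (set Omega)) (D : set Omega) :
  setI_closed C -> C `<=` measurable -> measurable D ->
  (forall A, C A -> P (A `&` D) = (P A * P D)%E) ->
  forall A, <<s C >> A -> P (A `&` D) = (P A * P D)%E.
Proof.
move=> CI Cm mD CD A sA.
suff : <<s C >> `<=` [set A | measurable A /\ P (A `&` D) = (P A * P D)%E].
  by move=> /(_ _ sA)[].
apply: lambda_system_subset; [by []| | |by []].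
- apply/dynkin_lambda_system; split => /=.
  + by split=> //; rewrite setTI probability_setT mul1e.
  + move=> B [mB PB]; split; first exact: measurableC.
    have PDoo : (P D < +oo)%E by rewrite (le_lt_trans (probability_le1 _ _)) ?ltry.
    have : P (D `\` B) = (P D - P (D `&` B))%E by exact: measureD.
    rewrite (setIC D B) PB setDE setIC => ->.
    have -> : P (~` B) = (1 - P B)%E by exact: probability_setC.
    have fB : P B \is a fin_num by exact: fin_num_measure.
    have fD : P D \is a fin_num by exact: fin_num_measure.
    by rewrite -(fineK fB) -(fineK fD) -EFinM -!EFinB -EFinM mulrBl mul1r.
  + move=> F tF Fm.
    have mF n : measurable (F n) by have [] := Fm n.
    split; first exact: bigcup_measurable.
    have fD : P D \is a fin_num by exact: fin_num_measure.
    have PU : P (\bigcup_k F k) = (\sum_(k <oo) P (F k))%E.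
      by rewrite measure_bigcup//; apply: eq_eseriesl => k; rewrite in_setT.
    have PUD : P (\bigcup_k (F k `&` D)) = (\sum_(k <oo) P (F k `&` D))%E.
      rewrite measure_bigcup//; first by apply: eq_eseriesl => k; rewrite in_setT.
        by move=> k _; exact: measurableI.
      by apply: trivIset_setIr.
    rewrite setI_bigcupl PUD PU muleC -(fineK fD) -nneseriesZl; last by [].
    by apply: eq_eseriesr => n _; rewrite (fineK fD) muleC; have [] := Fm n.
- by move=> B CB; split; [exact: Cm|exact: CD].
Qed.

Lemma sigma_generated_mono (G K : set (set Omega)) :
  G `<=` K -> <<s G >> `<=` <<s K >>.
Proof. by apply: sub_smallest2r; exact: smallest_sigma_algebra. Qed.

Lemma sigma_process_sub (J : set R) (Z : R -> Omega -> R) :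
  (forall u, J u -> measurable_fun setT (Z u)) ->
  sigma_process J Z `<=` measurable.
Proof.
move=> mZ; apply: smallest_sub; first exact: sigma_algebra_measurable.
move=> A [u Ju [B mB <-]]; exact: mZ.
Qed.

Lemma indep_systemsC (G K : set (set Omega)) :
  indep_systems P G K -> indep_systems P K G.
Proof. by move=> H A C KA GC; rewrite setIC muleC H. Qed.

Lemma sigma_process_incr (J : set R) (Z : R -> Omega -> R) s t : J s -> J t ->
  preimages (fun w => Z t w - Z s w) `<=` sigma_process J Z.
Proof.
move=> Js Jt _ [B mB <-].
have mZ u : J u -> measurable_fun setT (Z u : g_sigma_algebraType (\bigcup_(u in J) preimages (Z u)) -> R).
  move=> Ju _ C mC; apply: sub_sigma_algebra; exists u => //; exists C => //.
exact: (measurable_funB (mZ t Jt) (mZ s Js)).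
Qed.

End PiLambda.

(** * The augmented filtration and Wiener processes relative to a filtration *)

Section FilteredWiener.
Context {R : realType} {d : measure_display} {Omega : measurableType d}.
Variable P : probability Omega R.
Hypothesis complete_P : measure_is_complete P.

(** Being a sigma-algebra is expressed as a fixed point of generation, so that
    [g_sigma_algebraType (F t)] has exactly the sets of [F t] as its measurable sets. *)
Record filtration (F : R -> set (set Omega)) : Prop := {
  filtration_sigma : forall t : R, <<s F t >> = F t ;
  filtration_meas : forall t : R, 0 <= t -> F t `<=` measurable ;
  filtration_mono : forall s t : R, 0 <= s -> s <= t -> F s `<=` F t }.

(** [F] may be larger than the history of [W]: here it also carries the other noise and the initial
    values. Increments independent of all of [F] let [W] and [B] be treated alike. *)
Record filtered_wiener (F : R -> set (set Omega)) (W : R -> Omega -> R) : Prop := {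
  fwiener_adapted : adapted F W ;
  fwiener_indep : forall s t : R, 0 <= s -> s < t ->
    indep_systems P (F s) (preimages (fun w => W t w - W s w)) ;
  fwiener_normal : forall s t : R, 0 <= s -> s < t ->
    forall V : set R, measurable V ->
      P [set w | V (W t w - W s w)] = normal_prob 0 (Num.sqrt (t - s)) V }.

Lemma augmented_filtrationC W B y0 x0 :
  augmented_filtration P W B y0 x0 = augmented_filtration P B W y0 x0.
Proof.
by apply/funext => t; rewrite /augmented_filtration /sigma_noise (setUC (sigma_process _ W)).
Qed.

Section augmented.
Variables (W B : R -> Omega -> R) (y0 x0 : Omega -> R).
Hypotheses (wW : wiener_process P W)
  (mB : forall t : R, 0 <= t -> measurable_fun setT (B t))
  (my0 : measurable_fun setT y0) (mx0 : measurable_fun setT x0)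
  (WB : indep_systems P (sigma_process `[0, +oo[ W) (sigma_process `[0, +oo[ B))
  (init_indep : indep_systems P (sigma_initial y0 x0) (sigma_noise `[0, +oo[ W B)).

Let F := augmented_filtration P W B y0 x0.

Let ge0 (u : R) : u \in `[0, +oo[ -> 0 <= u. Proof. by rewrite in_itv/= andbT. Qed.

Let sW (J : set R) : J `<=` `[0, +oo[%classic -> sigma_process J W `<=` measurable.
Proof.
by move=> J0; apply: sigma_process_sub => u /J0/ge0 u0; exact: (wiener_measurable wW u0).
Qed.

Let sB (J : set R) : J `<=` `[0, +oo[%classic -> sigma_process J B `<=` measurable.
Proof. by move=> J0; apply: sigma_process_sub => u /J0/ge0 u0; exact: mB. Qed.

Let J0 (t : R) : `[0, t]%classic `<=` `[0, +oo[%classic.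
Proof. by move=> u /=; rewrite !in_itv/= => /andP[->]. Qed.

Let s0 : sigma_initial y0 x0 `<=` measurable.
Proof.
apply: smallest_sub; first exact: sigma_algebra_measurable.
by move=> A [] [C mC <-]; [exact: my0|exact: mx0].
Qed.

Let sigma_process_mono (J K : set R) (Z : R -> Omega -> R) : J `<=` K ->
  sigma_process J Z `<=` sigma_process K Z.
Proof.
by move=> JK; apply: sigma_generated_mono => A [u /JK Ku uA]; exists u.
Qed.

Let gI (G : set (set Omega)) (A C : set Omega) :
  <<s G >> A -> <<s G >> C -> <<s G >> (A `&` C).
Proof. exact: (@measurableI _ (g_sigma_algebraType G)). Qed.

Lemma filtration_augmented : filtration F.
Proof.
split.
- move=> t; apply/seteqP; split; last exact: sub_sigma_algebra.
  by apply: smallest_sub => //; exact: smallest_sigma_algebra.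
- move=> t t0; apply: smallest_sub; first exact: sigma_algebra_measurable.
  move=> A [[|]|]; last exact: complete_P.
    apply: smallest_sub; first exact: sigma_algebra_measurable.
    by move=> {}A [|]; [apply: sW|apply: sB]; exact: J0.
  exact: s0.
- move=> s t hs st; apply: sigma_generated_mono; apply: setSU; apply: setSU.
  apply: sigma_generated_mono; apply: setUSS; apply: sigma_process_mono => u /=;
  by rewrite !in_itv/= => /andP[->/= us]; exact: le_trans st.
Qed.

(** [F s] is generated by a pi-system: intersections of an event of the past of [W], one of the past
    of [B] and an initial one, together with the negligible sets. On such intersections the product
    formula follows from three independences: initial values from noise, [W] from [B], and the
    increment from the past of [W]. *)
Lemma augmented_indep (s t : R) : 0 <= s -> s < t ->
  indep_systems P (F s) (preimages (fun w => W t w - W s w)).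
Proof.
move=> hs st A D FA mD.
have t0 : 0 <= t by rewrite (le_trans hs)// ltW.
have DW : sigma_process `[0, +oo[ W D.
  by apply: sigma_process_incr mD; rewrite /= in_itv/= andbT.
have mD' : measurable D by apply: sW DW.
pose C : set (set Omega) := [set A | exists A1 A2 A3,
   [/\ sigma_process `[0, s] W A1, sigma_process `[0, s] B A2,
       sigma_initial y0 x0 A3 & A = A1 `&` A2 `&` A3]] `|` P.-negligible.
have CI : setI_closed C.
  move=> A1 A2 [|]; last by move=> n1 _; right; apply: negligibleS n1; exact: subIsetl.
  move=> [B1 [B2 [B3 [h1 h2 h3 ->]]]] [|]; last first.
    by move=> n1; right; apply: negligibleS n1; exact: subIsetr.
  move=> [C1 [C2 [C3 [k1 k2 k3 ->]]]]; left.
  exists (B1 `&` C1), (B2 `&` C2), (B3 `&` C3); split; try exact: gI.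
  by rewrite -!setIA; apply/seteqP; split => w /=; tauto.
have nI (E : set Omega) : P.-negligible E -> P (E `&` D) = (P E * P D)%E.
  move=> nE; have mE := complete_P nE.
  have E0 : P E = 0%E by apply/negligibleP.
  rewrite E0 mul0e; apply/eqP; rewrite -measure_le0 -E0.
  by apply: le_measure; rewrite ?inE//; exact: measurableI.
apply: (@indep_generated _ _ _ P C) => //.
- move=> E [|]; last exact: complete_P.
  move=> [A1 [A2 [A3 [h1 h2 h3 ->]]]].
  apply: measurableI; last exact: s0.
  by apply: measurableI; [apply: (sW _ h1)|apply: (sB _ h2)]; exact: J0.
- move=> E [|]; last exact: nI.
  move=> [A1 [A2 [A3 [h1 h2 h3 ->]]]].
  have k1 : sigma_process `[0, +oo[ W A1 by apply: sigma_process_mono h1; exact: J0.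
  have k2 : sigma_process `[0, +oo[ B A2 by apply: sigma_process_mono h2; exact: J0.
  have nW (X : set Omega) : sigma_process `[0, +oo[ W X -> sigma_noise `[0, +oo[ W B X.
    by move=> ?; apply: sub_sigma_algebra; left.
  have nB (X : set Omega) : sigma_process `[0, +oo[ B X -> sigma_noise `[0, +oo[ W B X.
    by move=> ?; apply: sub_sigma_algebra; right.
  have -> : A1 `&` A2 `&` A3 `&` D = A3 `&` ((A1 `&` D) `&` A2).
    by apply/seteqP; split => w /=; tauto.
  rewrite init_indep//; last by apply: gI; [by apply: nW; exact: gI|exact: nB].
  rewrite WB//; last exact: gI.
  rewrite (wiener_indep wW hs st h1 mD) [in RHS]setIC init_indep//; last by apply: gI; [exact: nW|exact: nB].
  by rewrite WB// -!muleA; congr (_ * _)%E; congr (_ * _)%E; rewrite muleC.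
- move: FA; apply: smallest_sub; first exact: smallest_sigma_algebra.
  have cT X : sigma_process `[0, s] X setT by exact: (@measurableT _ (g_sigma_algebraType _)).
  have c0 : sigma_initial y0 x0 setT by exact: (@measurableT _ (g_sigma_algebraType _)).
  move=> E [[|]|] HE; last by apply: sub_sigma_algebra; right.
    move: HE; apply: smallest_sub; first exact: smallest_sigma_algebra.
    move=> X [|] HX; apply: sub_sigma_algebra; left.
      by exists X, setT, setT; rewrite !setIT.
    by exists setT, X, setT; rewrite setIT setTI.
  by apply: sub_sigma_algebra; left; exists setT, setT, E; rewrite !setTI.
Qed.

Lemma filtered_wiener_augmented : filtered_wiener F W.
Proof.
split; [|exact: augmented_indep|exact: wiener_normal wW].
move=> t t0 A WA; apply: sub_sigma_algebra; left; left.
apply: sub_sigma_algebra; left; apply: sub_sigma_algebra; exists t => //.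
by rewrite /= in_itv/= t0 lexx.
Qed.

End augmented.
End FilteredWiener.

(** Replacing [x] by [- x] leaves the integral unchanged because the law is symmetric. Adding the
    two forms cancels the term linear in [y], so only nonnegative functions are ever integrated. *)
Lemma normal_affine_moment {R : realType} (s m x : R) : 0 < s ->
  (\int[normal_prob 0 s]_y ((m + x * y) ^+ 2)%:E <=
   (m ^+ 2 + 6 * s ^+ 2 * x ^+ 2)%:E)%E.
Proof.
move=> s0.
have mf (c : R) : measurable_fun setT (fun y : R => ((m + c * y) ^+ 2)%:E).
  apply/measurable_EFinP; apply: measurable_funX; apply: measurable_funD => //.
pose opp_mixin := isMeasurableFun.Build _ _ (measurableTypeR R) (measurableTypeR R) (-%R : R -> R) (@oppr_measurable R setT).
pose opp : {mfun measurableTypeR R >-> measurableTypeR R} := HB.pack (-%R : R -> R) opp_mixin.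
pose I c := (\int[normal_prob 0 s]_y ((m + c * y) ^+ 2)%:E)%E.
have Iopp : I x = I (- x).
  transitivity (\int[pushforward (normal_prob 0 s) opp]_y ((m + x * y) ^+ 2)%:E)%E.
    apply: eq_measure_integral => A mA _; apply/esym.
    by apply: normal_prob_opp => //; rewrite gt_eqF.
  rewrite ge0_integral_pushforward//=.
  - by apply: eq_integral => y _ /=; rewrite mulrN mulNr.
  - exact: mf.
  - by move=> y _; rewrite lee_fin sqr_ge0.
have I2 : (I x + I x <= (2 * m ^+ 2 + 2 * x ^+ 2 * (6 * s ^+ 2))%:E)%E.
  rewrite {2}Iopp /I -ge0_integralD//; last 4 first.
  - by move=> y _; rewrite lee_fin sqr_ge0.
  - exact: mf.
  - by move=> y _; rewrite lee_fin sqr_ge0.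
  - exact: mf.
  under eq_integral => y _.
    rewrite -EFinD (_ : _ + _ = 2 * m ^+ 2 + 2 * x ^+ 2 * y ^+ 2); last by ring.
    rewrite EFinD (EFinM (2 * x ^+ 2)).
    over.
  have x0 : 0 <= 2 * x ^+ 2 by rewrite mulr_ge0// sqr_ge0.
  have m0 : 0 <= 2 * m ^+ 2 by rewrite mulr_ge0// sqr_ge0.
  have msq : measurable_fun setT (fun y : measurableTypeR R => (y ^+ 2)%:E).
    by apply/measurable_EFinP; exact: measurable_funX.
  rewrite ge0_integralD//; last 2 first.
  - by move=> y _; rewrite mule_ge0// lee_fin// sqr_ge0.
  - exact: measurable_funeM.
  rewrite integral_cst// [X in (_ * X + _)%E](_ : _ = 1%E); last exact: probability_setT.
  rewrite mule1 EFinD leeD2l//.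
  rewrite ge0_integralZl//; last by move=> y _; rewrite lee_fin sqr_ge0.
  rewrite (EFinM (2 * x ^+ 2)) lee_wpmul2l ?lee_fin//.
  exact: normal_second_moment.
move: I2; rewrite -/(I x).
have : (0 <= I x)%E by apply: integral_ge0 => y _; rewrite lee_fin sqr_ge0.
case: (I x) => [i| |]//.
by rewrite -EFinD !lee_fin => _; lra.
Qed.

Section Increments.
Context {R : realType} {d : measure_display} {Omega : measurableType d}.
Variable P : probability Omega R.
Variables (F : R -> set (set Omega)) (W : R -> Omega -> R).
Hypotheses (FF : filtration F) (FW : filtered_wiener P F W).

(** On the space [g_sigma_algebraType (F t)] the closure properties of measurable functions become
    available for adaptedness. *)
Lemma preimages_measurable t d' (E : measurableType d') (xi : Omega -> E) :
  (forall A, measurable A -> F t (xi @^-1` A)) <->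
  measurable_fun setT (xi : g_sigma_algebraType (F t) -> E).
Proof.
split=> [H _ A mA|H A mA]; rewrite ?setTI.
  by rewrite /measurable/= (filtration_sigma FF); exact: H.
rewrite -(filtration_sigma FF) -[_ @^-1` _]setTI; exact: H.
Qed.

Lemma preimagesP t (xi : Omega -> R) : preimages xi `<=` F t <->
  measurable_fun setT (xi : g_sigma_algebraType (F t) -> R).
Proof.
rewrite -preimages_measurable; split=> [H A mA|H _ [A mA <-]].
  by apply: H; exists A => //; rewrite setTI.
by rewrite setTI; exact: H.
Qed.

Lemma filtration_measurable_fun t d' (E : measurableType d') (xi : Omega -> E) :
  0 <= t -> measurable_fun setT (xi : g_sigma_algebraType (F t) -> E) ->
  measurable_fun setT xi.
Proof.
move=> t0 /preimages_measurable H _ A mA; rewrite setTI.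
by apply: (filtration_meas FF t0); exact: H.
Qed.

Lemma fwiener_measurable t : 0 <= t -> measurable_fun setT (W t).
Proof.
move=> t0; apply: (filtration_measurable_fun t0); apply/preimagesP.
exact: fwiener_adapted FW _ t0.
Qed.

Lemma freezing_incr (s t : R) d' (E : measurableType d') (Z : Omega -> E)
    (f : E * measurableTypeR R -> \bar R) : 0 <= s -> s < t ->
  measurable_fun setT (Z : g_sigma_algebraType (F s) -> E) ->
  measurable_fun setT f -> (forall p, 0 <= f p)%E ->
  (\int[P]_w f (Z w, (W t w - W s w)%R) =
   \int[P]_w \int[normal_prob 0 (Num.sqrt (t - s))]_y f (Z w, y))%E.
Proof.
move=> s0 st mZ mf f0.
have t0 : 0 <= t by rewrite (le_trans s0)// ltW.
have mD : measurable_fun setT (fun w => W t w - W s w).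
  by apply: measurable_funB; exact: fwiener_measurable.
apply: (@freezing _ _ _ P _ _ _ (measurableTypeR R) Z (fun w => W t w - W s w)) => //.
- exact: filtration_measurable_fun mZ.
- move=> A C mA mC.
  transitivity (P (Z @^-1` A) * P ((fun w => W t w - W s w)%R @^-1` C))%E; last first.
    by congr (_ * _)%E; exact: (fwiener_normal FW s0 st mC).
  apply: (fwiener_indep FW s0 st).
    by move/preimages_measurable : mZ; apply.
  by exists C => //; rewrite setTI.
Qed.

(** This replaces martingale orthogonality: with the pair [(M, xi)] frozen, the increment is
    Gaussian of variance [t - s] and [normal_affine_moment] applies pointwise. Both sides may be
    infinite. *)
Lemma second_moment_step (s t : R) (M xi : Omega -> R) : 0 <= s -> s <= t ->
  preimages M `<=` F s -> preimages xi `<=` F s ->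
  (\int[P]_w ((M w + xi w * (W t w - W s w)) ^+ 2)%:E <=
   \int[P]_w (M w ^+ 2 + 6 * (xi w ^+ 2 * (t - s)))%:E)%E.
Proof.
move=> s0; rewrite le_eqVlt => /predU1P[<- _ _|st].
  under eq_integral do rewrite subrr mulr0 addr0.
  by under [leRHS]eq_integral do rewrite subrr !mulr0 addr0.
move=> /preimagesP mM /preimagesP mxi.
have mM' := filtration_measurable_fun s0 mM.
have mxi' := filtration_measurable_fun s0 mxi.
pose f (p : (R * R) * measurableTypeR R) : \bar R := ((p.1.1 + p.1.2 * p.2) ^+ 2)%:E.
have mf : measurable_fun setT f.
  apply/measurable_EFinP; apply: measurable_funX; apply: measurable_funD.
    exact: measurableT_comp measurable_fst measurable_fst.
  apply: measurable_funM; last exact: measurable_snd.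
  exact: measurableT_comp measurable_snd measurable_fst.
have f0 p : (0 <= f p)%E by rewrite lee_fin sqr_ge0.
have mZ : measurable_fun setT (fun w => (M w, xi w)) by exact: measurable_fun_pair.
have -> : (\int[P]_w ((M w + xi w * (W t w - W s w)) ^+ 2)%:E =
   \int[P]_w \int[normal_prob 0 (Num.sqrt (t - s))]_y f ((M w, xi w), y))%E.
  apply: (@freezing_incr s t _ _ (fun w => (M w, xi w)) f s0 st) => //.
  exact: measurable_fun_pair.
apply: ge0_le_integral => //.
- by move=> w _; exact: integral_ge0.
- pose h (z : R * R) := (\int[normal_prob 0 (Num.sqrt (t - s))]_y f (z, y))%E.
  apply: (@measurableT_comp _ _ _ _ _ _ h) mZ => //.
  exact: measurable_fun_fubini_tonelli_F.
- apply/measurable_EFinP; apply: measurable_funD; first exact: measurable_funX.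
  apply: (@measurable_funM _ _ _ _ (cst 6)); first exact: measurable_cst.
  apply: (@measurable_funM _ _ _ _ (fun w => xi w ^+ 2) (cst (t - s))) => //.
  exact: measurable_funX.
- move=> w _; have ts : 0 < Num.sqrt (t - s) by rewrite sqrtr_gt0 subr_gt0.
  apply: le_trans (normal_affine_moment (M w) (xi w) ts) _.
  rewrite lee_fin sqr_sqrtr; last by rewrite subr_ge0 ltW.
  by rewrite -[6 * _ * _]mulrA (mulrC (t - s)).
Qed.

(** Given [F s], the target [Z] is a constant and the increment has a density bounded by
    [1 / sqrt (t - s)]. *)
Lemma small_ball_incr (s t r : R) (Z : Omega -> R) : 0 <= s -> s < t -> 0 <= r ->
  preimages Z `<=` F s ->
  (P [set w | (`|W t w - W s w - Z w| <= r)%R] <= (2 * r / Num.sqrt (t - s))%:E)%E.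
Proof.
move=> s0 st r0 /preimagesP mZ.
have t0 : 0 <= t by rewrite (le_trans s0)// ltW.
pose A := [set p : R * measurableTypeR R | `|p.2 - p.1| <= r].
have mA : measurable A.
  have mg : measurable_fun setT (fun p : R * measurableTypeR R => `|p.2 - p.1|).
    apply: (@measurableT_comp _ _ _ _ _ _ (fun x : R => `|x|)) => //.
    by apply: measurable_funB; [exact: measurable_snd|exact: measurable_fst].
  have := mg measurableT _ (measurable_itv `]-oo, r]); rewrite setTI.
  by rewrite (_ : _ @^-1` _ = A)//; apply/seteqP; split=> p; rewrite /A/= in_itv.
pose f (p : R * measurableTypeR R) : \bar R := (\1_A p)%:E.
have mf : measurable_fun setT f by exact/measurable_EFinP/measurable_indic.
have f0 p : (0 <= f p)%E by rewrite lee_fin.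
have mZ' := filtration_measurable_fun s0 mZ.
have mB : measurable [set w | (`|W t w - W s w - Z w| <= r)%R].
  have mD : measurable_fun setT (fun w => W t w - W s w).
    by apply: measurable_funB; exact: fwiener_measurable.
  have mZD : measurable_fun setT (fun w => (Z w, W t w - W s w) : R * measurableTypeR R).
    exact: measurable_fun_pair.
  by have := mZD measurableT _ mA; rewrite setTI.
have -> : P [set w | (`|W t w - W s w - Z w| <= r)%R] =
    (\int[P]_w f (Z w, (W t w - W s w)%R))%E.
  rewrite -[X in P X]setIT -integral_indic//; apply: eq_integral => w _ //.
rewrite (@freezing_incr s t _ _ Z f s0 st)//.
apply: (@le_trans _ _ (\int[P]_w (cst (2 * r / Num.sqrt (t - s))%:E w))%E); last first.
  rewrite integral_cst// [X in (_ * X <= _)%E](_ : _ = 1%E) ?mule1//.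
  exact: probability_setT.
have ts : 0 < Num.sqrt (t - s) by rewrite sqrtr_gt0 subr_gt0.
apply: ge0_le_integral => //.
- by move=> w _; exact: integral_ge0.
- pose h (z : R) := (\int[normal_prob 0 (Num.sqrt (t - s))]_y f (z, y))%E.
  apply: (@measurableT_comp _ _ _ _ _ _ h) mZ' => //.
  exact: measurable_fun_fubini_tonelli_F.
- move=> w _; apply: le_trans (normal_prob_small_ball (Z w) ts r0).
  rewrite le_eqVlt; apply/orP; left; apply/eqP.
  set N := normal_prob 0 _; set I := `[_, _]%classic.
  have -> : N I = (\int[N]_y (\1_I y)%:E)%E.
    rewrite integral_indic//; last exact: measurable_itv.
    suff E J : J = I -> N I = N J by apply: E; apply/seteqP; split => x; [case|split].
    by move=> ->.
  apply: eq_integral => y _.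
  rewrite /f !indicE (_ : (Z w, y) \in A = (y \in I))//.
  by apply/idP/idP => /set_mem H; apply/mem_set; move: H; rewrite /A /I /= in_itv/= ler_distl.
Qed.

End Increments.

(** * The basic inequality for stochastic sums *)

Section Grid.
Context {R : realType} {d : measure_display} {Omega : measurableType d}.
Variable P : probability Omega R.
Variables (F : R -> set (set Omega)) (W : R -> Omega -> R).
Hypotheses (FF : filtration F) (FW : filtered_wiener P F W).

Lemma chebyshev_outer (M : Omega -> R) (e c : R) : measurable_fun setT M -> 0 < e ->
  (\int[P]_w (M w ^+ 2)%:E <= c%:E)%E ->
  outer_le P [set w | e <= `|M w|] (c / e ^+ 2).
Proof.
move=> mM e0 Mc; set A := [set w | _].
have mA : measurable A.
  have := @measurable_ge_dist _ _ _ M (cst 0) e mM (measurable_cst _).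
  by rewrite (_ : [set w | _] = A)//; apply/seteqP; split => w; rewrite /A/= subr0.
apply: outer_le_meas => //.
have e20 : 0 < e ^+ 2 by rewrite exprn_gt0.
rewrite EFinM lee_pdivlMr// muleC; apply: le_trans Mc.
have -> : ((e ^+ 2)%:E * P A = \int[P]_w ((e ^+ 2)%:E * (\1_A w)%:E))%E.
  rewrite ge0_integralZl//; last 2 first.
  - exact/measurable_EFinP/measurable_indic.
  - by rewrite lee_fin ltW.
  by rewrite integral_indic// setIT.
apply: ge0_le_integral => //.
- by move=> w _; rewrite mule_ge0// lee_fin// ltW.
- by apply: measurable_funeM; exact/measurable_EFinP/measurable_indic.
- by apply/measurable_EFinP; exact: measurable_funX.
- move=> w _; rewrite -EFinM lee_fin indicE; have [wA|wA] := boolP (w \in A).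
    rewrite mulr1.
    by rewrite -[M w ^+ 2]real_normK ?num_real// ler_pXn2r ?nnegrE ?(ltW e0)//; exact: set_mem wA.
  by rewrite mulr0 sqr_ge0.
Qed.

Lemma preimagesS (s t : R) (xi : Omega -> R) : 0 <= s -> s <= t ->
  preimages xi `<=` F s -> preimages xi `<=` F t.
Proof. by move=> s0 st H; apply: subset_trans H _; exact: (filtration_mono FF). Qed.

Variables (g : nat -> R) (xi : nat -> Omega -> R).
Hypotheses (g0 : 0 <= g 0) (gnd : forall k, g k <= g k.+1)
  (mxi : forall k, preimages (xi k) `<=` F (g k)).

Let V n w := \sum_(k < n) xi k w ^+ 2 * (g k.+1 - g k).
Let dW k w := W (g k.+1) w - W (g k) w.

Let gmono j k : (j <= k)%N -> g j <= g k.
Proof.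
elim: k => [|k IH]; first by rewrite leqn0 => /eqP ->.
by rewrite leq_eqVlt => /predU1P[->//|/IH jk]; exact: le_trans (gnd k).
Qed.

Let gge0 k : 0 <= g k. Proof. exact: le_trans (gmono (leq0n k)). Qed.

Let Vmono j k w : (j <= k)%N -> V j w <= V k w.
Proof.
elim: k => [|k IH]; first by rewrite leqn0 => /eqP ->.
rewrite leq_eqVlt => /predU1P[->//|/IH jk]; apply: le_trans jk _.
by rewrite /V big_ord_recr/= lerDl mulr_ge0 ?sqr_ge0// subr_ge0.
Qed.

Let mxi' j k : (j <= k)%N ->
  measurable_fun setT (xi j : g_sigma_algebraType (F (g k)) -> R).
Proof. by move=> jk; apply/preimagesP => //; apply: (preimagesS (gge0 j) (gmono jk)). Qed.

Let mV k : measurable_fun setT (V k.+1 : g_sigma_algebraType (F (g k)) -> R).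
Proof.
apply: measurable_sum => j; apply: measurable_funM => //.
by apply: measurable_funX; apply: mxi'; rewrite -ltnS.
Qed.

(* The stopping time in the localization: [xi k] is switched off as soon as the
   quadratic variation, known at time [g k], exceeds [c]. *)
Let eta (c : R) k w := xi k w * \1_([set w' | V k.+1 w' <= c]) w.

Let meta c k : measurable_fun setT (eta c k : g_sigma_algebraType (F (g k)) -> R).
Proof.
apply: measurable_funM; first exact: mxi'.
apply: measurable_indic.
have := @mV k measurableT _ (measurable_itv `]-oo, c]).
rewrite (_ : _ `&` _ = [set w' | V k.+1 w' <= c])//.
by apply/seteqP; split => [w []|w Vw]; [|split]; rewrite //= in_itv.
Qed.

Let M c n w := \sum_(k < n) eta c k w * dW k w.

Let mM c n : measurable_fun setT (M c n : g_sigma_algebraType (F (g n)) -> R).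
Proof.
apply: measurable_sum => k; apply: measurable_funM.
  by apply/preimagesP => //; apply: (preimagesS (gge0 k)); [exact/gmono/ltnW|exact/preimagesP].
have mW j : (j <= n)%N -> measurable_fun setT (W (g j) : g_sigma_algebraType (F (g n)) -> R).
  move=> jn; apply/preimagesP => //; apply: (preimagesS (gge0 j) (gmono jn)).
  exact: fwiener_adapted FW _ (gge0 j).
by apply: measurable_funB; apply: mW; rewrite // ltnW.
Qed.

(** The minimum with [V n] closes the induction: while the new coefficient is on, the sum is at most
    [V n.+1], and that is at most [c] by the very condition for being on. *)
Let eta_bound c n w : 0 <= c ->
  \sum_(k < n) eta c k w ^+ 2 * (g k.+1 - g k) <= Num.min c (V n w).
Proof.
move=> c0; elim: n => [|n IH]; first by rewrite /V !big_ord0 le_min c0 lexx.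
rewrite big_ord_recr/= {2}/eta indicE; have [|] := boolP (w \in _).
  move=> /set_mem /= Vc; rewrite mulr1 le_min; apply/andP; split.
    apply: le_trans Vc; rewrite /V big_ord_recr/= lerD2r.
    by rewrite (le_trans IH)// ge_min lexx orbT.
  by rewrite /V big_ord_recr/= lerD2r (le_trans IH)// ge_min lexx orbT.
move=> _; rewrite mulr0 expr0n/= mul0r addr0 (le_trans IH)// le_min !ge_min lexx/=.
by rewrite (Vmono _ (leqnSn n)) orbT.
Qed.

Let M_moment c n :
  (\int[P]_w (M c n w ^+ 2)%:E <=
   \int[P]_w (6 * \sum_(k < n) eta c k w ^+ 2 * (g k.+1 - g k))%:E)%E.
Proof.
elim: n => [|n IH].
  rewrite le_eqVlt; apply/orP; left; apply/eqP; apply: eq_integral => w _.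
  by rewrite /M !big_ord0 expr0n mulr0.
have m1 : measurable_fun setT (M c n) by exact: (filtration_measurable_fun FF (gge0 n) (@mM c n)).
have m2 k : measurable_fun setT (eta c k) by exact: (filtration_measurable_fun FF (gge0 k) (@meta c k)).
have p1 k w : 0 <= eta c k w ^+ 2 * (g k.+1 - g k) by rewrite mulr_ge0 ?sqr_ge0// subr_ge0.
have m3 k : measurable_fun setT (fun w => eta c k w ^+ 2 * (g k.+1 - g k)).
  by apply: measurable_funM => //; exact: measurable_funX.
have m4 : measurable_fun setT (fun w => \sum_(k < n) eta c k w ^+ 2 * (g k.+1 - g k)).
  by apply: measurable_sum => k.
apply: (@le_trans _ _ (\int[P]_w (M c n w ^+ 2 + 6 * (eta c n w ^+ 2 * (g n.+1 - g n)))%:E)%E).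
  under eq_integral do rewrite /M big_ord_recr/=.
  by apply: (second_moment_step FF FW) => //; apply/(preimagesP FF); [exact: mM|exact: meta].
under eq_integral do rewrite EFinD.
rewrite ge0_integralD//; last 4 first.
- by move=> w _; rewrite lee_fin sqr_ge0.
- by apply/measurable_EFinP; exact: measurable_funX.
- by move=> w _; rewrite lee_fin mulr_ge0.
- by apply/measurable_EFinP; apply: measurable_funM; [exact: measurable_cst|exact: m3].
under [leRHS]eq_integral do rewrite big_ord_recr/= mulrDr EFinD.
rewrite ge0_integralD//; last 4 first.
- by move=> w _; rewrite lee_fin mulr_ge0// sumr_ge0.
- by apply/measurable_EFinP; apply: measurable_funM; [exact: measurable_cst|exact: m4].
- by move=> w _; rewrite lee_fin mulr_ge0.
- by apply/measurable_EFinP; apply: measurable_funM; [exact: measurable_cst|exact: m3].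
exact: leeD2r.
Qed.

Lemma grid_inequality n (e c r : R) : 0 < e -> 0 <= c ->
  outer_le P [set w | c < V n w] r ->
  outer_le P [set w | e <= `|\sum_(k < n) xi k w * dW k w|] (r + 6 * c / e ^+ 2).
Proof.
move=> e0 c0 HV.
have H : (\int[P]_w (M c n w ^+ 2)%:E <= (6 * c)%:E)%E.
  apply: le_trans (M_moment c n) _.
  apply: (@le_trans _ _ (\int[P]_w (cst (6 * c)%:E w))%E); last first.
    rewrite integral_cst// [X in (_ * X <= _)%E](_ : _ = 1%E) ?mule1//.
    exact: probability_setT.
  have m2 k : measurable_fun setT (eta c k) by exact: (filtration_measurable_fun FF (gge0 k) (@meta c k)).
  apply: ge0_le_integral => //.
  - move=> w _; rewrite lee_fin mulr_ge0// sumr_ge0// => k _.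
    by rewrite mulr_ge0 ?sqr_ge0// subr_ge0.
  - apply/measurable_EFinP; apply: measurable_funM => //; apply: measurable_sum => k.
    by apply: measurable_funM => //; exact: measurable_funX.
  - move=> w _; rewrite lee_fin ler_wpM2l// (le_trans (@eta_bound c n w c0))//.
    by rewrite ge_min lexx.
have mM' : measurable_fun setT (M c n) by exact: (filtration_measurable_fun FF (gge0 n) (@mM c n)).
apply: outer_leS (outer_leU HV (chebyshev_outer mM' e0 H)) => // w /= ew.
(* If [V n w <= c], no coefficient has been switched off, because [V] is nondecreasing in its index;
   the localized sum is then the original one. *)
have [Vc|Vc] := ltP c (V n w); [by left|right].
rewrite (_ : M c n w = \sum_(k < n) xi k w * dW k w)//.
apply: eq_bigr => k _; congr (_ * _); rewrite /eta indicE mem_set ?mulr1//=.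
exact: le_trans (Vmono w (ltn_ord k)) Vc.
Qed.

End Grid.

(** * Lebesgue integrals of bounded paths *)

Section BoundedPaths.
Context {R : realType}.
Local Notation mu := (@lebesgue_measure R).
Implicit Types (T : R) (f g : R -> R).

(** This class is closed under sums and products and implies integrability on [[0, T]], so
    integrability conditions reduce to algebra. *)
Definition bounded_meas T f : Prop :=
  measurable_fun `[0, T] f /\ exists M, forall s, 0 <= s <= T -> `|f s| <= M.

Lemma bounded_meas_integrable T f : bounded_meas T f ->
  mu.-integrable `[0, T] (EFin \o f).
Proof.
move=> [mf [M fM]]; apply: measurable_bounded_integrable => //.
  by rewrite /= lebesgue_measure_itv/=; case: ifP; rewrite // ltry.
exists M; split; first exact: num_real.
by move=> x Mx s /=; rewrite in_itv/= => /fM /le_trans; apply; exact: ltW.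
Qed.

Lemma bounded_meas_cst T (c : R) : bounded_meas T (cst c).
Proof. by split; [exact: measurable_cst|exists `|c|]. Qed.

Lemma bounded_measD T f g : bounded_meas T f -> bounded_meas T g ->
  bounded_meas T (fun s => f s + g s).
Proof.
move=> [mf [M fM]] [mg [N gN]]; split; first exact: measurable_funD.
by exists (M + N) => s sT; rewrite (le_trans (ler_normD _ _))// lerD ?fM ?gN.
Qed.

Lemma bounded_measM T f g : bounded_meas T f -> bounded_meas T g ->
  bounded_meas T (fun s => f s * g s).
Proof.
move=> [mf [M fM]] [mg [N gN]]; split; first exact: measurable_funM.
by exists (M * N) => s sT; rewrite normrM ler_pM ?fM ?gN.
Qed.

Lemma bounded_measX2 T f : bounded_meas T f -> bounded_meas T (fun s => f s ^+ 2).
Proof. by move=> bf; under eq_fun do rewrite expr2; exact: bounded_measM. Qed.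

Lemma bounded_measB T f g : bounded_meas T f -> bounded_meas T g ->
  bounded_meas T (fun s => f s - g s).
Proof.
move=> bf bg; have := bounded_measD bf (bounded_measM (bounded_meas_cst T (-1)) bg).
by under eq_fun do rewrite mulN1r.
Qed.

Lemma bounded_meas_sum T (I : Type) (r : seq I) (h : I -> R -> R) :
  (forall i, bounded_meas T (h i)) -> bounded_meas T (fun s => \sum_(i <- r) h i s).
Proof.
move=> bh; elim: r => [|i r IH].
  by under eq_fun do rewrite big_nil; exact: bounded_meas_cst.
by under eq_fun do rewrite big_cons; exact: bounded_measD.
Qed.

Lemma bounded_meas_indic T (A : set R) : measurable A -> bounded_meas T \1_A.
Proof.
move=> mA; split; first exact: measurable_indic.
by exists 1 => s _; rewrite indicE ger0_norm//; case: (_ \in _).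
Qed.

Lemma Rintegral_sum T (I : Type) (r : seq I) (h : I -> R -> R) :
  (forall i, bounded_meas T (h i)) ->
  \int[mu]_(s in `[0, T]) (\sum_(i <- r) h i s) =
  \sum_(i <- r) \int[mu]_(s in `[0, T]) h i s.
Proof.
move=> bh; elim: r => [|i r IH].
  under eq_Rintegral do rewrite big_nil.
  by rewrite Rintegral_cst// mul0r big_nil.
under eq_Rintegral do rewrite big_cons.
rewrite big_cons -IH RintegralD//; apply: bounded_meas_integrable => //.
exact: bounded_meas_sum.
Qed.

Lemma Rintegral_indic_itv T (c a b : R) : 0 <= a -> a <= b -> b <= T ->
  \int[mu]_(s in `[0, T]) (c * \1_(`]a, b]) s) = c * (b - a).
Proof.
move=> a0 ab bT; rewrite RintegralZl//; last first.
  by apply: bounded_meas_integrable; exact: bounded_meas_indic.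
congr (_ * _); rewrite /Rintegral integral_indic//.
rewrite (_ : _ `&` _ = `]a, b]%classic).
  rewrite /= lebesgue_measure_itv/= lte_fin; case: ltP => //= ba.
  by apply/esym/eqP; rewrite subr_eq0 eq_le ab ba.
apply/seteqP; split => s /=; rewrite !in_itv/=; first by case.
by move=> /andP[as_ sb]; rewrite as_ sb; split => //; apply/andP; split; [exact: le_trans a0 (ltW as_)|exact: le_trans bT].
Qed.

(** Dominated convergence with a constant bound. Only interior points are asked for, because
    left-point interpolations vanish at 0 and past the last tick, hence may fail to converge at 0
    and at [T]; these two points are a null set. *)
Lemma bounded_cvg T (f : nat -> R -> R) g (M : R) :
  (forall n, bounded_meas T (f n)) ->
  (forall n s, 0 < s < T -> `|f n s| <= M) ->
  measurable_fun `[0, T] g ->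
  (forall s, 0 < s < T -> f ^~ s @ \oo --> g s) ->
  \int[mu]_(s in `[0, T]) f n s @[n --> \oo] --> \int[mu]_(s in `[0, T]) g s.
Proof.
move=> bf fM mg fg.
have N0 : mu.-negligible [set (0 : R); T].
  exists [set 0; T]; split => //; first exact: measurableU.
  apply/eqP; rewrite -measure_le0 (le_trans (measureU2 _ _ _))//=.
  by rewrite !lebesgue_measure_set1 adde0.
have aeT (Q : R -> Prop) : (forall s, (0 <= s <= T -> 0 < s < T) -> Q s) ->
    {ae mu, forall s, Q s}.
  move=> HQ; apply: negligibleS N0 => s /=.
  apply: contra_notP => /not_orP[/= s0 sT]; apply: HQ => /andP[].
  by rewrite !le_eqVlt => /predU1P[/esym//|->] /predU1P[].
have [] := @dominated_convergence _ _ R mu `[0, T]%classic (measurable_itv _)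
  (fun n s => (f n s)%:E) (EFin \o g) (cst M%:E).
- by move=> n; apply/measurable_EFinP; case: (bf n).
- exact/measurable_EFinP.
- apply: aeT => s sT; rewrite /= in_itv/= => /sT {}sT.
  by apply: cvg_EFin; [exact: nearW|exact: fg].
- exact: (bounded_meas_integrable (bounded_meas_cst T M)).
- by apply: aeT => s sT n; rewrite /= in_itv/= lee_fin => /sT; exact: fM.
- move=> ig _; rewrite -[X in _ --> X](fineK (integrable_fin_num _ ig))//.
  by move=> /fine_cvgP[].
Qed.

End BoundedPaths.

Section Telescoping.
Context {R : realType}.
Implicit Types (g : nat -> R) (u v : R).

(* Clamping to [[u, v]] turns the sum into a telescoping one. *)
Lemma telescope_between (phi : R -> R) g n u v :
  (forall k, g k <= g k.+1) -> g 0%N <= u -> v <= g n -> u <= v ->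
  (exists p, g p = u) -> (exists q, g q = v) ->
  \sum_(k < n) ((u <= g k < v)%R%:R * (phi (g k.+1) - phi (g k))) = phi v - phi u.
Proof.
move=> gnd g0 gn uv [p gp] [q gq].
have gmono j k : (j <= k)%N -> g j <= g k.
  elim: k => [|k IH]; first by rewrite leqn0 => /eqP ->.
  by rewrite leq_eqVlt => /predU1P[->//|/IH jk]; exact: le_trans (gnd k).
have next k x : (exists r, g r = x) -> g k < x -> g k.+1 <= x.
  move=> [r <-] kr; apply: (gmono k.+1 r); rewrite ltnNge; apply/negP => rk.
  by move: kr; rewrite ltNge gmono.
pose cl x := Num.min (Num.max x u) v.
have cl_u x : x <= u -> cl x = u by move=> xu; rewrite /cl (max_idPr xu) (min_idPl uv).
have cl_v x : v <= x -> cl x = v.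
  by move=> vx; rewrite /cl; apply/min_idPr; rewrite le_max vx.
have cl_id x : u <= x -> x <= v -> cl x = x.
  by move=> ux xv; rewrite /cl (max_idPl ux); apply/min_idPl.
transitivity (\sum_(0 <= k < n) (phi (cl (g k.+1)) - phi (cl (g k)))).
  rewrite big_mkord; apply: eq_bigr => k _.
  have [gu|ug] := ltP (g k) u.
    by rewrite mul0r (cl_u (g k)) ?ltW// cl_u ?subrr//; apply: next => //; exists p.
  have [gv|vg] := ltP (g k) v; last first.
    by rewrite mul0r !cl_v ?subrr// (le_trans vg).
  rewrite mul1r (cl_id (g k)) ?(ltW gv)// cl_id//; first exact: le_trans (gnd k).
  by apply: next => //; exists q.
rewrite telescope_sumr//.
by rewrite (cl_v (g n))// (cl_u (g 0%N)).
Qed.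

(** The form [phi v - phi u] with [phi x = (s <= x)] is the one that [telescope_between] decomposes
    along a grid. *)
Lemma indic_between u v (s : R) : u <= v ->
  \1_(`]u, v]) s = (s <= v)%R%:R - (s <= u)%R%:R :> R.
Proof.
move=> uv; rewrite indicE mem_setE in_itv/=.
by have [su|us] := leP s u; [rewrite (le_trans su uv)|]; rewrite /= ?subrr ?subr0.
Qed.

Lemma common_grid (T : R) (l : seq R) : 0 <= T ->
  (forall x, x \in l -> 0 <= x <= T) ->
  exists n g, [/\ forall k, g k <= g k.+1, g 0%N = 0, g n = T &
    forall x, x \in l -> exists p, g p = x].
Proof.
(* The default value [T] of [nth] continues the grid by the constant [T]: this gives [g n = T] for
   [n = size L] and keeps [g] nondecreasing. The added element 0 is the least one, so it provides
   [g 0 = 0]. *)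
move=> T0 lT; pose L := sort <=%O (0 :: l); pose g k := nth T L k.
have LT x : x \in L -> 0 <= x <= T.
  by rewrite mem_sort inE => /predU1P[->|/lT//]; rewrite lexx.
have sL : sorted <=%O L by exact: sort_le_sorted.
have gLT k : 0 <= g k <= T.
  have [kL|Lk] := ltnP k (size L); first by apply: LT; exact: mem_nth.
  by rewrite /g nth_default// T0 lexx.
exists (size L), g; split.
- move=> k; have [kL|Lk] := ltnP k.+1 (size L); last first.
    by rewrite {2}/g nth_default//; have /andP[] := gLT k.
  by apply: (sorted_leq_nth le_trans le_refl T sL); rewrite ?inE// ltnW.
- have L0 : (0 < size L)%N by rewrite size_sort.
  apply/eqP; rewrite eq_le; have /andP[-> _] := gLT 0%N; rewrite andbT.
  have zL : 0 \in L by rewrite mem_sort inE eqxx.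
  rewrite -(nth_index T zL).
  by apply: (sorted_leq_nth le_trans le_refl T sL); rewrite ?inE ?index_mem.
- by rewrite /g nth_default.
- move=> x xl; exists (index x L); apply: nth_index.
  by rewrite mem_sort inE xl orbT.
Qed.

End Telescoping.

(** * Stochastic integrals of step integrands *)

Section Steps.
Context {R : realType} {d : measure_display} {Omega : measurableType d}.
Variable P : probability Omega R.
Hypothesis complete_P : measure_is_complete P.
Variables (F : R -> set (set Omega)) (W : R -> Omega -> R).
Hypotheses (FF : filtration F) (FW : filtered_wiener P F W).
Variable T : R.
Hypothesis T0 : 0 <= T.
Local Notation mu := (@lebesgue_measure R).

(* [step f J]: the function [f] is a finite sum of terms [xi 1_(]u, v])] with
   [xi] [F u]-measurable, not necessarily bounded, and [J = \int_0^T f dW]. *)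
Definition step (f : R -> Omega -> R) (J : Omega -> R) : Prop :=
  exists (I : finType) (u v : I -> R) (xi : I -> Omega -> R),
  [/\ forall i, [/\ 0 <= u i, u i <= v i & v i <= T],
      forall i, preimages (xi i) `<=` F (u i),
      forall s w, f s w = \sum_i xi i w * \1_(`]u i, v i]) s &
      forall w, J w = \sum_i xi i w * (W (v i) w - W (u i) w)].

Lemma stepD f J f' J' : step f J -> step f' J' ->
  step (fun s w => f s w + f' s w) (fun w => J w + J' w).
Proof.
move=> [I [u [v [xi [uv mxi fE JE]]]]] [I' [u' [v' [xi' [uv' mxi' fE' JE']]]]].
exists (I + I')%type, (fun i => match i with inl i => u i | inr i => u' i end),
  (fun i => match i with inl i => v i | inr i => v' i end),
  (fun i => match i with inl i => xi i | inr i => xi' i end); split.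
- by case.
- by case.
- by move=> s w; rewrite fE fE' big_sumType.
- by move=> w; rewrite JE JE' big_sumType.
Qed.

Lemma step_sum (I : Type) (r : seq I) (f : I -> R -> Omega -> R) (J : I -> Omega -> R) :
  (forall i, step (f i) (J i)) ->
  step (fun s w => \sum_(i <- r) f i s w) (fun w => \sum_(i <- r) J i w).
Proof.
move=> fJ; elim: r => [|i r IH].
  exists void, (fun=> 0), (fun=> 0), (fun=> fun=> 0); split; [by case|by case|..].
    by move=> s w; rewrite big_nil big1//; case.
  by move=> w; rewrite big_nil big1//; case.
under eq_fun do under eq_fun do rewrite big_cons.
under [X in step _ X]eq_fun do rewrite big_cons.
exact: stepD.
Qed.

Lemma stepZ (c : R) f J : step f J -> step (fun s w => c * f s w) (fun w => c * J w).
Proof.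
move=> [I [u [v [xi [uv mxi fE JE]]]]].
exists I, u, v, (fun i w => c * xi i w); split => //.
- move=> i; apply/(preimagesP FF); apply: measurable_funM; first exact: measurable_cst.
  exact/(preimagesP FF).
- by move=> s w; rewrite fE mulr_sumr; apply: eq_bigr => i _; rewrite mulrA.
- by move=> w; rewrite JE mulr_sumr; apply: eq_bigr => i _; rewrite mulrA.
Qed.

Lemma stepB f J f' J' : step f J -> step f' J' ->
  step (fun s w => f s w - f' s w) (fun w => J w - J' w).
Proof.
move=> fJ /(stepZ (-1)) /(stepD fJ).
by under eq_fun do under eq_fun do rewrite mulN1r;
  under [X in step _ X]eq_fun do rewrite mulN1r.
Qed.

Lemma step_bounded f J w : step f J -> bounded_meas T (f ^~ w).
Proof.
move=> [I [u [v [xi [uv mxi fE JE]]]]].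
under eq_fun do rewrite fE.
apply: bounded_meas_sum => i; apply: bounded_measM; first exact: bounded_meas_cst.
exact: bounded_meas_indic.
Qed.

(** The intervals of a step integrand may overlap. On a grid containing all endpoints, the
    coefficient of a cell is the sum of the [xi i] whose interval covers it; this is known at the
    left end [g k] since [u i <= g k]. The cells are disjoint, so squaring produces no cross
    terms. *)
Lemma step_grid f J : step f J -> exists n (g : nat -> R) (xi : nat -> Omega -> R),
  [/\ 0 <= g 0%N, forall k, g k <= g k.+1, forall k, preimages (xi k) `<=` F (g k),
      forall w, J w = \sum_(k < n) xi k w * (W (g k.+1) w - W (g k) w) &
      forall w, \int[mu]_(s in `[0, T]) (f s w ^+ 2) =
        \sum_(k < n) xi k w ^+ 2 * (g k.+1 - g k)].
Proof.
move=> [I [u [v [xi [uv mxi fE JE]]]]].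
have [] := @common_grid R T ([seq u i | i : I] ++ [seq v i | i : I]) T0.
  move=> x; rewrite mem_cat => /orP[] /mapP[i _ ->]; have [ui uvi vi] := uv i.
    by rewrite ui (le_trans uvi).
  by rewrite vi andbT (le_trans ui).
move=> n [g [gnd g0 gn gl]].
have gu i : exists p, g p = u i.
  by apply: gl; rewrite mem_cat map_f ?mem_enum.
have gv i : exists p, g p = v i.
  by apply: gl; rewrite mem_cat map_f ?mem_enum// orbT.
(* Used twice: with [phi] a path of [W] it rewrites [J], and with [phi x = (s <= x)] it rewrites
   [f]. *)
have tele (phi : R -> R) i : \sum_(k < n) ((u i <= g k < v i)%R%:R * (phi (g k.+1) - phi (g k))) = phi (v i) - phi (u i).
  by have [ui uvi vi] := uv i; apply: telescope_between; rewrite ?g0 ?gn.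
pose xi' k w := \sum_i (u i <= g k < v i)%R%:R * xi i w.
have gT k : (k < n)%N -> 0 <= g k /\ g k.+1 <= T.
  have gm j k' : (j <= k')%N -> g j <= g k'.
    elim: k' => [|k' IH]; first by rewrite leqn0 => /eqP ->.
    by rewrite leq_eqVlt => /predU1P[->//|/IH jk]; exact: le_trans (gnd k').
  by move=> kn; split; [rewrite -g0; exact: gm|rewrite -gn; exact: gm].
exists n, g, xi'; split => //.
- by rewrite g0.
- move=> k; apply/(preimagesP FF); apply: measurable_sum => i.
  have [/andP[uk kv]|_] := boolP (u i <= g k < v i).
    apply: measurable_funM; first exact: measurable_cst.
    by apply/(preimagesP FF); apply: (preimagesS FF _ uk (mxi i)); have [] := uv i.
  by under eq_fun do rewrite mul0r; exact: measurable_cst.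
- move=> w; rewrite JE /xi'; under [RHS]eq_bigr do rewrite mulr_suml.
  rewrite exchange_big/=; apply: eq_bigr => i _.
  rewrite -(tele (W ^~ w)) mulr_sumr; apply: eq_bigr => k _.
  by rewrite mulrCA mulrA.
- move=> w; pose c k := xi' k w.
  have fE' s : f s w = \sum_(k < n) c k * \1_(`]g k, g k.+1]) s.
    rewrite fE /c /xi'; under [RHS]eq_bigr do rewrite mulr_suml.
    rewrite exchange_big/=; apply: eq_bigr => i _.
    have [ui uvi vi] := uv i; rewrite indic_between//.
    rewrite -(tele (fun x => (s <= x)%R%:R)) mulr_sumr; apply: eq_bigr => k _.
    by rewrite indic_between// mulrCA mulrA.
  have sqE s : f s w ^+ 2 = \sum_(k < n) c k ^+ 2 * \1_(`]g k, g k.+1]) s.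
    rewrite fE' expr2 mulr_suml; apply: eq_bigr => k _.
    rewrite mulr_sumr (bigD1 k)//= big1 ?addr0 => [|j jk].
      rewrite mulrACA -expr2 indicE; case: (s \in _); rewrite ?mulr1 ?mulr0//.
    suff : \1_(`]g k, g k.+1]) s * \1_(`]g j, g j.+1]) s = 0 :> R.
      by rewrite mulrACA => ->; rewrite mulr0.
    rewrite !indicE; have [/set_mem/=|] := boolP (s \in `]g k, g k.+1]%classic); last by rewrite mul0r.
    have [/set_mem/=|] := boolP (s \in `]g j, g j.+1]%classic); last by rewrite mulr0.
    rewrite !in_itv/= => /andP[js sj] /andP[ks sk].
    have gm a b : (a <= b)%N -> g a <= g b.
      elim: b => [|b IH]; first by rewrite leqn0 => /eqP ->.
      by rewrite leq_eqVlt => /predU1P[->//|/IH ab]; exact: le_trans (gnd b).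
    move: jk; rewrite -val_eqE neq_ltn => /orP[/gm jk|/gm kj].
      by move: (lt_le_trans ks (le_trans sj jk)); rewrite ltxx.
    by move: (lt_le_trans js (le_trans sk kj)); rewrite ltxx.
  under eq_Rintegral do rewrite sqE.
  rewrite Rintegral_sum => [|k]; last first.
    apply: bounded_measM; first exact: bounded_meas_cst.
    exact: bounded_meas_indic.
  by apply: eq_bigr => k _; have [gk0 gkT] := gT k (ltn_ord k); rewrite Rintegral_indic_itv.
Qed.

Lemma step_measurable f J : step f J -> measurable_fun setT J /\
  measurable_fun setT (fun w => \int[mu]_(s in `[0, T]) (f s w ^+ 2)).
Proof.
move=> /step_grid[n [g [xi [g0 gnd mxi JE IE]]]].
have gge0 k : 0 <= g k by elim: k => // k; move/le_trans; exact.
have mx k : measurable_fun setT (xi k).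
  by apply: (filtration_measurable_fun FF (gge0 k)); exact/(preimagesP FF).
split.
  move/funext : JE => ->; apply: measurable_sum => k; apply: measurable_funM => //.
  by apply: measurable_funB; exact: (fwiener_measurable FF FW).
move/funext : IE => ->; apply: measurable_sum => k; apply: measurable_funM => //.
exact: measurable_funX.
Qed.

Lemma step_inequality f J (e c r : R) : step f J -> 0 < e -> 0 <= c ->
  outer_le P [set w | c < \int[mu]_(s in `[0, T]) (f s w ^+ 2)] r ->
  outer_le P [set w | e <= `|J w|] (r + 6 * c / e ^+ 2).
Proof.
move=> /step_grid[n [g [xi [g0 gnd mxi JE IE]]]] e0 c0 H.
apply: outer_leS (grid_inequality FF FW g0 gnd mxi (n := n) e0 c0 _) => //.
  by move=> w /=; rewrite JE.
by apply: outer_leS H => // w /=; rewrite IE.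
Qed.

(** The continuity of stochastic integration on which the later limits of stochastic integrals rest,
    directly or through [step_ae_cip]. *)
Lemma step_cip (f : nat -> R -> Omega -> R) (J : nat -> Omega -> R) :
  (forall n, step (f n) (J n)) ->
  cip P (fun n w => \int[mu]_(s in `[0, T]) (f n s w ^+ 2)) (fun=> 0) ->
  cip P J (fun=> 0).
Proof.
move=> fJ f0 e r e0 r0.
(* Chosen so that [6 * c / e ^+ 2 = r / 2], the other half of [r] being left for the quadratic
   variation. *)
pose c := r / 2 * e ^+ 2 / 6.
have c0 : 0 < c by rewrite !mulr_gt0// exprn_gt0.
have r2 : 0 < r / 2 by rewrite divr_gt0.
apply: filterS (f0 _ _ c0 r2) => n H.
apply: (@outer_leS _ _ _ P _ [set w | e <= `|J n w|] (r / 2 + 6 * c / e ^+ 2)).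
- by move=> w /=; rewrite subr0.
- rewrite le_eqVlt; apply/orP; left; apply/eqP; rewrite /c; field.
  by rewrite gt_eqF.
apply: (step_inequality (fJ n)) => //; first exact: ltW.
apply: outer_leS H => // w /= cw; rewrite subr0 (le_trans (ltW cw))// ler_norm//.
Qed.

Lemma step_ae_cip (f : nat -> R -> Omega -> R) (J : nat -> Omega -> R) :
  (forall n, step (f n) (J n)) ->
  {ae P, forall w, \int[mu]_(s in `[0, T]) (f n s w ^+ 2) @[n --> \oo] --> (0 : R)} ->
  cip P J (fun=> 0).
Proof.
move=> fJ f0; apply: (step_cip fJ); apply: ae_cip => // n.
by have [] := step_measurable (fJ n).
Qed.

End Steps.

(** * Left-point sums along continuous paths *)

Section ContinuousPaths.
Context {R : realType}.
Implicit Types (T s c : R) (h k : R -> R).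

Definition cpath h : Prop := {within `[0, +oo[, continuous h}.

Lemma cpath_cvg h s : cpath h -> 0 < s -> h x @[x --> s] --> h s.
Proof.
move=> /continuous_within_itvcyP[hc _] s0; apply: hc.
by rewrite in_itv/= s0.
Qed.

Lemma cpath_cst c : cpath (cst c).
Proof. by move=> x; exact: cvg_cst. Qed.

Lemma cpathD h k : cpath h -> cpath k -> cpath (fun s => h s + k s).
Proof. by move=> hc kc x; apply: cvgD; [exact: hc|exact: kc]. Qed.

Lemma cpathM h k : cpath h -> cpath k -> cpath (fun s => h s * k s).
Proof. by move=> hc kc x; apply: cvgM; [exact: hc|exact: kc]. Qed.

Lemma cpath_sqrt h : cpath h -> cpath (fun s => Num.sqrt (h s)).
Proof.
by move=> hc x; exact: (cvg_comp _ _ (hc x) (@sqrt_continuous R (h x))).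
Qed.

Lemma cpath_itv T h : cpath h -> {within `[0, T], continuous h}.
Proof.
by apply: continuous_subspaceW => s /=; rewrite !in_itv/= andbT => /andP[].
Qed.

Lemma cpath_bound T h : cpath h ->
  exists2 M, 0 <= M & forall s, 0 <= s <= T -> `|h s| <= M.
Proof.
move=> hc; have [T0|T0] := leP 0 T; last first.
  exists 0 => // s /andP[s0 sT]; have := le_lt_trans (le_trans s0 sT) T0.
  by rewrite ltxx.
have [a _ ha] := EVT_max T0 (cpath_itv hc).
have [b _ hb] := EVT_min T0 (cpath_itv hc).
exists (`|h a| + `|h b|) => [|s sT]; first exact: addr_ge0.
have h1 : h s <= `|h a| by rewrite (le_trans (ha s sT))// ler_norm.
have h2 := hb s sT.
have h3 : - `|h b| <= h s by rewrite (le_trans _ h2)// lerNl -normrN ler_norm.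
rewrite ler_norml; apply/andP; split.
  by rewrite (le_trans _ h3)// lerN2 lerDr.
by rewrite (le_trans h1)// lerDl.
Qed.

Lemma cpath_bounded_meas T h : cpath h -> bounded_meas T h.
Proof.
move=> hc; split.
  by apply: subspace_continuous_measurable_fun => //; exact: cpath_itv.
by have [M _ hM] := cpath_bound T hc; exists M.
Qed.

End ContinuousPaths.

Section LeftSums.
Context {R : realType}.
Variable T : R.
Hypothesis T0 : 0 < T.
Implicit Types (x : nat -> R) (s : R) (n k : nat).

Local Notation nbr n := (Num.truncn (n%:R * T)).

Lemma tick_ge0 n k : 0 <= k%:R / n%:R :> R.
Proof. by rewrite divr_ge0. Qed.

Lemma tick_nd n k : k%:R / n%:R <= k.+1%:R / n%:R :> R.
Proof. by rewrite ler_wpM2r ?invr_ge0// ler_nat. Qed.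

Lemma tick_le n k : (k <= nbr n)%N -> k%:R / n%:R <= T.
Proof.
case: n => [|n]; first by rewrite invr0 mulr0 ltW.
rewrite truncn_ge_nat ?mulr_ge0 ?(ltW T0)// => kT.
by rewrite ler_pdivrMr ?ltr0n// mulrC.
Qed.

Lemma nbr_gt0 n k : (k < nbr n)%N -> (0 < n)%N.
Proof. by case: n => [|//]; rewrite truncn_gt_nat mul0r leNgt ltr0Sn. Qed.

(** A left-continuous step function: it takes the value [x k] on the cell that starts at tick [k],
    and vanishes at 0 and beyond the last tick, which may lie before [T]. *)
Definition lsum x n s : R :=
  \sum_(k < nbr n) x k * \1_(`]k%:R / n%:R, k.+1%:R / n%:R]) s.

Lemma indic_oc (a b s : R) : \1_(`]a, b]) s = (a < s <= b)%R%:R :> R.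
Proof. by rewrite indicE mem_setE in_itv. Qed.

Lemma tick_uniq n j k s : (0 < n)%N -> j%:R / n%:R < s <= j.+1%:R / n%:R ->
  k%:R / n%:R < s <= k.+1%:R / n%:R -> j = k.
Proof.
move=> n0 /andP[js sj] /andP[ks sk].
have : j%:R / n%:R < k.+1%:R / n%:R :> R by exact: lt_le_trans sk.
have : k%:R / n%:R < j.+1%:R / n%:R :> R by exact: lt_le_trans sj.
rewrite !ltr_pM2r ?invr_gt0 ?ltr0n// !ltr_nat !ltnS => kj jk.
by apply/eqP; rewrite eqn_leq jk kj.
Qed.

Lemma lsum_at x n k s : (k < nbr n)%N -> k%:R / n%:R < s <= k.+1%:R / n%:R ->
  lsum x n s = x k.
Proof.
move=> kn ks; rewrite /lsum (bigD1 (Ordinal kn))//= big1 ?addr0 => [|j].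
  by rewrite indic_oc ks mulr1.
rewrite -val_eqE/= => /eqP jk; rewrite indic_oc.
have [js|_] := boolP (j%:R / n%:R < s <= j.+1%:R / n%:R); last by rewrite mulr0.
have n0 := nbr_gt0 kn.
by case: jk; exact: tick_uniq js ks.
Qed.

Lemma lsum_bound x n s M : 0 <= M -> (forall k, (k < nbr n)%N -> `|x k| <= M) ->
  `|lsum x n s| <= M.
Proof.
move=> M0 xM.
have [[k kn ks]|] := pselect (exists2 k, (k < nbr n)%N & k%:R / n%:R < s <= k.+1%:R / n%:R).
  by rewrite (lsum_at _ kn ks) xM.
move=> nk; rewrite /lsum big1 ?normr0// => k _; rewrite indic_oc.
by have [ks|_] := boolP (k%:R / n%:R < s <= k.+1%:R / n%:R); rewrite ?mulr0//; case: nk; exists k.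
Qed.

Lemma tick_exists n s : (0 < n)%N -> 0 < s -> s + n%:R^-1 <= T ->
  exists2 k, (k < nbr n)%N & k%:R / n%:R < s <= k.+1%:R / n%:R.
Proof.
move=> n0 s0 sT.
have sN : s <= (nbr n)%:R / n%:R.
  rewrite ler_pdivlMr ?ltr0n//.
  have := truncnS_gt (n%:R * T); rewrite -natr1.
  have : (s + n%:R^-1) * n%:R <= n%:R * T by rewrite [leRHS]mulrC ler_wpM2r.
  by rewrite mulrDl mulVf ?pnatr_eq0 -?lt0n//; lra.
elim: (nbr n) sN => [|N IH]; first by rewrite mul0r leNgt s0.
have [sN _|Ns sN] := leP s (N%:R / n%:R).
  by have [k kN ks] := IH sN; exists k => //; rewrite ltnW.
by exists N => //; rewrite Ns.
Qed.

Lemma inv_small (e : R) : 0 < e -> \forall n \near \oo, (0 < n)%N /\ n%:R^-1 < e.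
Proof.
move=> e0; have := near_infty_natSinv_lt (PosNum e0); case=> N _ NH.
exists N.+1 => // -[|n]//= Nn; split => //; exact: NH.
Qed.

Lemma lsum_cvg (x : nat -> nat -> R) (h : R -> R) s : 0 < s < T ->
  h y @[y --> s] --> h s ->
  (\forall n \near \oo, forall k, (k < nbr n)%N -> x n k = h (k%:R / n%:R)) ->
  lsum (x n) n s @[n --> \oo] --> h s.
Proof.
move=> /andP[s0 sT] /cvgrPdist_le hs xh; apply/cvgrPdist_le => e e0.
have [del /= del0 Hdel] := hs e e0.
have sT' : 0 < T - s by rewrite subr_gt0.
apply: filterS3 (inv_small del0) (inv_small sT') xh => n [n0 nd] [_ nT] xn.
have [|k kn ks] := @tick_exists n s n0 s0; first by rewrite -lerBrDl ltW.
rewrite (lsum_at _ kn ks) xn//; apply: Hdel => /=.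
have /andP[k1 k2] := ks.
rewrite ger0_norm ?subr_ge0 1?ltW//; apply: le_lt_trans nd.
by move: k2; rewrite -natr1 mulrDl mul1r; lra.
Qed.

Lemma lsum_bounded_meas x n t : bounded_meas t (lsum x n).
Proof.
apply: bounded_meas_sum => k; apply: bounded_measM; first exact: bounded_meas_cst.
exact: bounded_meas_indic.
Qed.

(** Coefficients of simple processes must be bounded, whereas values of a continuous process are
    only bounded path by path. Truncation at level [n] is inactive on a given path once [n] exceeds
    its bound on [[0, T]]. *)
Definition clip n (y : R) : R := Num.max (- n%:R) (Num.min n%:R y).

Lemma clip_bound n y : `|clip n y| <= n%:R.
Proof.
rewrite ler_norml /clip le_max lexx/= ge_max ge_min lexx/= andbT.
by rewrite (@le_trans _ _ 0)// oppr_le0.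
Qed.

Lemma clip_id n y : `|y| <= n%:R -> clip n y = y.
Proof.
by rewrite ler_norml /clip => /andP[yl yu]; rewrite (min_idPr yu) (max_idPr yl).
Qed.

Lemma clip_le n y M : `|y| <= M -> `|clip n y| <= M.
Proof.
move=> yM; have [ny|yn] := leP `|y| n%:R; first by rewrite clip_id.
by rewrite (le_trans (clip_bound n y))// (le_trans (ltW yn)).
Qed.

Definition lclip (h : R -> R) n := lsum (fun k => clip n (h (k%:R / n%:R))) n.

Lemma lclip_bound h M : 0 <= M -> (forall s, 0 <= s <= T -> `|h s| <= M) ->
  forall n s, `|lclip h n s| <= M.
Proof.
move=> M0 hM n s; apply: lsum_bound => // k kn; apply: clip_le; apply: hM.
by rewrite tick_ge0 tick_le// ltnW.
Qed.

Lemma lclip_cvg h s : cpath h -> 0 < s < T -> lclip h n s @[n --> \oo] --> h s.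
Proof.
move=> hc sT; have /andP[s0 _] := sT.
apply: (@lsum_cvg (fun n k => clip n (h (k%:R / n%:R)))) => //; first exact: cpath_cvg.
have [M M0 hM] := cpath_bound T hc.
exists (Num.truncn M).+1 => // n /= Mn k kn; apply: clip_id.
rewrite (le_trans (hM _ _))//; first by rewrite tick_ge0 tick_le// ltnW.
by rewrite (le_trans (ltW (truncnS_gt M)))// ler_nat.
Qed.

Lemma lclip_cvg_int h (t : R) : cpath h -> t <= T ->
  \int[lebesgue_measure]_(s in `[0, t]) (lclip h n s - h s) ^+ 2 @[n --> \oo] --> (0 : R).
Proof.
move=> hc tT; have [M M0 hM] := cpath_bound T hc.
rewrite [X in _ --> X](_ : 0 = \int[lebesgue_measure]_(s in `[0, t]) cst 0 s); last first.
  by rewrite Rintegral_cst// mul0r.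
apply: (@bounded_cvg _ t (fun n s => (lclip h n s - h s) ^+ 2) (cst 0) ((M + M) ^+ 2)).
- move=> n; apply: bounded_measX2; apply: bounded_measB; first exact: lsum_bounded_meas.
  exact: cpath_bounded_meas.
- move=> n s /andP[s0 st]; rewrite normrX ler_pXn2r ?nnegrE ?addr_ge0//.
  rewrite (le_trans (ler_normB _ _))// lerD ?(lclip_bound M0 hM)// hM//.
  by rewrite (ltW s0) (le_trans (ltW st)).
- exact: measurable_cst.
- move=> s /andP[s0 st] /=.
  have H : lclip h n s - h s @[n --> \oo] --> (0 : R).
    rewrite -(subrr (h s)); apply: cvgB; last exact: cvg_cst.
    by apply: lclip_cvg => //; rewrite s0 (lt_le_trans st).
  have HH := cvgM H H; rewrite mulr0 in HH.
  by under eq_fun do rewrite expr2; exact: HH.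
Qed.

End LeftSums.

(** * The Ito integral of a continuous adapted process *)

Section SimpleIntegrals.
Context {R : realType} {d : measure_display} {Omega : measurableType d}.
Variable P : probability Omega R.
Variables (F : R -> set (set Omega)) (W : R -> Omega -> R).
Hypotheses (FF : filtration F) (FW : filtered_wiener P F W).
Local Notation mu := (@lebesgue_measure R).
Implicit Types (S : simple_process F) (t u v s : R).

Lemma simple_time_ge0k S k : 0 <= simple_time S k.
Proof.
elim: k => [|k IH]; first exact: simple_time_ge0.
exact: le_trans (simple_time_nd S k).
Qed.

Lemma simple_integral0 S w : simple_integral S W 0 w = 0.
Proof.
rewrite /simple_integral big1// => k _.
by rewrite !(min_idPr (simple_time_ge0k _ _)) subrr mulr0.
Qed.

Lemma simple_val0 S s w : s <= 0 -> simple_val S s w = 0.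
Proof.
move=> s0; rewrite /simple_val big1// => k _; rewrite indic_oc.
by rewrite ltNge (le_trans s0 (simple_time_ge0k S k))/= mulr0.
Qed.

Lemma simple_bounded_meas t S w : bounded_meas t (simple_val S ^~ w).
Proof.
apply: bounded_meas_sum => k; apply: bounded_measM; first exact: bounded_meas_cst.
exact: bounded_meas_indic.
Qed.

(** The partition is clamped to [[u, v]]. The factor [(t k < v)] keeps the coefficients adapted: if
    [v <= t k], the clamped interval is reduced to [v], where the coefficient may not be known yet,
    and the term is zero anyway. [eta] may be unbounded, which is why [step] is wider than
    [simple_process]. *)
Lemma simple_step T S (eta : Omega -> R) u v : 0 <= u -> u <= v -> v <= T ->
  preimages eta `<=` F u ->
  step F W T (fun s w => eta w * \1_(`]u, v]) s * simple_val S s w)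
    (fun w => eta w * (simple_integral S W v w - simple_integral S W u w)).
Proof.
move=> u0 uv vT meta.
pose t k := simple_time S k.
pose cl x := Num.min (Num.max x u) v.
have cl_v x : v <= x -> cl x = v.
  by move=> vx; apply/min_idPr; rewrite le_max vx.
have clW x w : W (Num.min x v) w - W (Num.min x u) w = W (cl x) w - W u w.
  rewrite /cl; have [xu|ux] := leP x u.
    by rewrite (min_idPl (le_trans xu uv)) (min_idPl uv) !subrr.
  by [].
exists 'I_(simple_size S), (fun k : 'I__ => cl (t k)), (fun k : 'I__ => cl (t k.+1)),
  (fun (k : 'I__) w => (t k < v)%R%:R * (eta w * simple_coef S k w)); split.
- move=> k; split.
  + by rewrite /cl le_min le_max u0 orbT (le_trans u0).
  + rewrite /cl le_min !ge_min lexx orbT andbT ge_max !le_max lexx orbT andbT.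
    by rewrite simple_time_nd.
  + by rewrite /cl ge_min vT orbT.
- move=> k; have [tv|_] := boolP (t k < v); last first.
    by under eq_fun do rewrite mul0r; apply/(preimagesP FF); exact: measurable_cst.
  have tcl : t k <= cl (t k) by rewrite /cl le_min le_max lexx/= ltW.
  have ucl : u <= cl (t k) by rewrite /cl le_min le_max lexx orbT.
  under eq_fun do rewrite mul1r.
  apply/(preimagesP FF); apply: measurable_funM; apply/(preimagesP FF).
    exact: (preimagesS FF u0 ucl).
  apply: (preimagesS FF (simple_time_ge0k S k) tcl).
  exact: simple_coef_meas.
- move=> s w; rewrite /simple_val mulr_sumr; apply: eq_bigr => k _.
  rewrite !indic_oc -/(t k) -/(t k.+1) /cl gt_min gt_max le_min le_max.
  have tk : t k <= t k.+1 by exact: simple_time_nd.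
  rewrite -!mulrA [in RHS]mulrCA; congr (_ * _); rewrite mulrCA [in RHS]mulrCA; congr (_ * _).
  rewrite -!natrM; congr (_%:R).
  have [us|su] := ltP u s; have [sv|vs] := leP s v => //=;
    have [ts|st] := ltP (t k) s => //=; have [st1|t1s] := leP s (t k.+1) => //=;
    rewrite ?muln0 ?mul0n ?mul1n ?muln1//=.
  by rewrite (lt_le_trans ts sv).
- move=> w; rewrite /simple_integral -sumrB mulr_sumr; apply: eq_bigr => k _.
  rewrite -/(t k) -/(t k.+1) -mulrBr.
  have -> : W (Num.min (t k.+1) v) w - W (Num.min (t k) v) w -
    (W (Num.min (t k.+1) u) w - W (Num.min (t k) u) w) = W (cl (t k.+1)) w - W (cl (t k)) w.
    by have := clW (t k.+1) w; have := clW (t k) w; lra.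
  have [tv|vt] := ltP (t k) v; first by rewrite mul1r mulrA.
  by rewrite !cl_v ?subrr ?mulr0// (le_trans vt)// simple_time_nd.
Qed.

Lemma simple_step0 t S : 0 <= t ->
  step F W t (fun s w => \1_(`]0, t]) s * simple_val S s w) (simple_integral S W t).
Proof.
move=> t0; have m1 : preimages (cst 1 : Omega -> R) `<=` F 0.
  by apply/(preimagesP FF); exact: measurable_cst.
have := simple_step S (lexx 0) t0 (lexx t) m1.
under eq_fun do under eq_fun do rewrite mul1r.
by under [X in step _ _ _ _ X -> _]eq_fun do rewrite mul1r simple_integral0 subr0.
Qed.

Lemma simple_cut t S s w : 0 <= s <= t -> \1_(`]0, t]) s * simple_val S s w = simple_val S s w.
Proof.
move=> /andP[]; rewrite le_eqVlt => /predU1P[<- _|s0 st].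
  by rewrite simple_val0// mulr0.
by rewrite indic_oc s0 st mul1r.
Qed.

Lemma simple_integral_measurable t S : 0 <= t -> measurable_fun setT (simple_integral S W t).
Proof. by move=> t0; have [] := step_measurable FF FW t0 (simple_step0 S t0). Qed.

End SimpleIntegrals.

Section ItoIntegral.
Context {R : realType} {d : measure_display} {Omega : measurableType d}.
Variable P : probability Omega R.
Hypothesis complete_P : measure_is_complete P.
Variables (F : R -> set (set Omega)) (W : R -> Omega -> R).
Hypotheses (FF : filtration F) (FW : filtered_wiener P F W).
Variable T : R.
Hypothesis T0 : 0 < T.
Local Notation mu := (@lebesgue_measure R).

Lemma clip_measurable n d' (E : measurableType d') (xi : E -> R) : measurable_fun setT xi ->
  measurable_fun setT (fun w => clip n (xi w)).
Proof. by move=> mxi; apply: measurable_maxr => //; apply: measurable_minr. Qed.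

Section adapted.
Variable H : R -> Omega -> R.
Hypotheses (aH : adapted F H) (cH : continuous_paths P H).

Lemma adapted_measurable (t : R) : 0 <= t -> measurable_fun setT (H t).
Proof.
move=> t0; apply: (filtration_measurable_fun FF t0); apply/(preimagesP FF).
exact: aH.
Qed.

(** Left transparent so that its value is [lclip] by computation. *)
Definition left_process (n : nat) : simple_process F.
Proof.
refine (@SimpleProcess _ _ _ F (Num.truncn (n%:R * T)) (fun k => k%:R / n%:R)
  (fun k w => clip n (H (k%:R / n%:R) w)) _ _ _ _).
- exact: tick_ge0.
- exact: tick_nd.
- move=> k; apply/(preimagesP FF); apply: clip_measurable; apply/(preimagesP FF).
  exact: aH (tick_ge0 _ _).
- by move=> k; exists n%:R => w; exact: clip_bound.
Defined.

Lemma left_process_val (n : nat) (s : R) (w : Omega) : simple_val (left_process n) s w = lclip T (H ^~ w) n s.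
Proof. by []. Qed.

Let L n := left_process n.

Lemma left_process_cvg (t : R) : t <= T -> {ae P, forall w,
  \int[mu]_(s in `[0, t]) (simple_val (L n) s w - H s w) ^+ 2 @[n --> \oo] --> (0 : R)}.
Proof.
by move=> tT; apply: filterS cH => w Hw; exact: (lclip_cvg_int T0 Hw tT).
Qed.

(** This avoids joint measurability of [H]: the distance is the almost sure limit of the distances
    from [S] to [L n], which [step_grid] writes as finite sums. *)
Lemma simple_dist_measurable (S : simple_process F) (t : R) : 0 <= t -> t <= T ->
  measurable_fun setT (fun w => \int[mu]_(s in `[0, t]) (simple_val S s w - H s w) ^+ 2).
Proof.
move=> t0 tT.
apply: (@ae_lim_measurable _ _ _ P complete_P
  (fun n w => \int[mu]_(s in `[0, t]) (simple_val S s w - simple_val (L n) s w) ^+ 2)).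
  move=> n; have := stepB FF (simple_step0 W FF S t0) (simple_step0 W FF (L n) t0).
  move=> /(step_measurable FF FW t0)[_]; congr (measurable_fun _ _).
  apply/funext => w; apply: eq_Rintegral => s; rewrite inE/= in_itv/= => st.
  by rewrite !simple_cut.
apply: filterS cH => w Hw.
have [M M0 HM] := cpath_bound T Hw.
have [_ [N HN]] := simple_bounded_meas t S w.
have bS := simple_bounded_meas t S w.
apply: (@bounded_cvg _ t (fun n s => (simple_val S s w - simple_val (L n) s w) ^+ 2)
  (fun s => (simple_val S s w - H s w) ^+ 2) ((N + M) ^+ 2)).
- by move=> n; apply: bounded_measX2; apply: bounded_measB => //; exact: simple_bounded_meas.
- move=> n s /andP[s0 st].
  have sN : `|simple_val S s w| <= N by apply: HN; rewrite !ltW.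
  have N0 : 0 <= N by exact: le_trans sN.
  rewrite normrX ler_pXn2r ?nnegrE ?addr_ge0//.
  by rewrite (le_trans (ler_normB _ _))// lerD// (lclip_bound T0 M0 HM).
- by case: (bounded_measX2 (bounded_measB bS (cpath_bounded_meas t Hw))).
- move=> s /andP[s0 st].
  have HH : simple_val S s w - simple_val (L n) s w @[n --> \oo] --> simple_val S s w - H s w.
    apply: cvgB; first exact: cvg_cst.
    by apply: (lclip_cvg T0 Hw); rewrite s0 (lt_le_trans st).
  by under eq_fun do rewrite expr2; exact: (cvgM HH HH).
Qed.

Lemma left_process_cip (t : R) : 0 <= t -> t <= T ->
  cip P (fun n w => \int[mu]_(s in `[0, t]) (simple_val (L n) s w - H s w) ^+ 2) (fun=> 0).
Proof.
move=> t0 tT; apply: ae_cip => //; last exact: left_process_cvg.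
by move=> n; exact: simple_dist_measurable.
Qed.

Lemma simple_integrals_close (S S' : nat -> simple_process F) (t : R) : 0 <= t -> t <= T ->
  cip P (fun n w => \int[mu]_(s in `[0, t]) (simple_val (S n) s w - H s w) ^+ 2) (fun=> 0) ->
  cip P (fun n w => \int[mu]_(s in `[0, t]) (simple_val (S' n) s w - H s w) ^+ 2) (fun=> 0) ->
  cip P (fun n w => simple_integral (S n) W t w - simple_integral (S' n) W t w) (fun=> 0).
Proof.
move=> t0 tT SH SH'.
pose D (S : nat -> simple_process F) n w := \int[mu]_(s in `[0, t]) (simple_val (S n) s w - H s w) ^+ 2.
apply: (step_cip FF FW t0 (fun n => stepB FF (simple_step0 W FF (S n) t0) (simple_step0 W FF (S' n) t0))).
refine (@cip_le _ _ _ P _ (fun n w => (D S n w + D S' n w) + (D S n w + D S' n w)) _ _); last first.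
  have H1 := cipD SH SH'; have := cipD H1 H1.
  by apply: cip_ae_eq => [n|]; apply: aeW => w //; rewrite !addr0.
move=> n; apply: filterS cH => w Hw.
have bS := simple_bounded_meas t (S n) w.
have bS' := simple_bounded_meas t (S' n) w.
have bH := cpath_bounded_meas t Hw.
have b1 := bounded_measX2 (bounded_measB bS bH).
have b2 := bounded_measX2 (bounded_measB bS' bH).
have b3 := bounded_measX2 (bounded_measB bS bS').
rewrite ger0_norm; last by apply: Rintegral_ge0 => s _; exact: sqr_ge0.
rewrite /D -RintegralD//; try exact: bounded_meas_integrable.
rewrite -RintegralD//; try exact: (bounded_meas_integrable (bounded_measD b1 b2)).
under eq_Rintegral => s.
  rewrite inE/= in_itv/= => st; rewrite !simple_cut//; over.
apply: le_Rintegral => //.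
- exact: bounded_meas_integrable.
- exact: (bounded_meas_integrable (bounded_measD (bounded_measD b1 b2) (bounded_measD b1 b2))).
- move=> s _; set x := simple_val _ s w; set y := simple_val _ s w; set z := H s w.
  (* [2 (x - z)^2 + 2 (y - z)^2 - (x - y)^2 = (x + y - 2 z)^2]. *)
  by have := sqr_ge0 (x + y - 2 * z); nra.
Qed.

(** Every version of the integral, whatever sequence defines it, is the limit of the same left-point
    integrals. This pins down the arbitrary choice made by [ito_integral]. *)
Lemma ito_integral_limit (t : R) I : 0 <= t -> t <= T -> is_ito_integral P F W H t I ->
  cip P (fun n => simple_integral (L n) W t) I.
Proof.
move=> t0 tT [mI _ _ [S SH SI]].
have {}SH : cip P (fun n w => \int[mu]_(s in `[0, t]) (simple_val (S n) s w - H s w) ^+ 2) (fun=> 0).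
  by apply/(cip_cvg_in_probability P) => // n; exact: simple_dist_measurable.
have {}SI : cip P (fun n => simple_integral (S n) W t) I.
  by apply/(cip_cvg_in_probability P) => // n; exact: (simple_integral_measurable FF FW).
have := cipD (simple_integrals_close t0 tT (left_process_cip t0 tT) SH) SI.
by apply: cip_ae_eq => [n|]; apply: aeW => w; rewrite ?subrK ?add0r.
Qed.

(** If the left-point integrals were not Cauchy in probability, two index sequences tending to
    infinity would keep them apart, against [simple_integrals_close]. The limit given by
    [cip_cauchy] is then an Ito integral, with [L (m n)] as approximating sequence. *)
Lemma ito_integral_exists (t : R) : 0 <= t -> t <= T -> exists I, is_ito_integral P F W H t I.
Proof.
move=> t0 tT.
have [||m [I [mk mI LI]]] := @cip_cauchy _ _ _ P complete_P (fun n => simple_integral (L n) W t).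
- by move=> n; exact: (simple_integral_measurable FF FW).
- move=> e r e0 r0; apply: contrapT => /forallNP HN.
  have {}HN N : exists nm : nat * nat, [/\ (N <= nm.1)%N, (N <= nm.2)%N &
      ~ outer_le P [set w | e <= `|simple_integral (L nm.1) W t w - simple_integral (L nm.2) W t w|] r].
    have /existsNP[n /existsNP[k /not_implyP[Nn /not_implyP[Nk H1]]]] := HN N.
    by exists (n, k).
  pose c N := sval (cid (HN N)).
  have cP N : [/\ (N <= (c N).1)%N, (N <= (c N).2)%N &
      ~ outer_le P [set w | e <= `|simple_integral (L (c N).1) W t w - simple_integral (L (c N).2) W t w|] r].
    by rewrite /c; case: cid.
  have sub (m : nat -> nat) : (forall N, (N <= m N)%N) -> m @ \oo --> \oo.
    move=> mN; apply/cvgnyPge => K; exists K => // N /= KN; exact: leq_trans (mN N).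
  have c1 : (fun N => (c N).1) @ \oo --> \oo by apply: sub => N; have [] := cP N.
  have c2 : (fun N => (c N).2) @ \oo --> \oo by apply: sub => N; have [] := cP N.
  have Hl := left_process_cip t0 tT.
  have := simple_integrals_close t0 tT (cip_subseq c1 Hl) (cip_subseq c2 Hl).
  move=> /(_ e r e0 r0)[N _ /(_ N (leqnn N))].
  by have [_ _ nH] := cP N; apply: contra_not nH; apply: outer_leS => // w /=; rewrite subr0.
exists I; split => //.
- by move=> s /andP[s0 _]; exact: aH.
- apply: filterS cH => w Hw; have bH := cpath_bounded_meas t Hw; split.
    by case: bH.
  exact: (bounded_meas_integrable (bounded_measX2 bH)).
- have mo : m @ \oo --> \oo.
    by apply/cvgnyPge => K; exists K => // N /= KN; exact: leq_trans (mk N).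
  exists (fun n => L (m n)).
    apply/(cip_cvg_in_probability P) => //.
      by move=> n; exact: simple_dist_measurable.
    exact: (cip_subseq mo (left_process_cip t0 tT)).
  apply/(cip_cvg_in_probability P) => // n.
  exact: (simple_integral_measurable FF FW).
Qed.

Lemma ito_integralP (t : R) : 0 <= t -> t <= T ->
  is_ito_integral P F W H t (ito_integral P F W H t).
Proof.
move=> t0 tT; have [I HI] := ito_integral_exists t0 tT.
exact: (@xgetPex _ (fun=> 0) [set I | is_ito_integral P F W H t I] (ex_intro _ I HI)).
Qed.

Lemma ito_integral_measurable (t : R) : 0 <= t -> t <= T ->
  measurable_fun setT (ito_integral P F W H t).
Proof. by move=> t0 tT; have [] := ito_integralP t0 tT. Qed.

Lemma ito_integral_cip (t : R) : 0 <= t -> t <= T ->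
  cip P (fun n => simple_integral (L n) W t) (ito_integral P F W H t).
Proof. by move=> t0 tT; exact: ito_integral_limit (ito_integralP t0 tT). Qed.

End adapted.
End ItoIntegral.

Section PathIncrements.
Context {R : realType}.
Local Notation mu := (@lebesgue_measure R).
Implicit Types (T : R) (f h : R -> R).

Lemma Rintegral_restrict T f x : 0 <= x -> x <= T ->
  \int[mu]_(s in `[0, T]) (f s * \1_(`[0, x]) s) = \int[mu]_(s in `[0, x]) f s.
Proof.
move=> x0 xT; have -> : `[0, x]%classic = `[0, T] `&` `[0, x] :> set R.
  apply/seteqP; split => s /=; rewrite !in_itv/=; last by case.
  by move=> /andP[s0 sx]; rewrite s0 sx (le_trans sx).
rewrite Rintegral_mkcondr; apply: eq_Rintegral => s; rewrite inE/= => sT.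
have sT' : s \in `[0, T]%classic by apply/mem_set.
rewrite patchE indicE in_setI sT'/=.
by case: (_ \in _); rewrite ?mulr1 ?mulr0.
Qed.

Lemma Rintegral_incr T f a b : bounded_meas T f -> 0 <= a -> a <= b -> b <= T ->
  \int[mu]_(s in `[0, b]) f s - \int[mu]_(s in `[0, a]) f s =
  \int[mu]_(s in `[0, T]) (\1_(`]a, b]) s * f s).
Proof.
move=> bf a0 ab bT.
have bx x : bounded_meas T (fun s => f s * \1_(`[0, x]) s).
  by apply: bounded_measM => //; exact: bounded_meas_indic.
rewrite -(@Rintegral_restrict T f b) ?(le_trans a0)//.
rewrite -(@Rintegral_restrict T f a) ?(le_trans ab)//.
rewrite -RintegralB//; [|exact: bounded_meas_integrable..].
apply: eq_Rintegral => s; rewrite inE/= in_itv/= => /andP[s0 sT].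
rewrite indic_oc !indicE !mem_setE !in_itv/= s0/= -mulrBr mulrC; congr (_ * _).
have [sa|as_] := leP s a; first by rewrite (le_trans sa ab)/= subrr.
by rewrite subr0.
Qed.

Lemma Rintegral_incr_bound T f a b M : bounded_meas T f -> 0 <= a -> a <= b -> b <= T ->
  (forall s, 0 <= s <= T -> `|f s| <= M) ->
  `|\int[mu]_(s in `[0, b]) f s - \int[mu]_(s in `[0, a]) f s| <= M * (b - a).
Proof.
move=> bf a0 ab bT fM; rewrite (Rintegral_incr bf a0 ab bT).
have b1 : bounded_meas T (fun s => \1_(`]a, b]) s * f s).
  by apply: bounded_measM => //; exact: bounded_meas_indic.
have b2 : bounded_meas T (fun s => M * \1_(`]a, b]) s).
  by apply: bounded_measM; [exact: bounded_meas_cst|exact: bounded_meas_indic].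
rewrite -(Rintegral_indic_itv M a0 ab bT).
rewrite (le_trans (le_normr_Rintegral _ (bounded_meas_integrable b1)))//.
apply: le_Rintegral => //.
- exact: (integrable_norm (bounded_meas_integrable b1)).
- exact: bounded_meas_integrable.
- move=> s /=; rewrite in_itv/= => sT.
  have i0 : 0 <= \1_(`]a, b]) s :> R by rewrite indicE.
  by rewrite normrM (ger0_norm i0) mulrC ler_wpM2r// fM.
Qed.

End PathIncrements.

Section CipMore.
Context {R : realType} {d : measure_display} {Omega : measurableType d}.
Variable P : probability Omega R.

(** Row [n] is followed until it is within [1 / (n + 1)] of [L n] off an event of outer probability
    [1 / (n + 1)]. The [L n] themselves need not converge. *)
Lemma cip_diag (J : nat -> nat -> Omega -> R) (L : nat -> Omega -> R) :
  (forall n, cip P (J n) (L n)) ->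
  exists m : nat -> nat, (forall n, (n <= m n)%N) /\
    cip P (fun n w => J n (m n) w - L n w) (fun=> 0).
Proof.
move=> JL.
have Hm n : exists k, (n <= k)%N /\
    outer_le P [set w | n.+1%:R^-1 <= `|J n k w - L n w|] n.+1%:R^-1.
  have n0 : (0 : R) < n.+1%:R^-1 by [].
  have [N _ HN] := JL n _ _ n0 n0; exists (maxn n N); split; first exact: leq_maxl.
  by apply: HN => /=; exact: leq_maxr.
exists (fun n => sval (cid (Hm n))); split; first by move=> n; case: cid => k [].
move=> e r e0 r0.
apply: filterS2 (inv_small e0) (inv_small r0) => -[|n] [// _ ne] [_ nr].
case: cid => k [_ /= H]; apply: outer_leS H => [w /=|].
  rewrite subr0 => /(le_trans _); apply; apply: le_trans (ltW ne).
  by rewrite lef_pV2 ?posrE// ler_nat.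
by apply: le_trans (ltW nr); rewrite lef_pV2 ?posrE// ler_nat.
Qed.

Lemma cip_sum N (f : 'I_N -> nat -> Omega -> R) (u : 'I_N -> Omega -> R) :
  (forall k, cip P (f k) (u k)) ->
  cip P (fun n w => \sum_k f k n w) (fun w => \sum_k u k w).
Proof.
move=> fu; have : forall r : seq 'I_N,
    cip P (fun n w => \sum_(k <- r) f k n w) (fun w => \sum_(k <- r) u k w); last exact.
elim=> [|k r IH].
  have := cip_cst P (fun=> 0); apply: cip_ae_eq => [n|]; apply: aeW => w; by rewrite big_nil.
have := cipD (fu k) IH; apply: cip_ae_eq => [n|]; apply: aeW => w; by rewrite big_cons.
Qed.

End CipMore.

(** * Left-point sums against an integral process *)

Section ItoRiemann.
Context {R : realType} {d : measure_display} {Omega : measurableType d}.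
Variable P : probability Omega R.
Hypothesis complete_P : measure_is_complete P.
Variables (F : R -> set (set Omega)) (W : R -> Omega -> R).
Hypotheses (FF : filtration F) (FW : filtered_wiener P F W).
Variable T : R.
Hypothesis T0 : 0 < T.
Local Notation mu := (@lebesgue_measure R).
Local Notation nbr n := (Num.truncn (n%:R * T)).
Local Notation ito := (ito_integral P F W).

Lemma adaptedM Y H : adapted F Y -> adapted F H -> adapted F (fun s w => Y s w * H s w).
Proof.
move=> aY aH t t0; apply/(preimagesP FF).
by apply: measurable_funM; apply/(preimagesP FF); [exact: aY|exact: aH].
Qed.

Lemma continuous_pathsM Y H : continuous_paths P Y -> continuous_paths P H ->
  continuous_paths P (fun s w => Y s w * H s w).
Proof. by move=> cY cH; apply: filterS2 cY cH => w; exact: cpathM. Qed.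

Section riemann.
Variables (Y H : R -> Omega -> R).
Hypotheses (aY : adapted F Y) (cY : continuous_paths P Y)
  (aH : adapted F H) (cH : continuous_paths P H).

Let YH s w := Y s w * H s w.
Let aYH : adapted F YH. Proof. exact: adaptedM. Qed.
Let cYH : continuous_paths P YH. Proof. exact: continuous_pathsM. Qed.
Let S m := left_process FF T aH m.
Let S' m := left_process FF T aYH m.

Let L n w := \sum_(k < nbr n) Y (k%:R / n%:R) w *
  (ito H (k.+1%:R / n%:R) w - ito H (k%:R / n%:R) w) - ito YH T w.

Let J n m w := \sum_(k < nbr n) Y (k%:R / n%:R) w *
  (simple_integral (S m) W (k.+1%:R / n%:R) w - simple_integral (S m) W (k%:R / n%:R) w)
  - simple_integral (S' m) W T w.

Let JL n : cip P (J n) (L n).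
Proof.
apply: cipB; last exact: (ito_integral_cip complete_P FF FW T0 aYH cYH (ltW T0) (lexx T)).
apply: cip_sum => k; have kn := ltn_ord k.
have k1 := tick_le T0 kn; have k0 := tick_le T0 (ltnW kn).
have p1 := @tick_ge0 R n k.+1; have p0 := @tick_ge0 R n k.
have mito := ito_integral_measurable complete_P FF FW T0 aH cH.
apply: (cipM complete_P).
- exact: (adapted_measurable FF aY).
- by apply: measurable_funB; apply: mito.
- exact: cip_cst.
- by apply: cipB; apply: (ito_integral_cip complete_P FF FW T0 aH cH).
Qed.

Let f n m s w := \sum_(k < nbr n) Y (k%:R / n%:R) w *
  \1_(`]k%:R / n%:R, k.+1%:R / n%:R]) s * simple_val (S m) s w
  - \1_(`]0, T]) s * simple_val (S' m) s w.

Let fJ n m : step F W T (f n m) (J n m).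
Proof.
apply: (stepB FF); last exact: (simple_step0 W FF (S' m) (ltW T0)).
apply: step_sum => k; apply: (simple_step W FF).
- exact: tick_ge0.
- exact: tick_nd.
- exact: (tick_le T0 (ltn_ord k)).
- exact: aY (tick_ge0 _ _).
Qed.

(** The versions of the integral of [H] at the ticks are limits of integrals of the same [S m], so
    the error [L n] is the limit in [m] of the step integrals [J n m]. After a diagonal choice the
    integrands [f n (m n)] tend to [Y H - Y H = 0] at every interior time, boundedly along each
    continuous path. *)
Lemma ito_riemann_sum :
  cip P (fun n w => \sum_(k < nbr n) Y (k%:R / n%:R) w *
    (ito H (k.+1%:R / n%:R) w - ito H (k%:R / n%:R) w)) (ito YH T).
Proof.
apply/cip0; have [m [nm JL0]] := cip_diag JL.
have mo : m @ \oo --> \oo.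
  by apply/cvgnyPge => K; exists K => // N /= KN; exact: leq_trans (nm N).
suff J0 : cip P (fun n => J n (m n)) (fun=> 0).
  have := cipB J0 JL0; apply: cip_ae_eq => [n|]; apply: aeW => w; last by rewrite subrr.
  by rewrite opprB subrKC.
apply: (step_ae_cip complete_P FF FW (ltW T0) (fun n => fJ n (m n))).
apply: filterS2 cY cH => w Yw Hw.
have YHw := cpathM Yw Hw.
have [A A0 YA] := cpath_bound T Yw.
have [C C0 HC] := cpath_bound T Hw.
have [D D0 YHD] := cpath_bound T YHw.
pose g n s := lsum T (fun k => Y (k%:R / n%:R) w) n s * lclip T (H ^~ w) (m n) s
  - \1_(`]0, T]) s * lclip T (YH ^~ w) (m n) s.
have fg n s : f n (m n) s w = g n s by rewrite /f /g /lsum mulr_suml.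
suff G : \int[mu]_(s in `[0, T]) g n s ^+ 2 @[n --> \oo] --> (0 : R).
  apply: cvg_trans G; apply: near_eq_cvg; apply: nearW => n.
  by apply: eq_Rintegral => s _; rewrite fg.
rewrite [X in _ --> X](_ : 0 = \int[mu]_(s in `[0, T]) cst 0 s); last first.
  by rewrite Rintegral_cst// mul0r.
apply: (@bounded_cvg _ T (fun n s => g n s ^+ 2) (cst 0) ((A * C + D) ^+ 2)).
- move=> n; apply: bounded_measX2; apply: bounded_measB; apply: bounded_measM.
  + exact: lsum_bounded_meas.
  + exact: lsum_bounded_meas.
  + exact: bounded_meas_indic.
  + exact: lsum_bounded_meas.
- move=> n s sT; rewrite normrX ler_pXn2r ?nnegrE ?addr_ge0 ?mulr_ge0//.
  rewrite (le_trans (ler_normB _ _))// lerD// normrM.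
    apply: ler_pM => //; last exact: lclip_bound.
    apply: lsum_bound => // k kn; apply: YA.
    by rewrite tick_ge0 tick_le// ltnW.
  rewrite -[leRHS]mul1r; apply: ler_pM => //; last exact: lclip_bound.
  by rewrite ger0_norm indicE//; case: (_ \in _).
- exact: measurable_cst.
- move=> s sT; have /andP[s0 sT'] := sT.
  have H1 : lsum T (fun k => Y (k%:R / n%:R) w) n s @[n --> \oo] --> Y s w.
    apply: (lsum_cvg (x := fun n k => Y (k%:R / n%:R) w) (h := Y ^~ w)) => //.
      exact: (cpath_cvg Yw).
    by apply: nearW.
  have H2 : lclip T (H ^~ w) (m n) s @[n --> \oo] --> H s w.
    exact: (cvg_comp m (fun j => lclip T (H ^~ w) j s) mo (lclip_cvg T0 Hw sT)).
  have H3 : lclip T (YH ^~ w) (m n) s @[n --> \oo] --> YH s w.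
    exact: (cvg_comp m (fun j => lclip T (YH ^~ w) j s) mo (lclip_cvg T0 YHw sT)).
  have H4 : g n s @[n --> \oo] --> (0 : R).
    have -> : (0 : R) = Y s w * H s w - 1 * YH s w by rewrite mul1r subrr.
    apply: cvgB; first exact: cvgM.
    by under eq_fun do rewrite indic_oc s0 (ltW sT'); apply: cvgM => //; exact: cvg_cst.
  have H5 := cvgM H4 H4; rewrite mulr0 in H5.
  by under eq_fun do rewrite expr2; exact: H5.
Qed.

End riemann.

(** For fixed [n] the sum is the integral of [H] times the left-point interpolation of [Y]. With
    [H = 1] this is convergence of ordinary Riemann sums. *)
Lemma drift_riemann_sum Y H : continuous_paths P Y -> continuous_paths P H ->
  {ae P, forall w, \sum_(k < nbr n) Y (k%:R / n%:R) w *
    (\int[mu]_(s in `[0, k.+1%:R / n%:R]) H s w - \int[mu]_(s in `[0, k%:R / n%:R]) H s w)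
    @[n --> \oo] --> \int[mu]_(s in `[0, T]) (Y s w * H s w)}.
Proof.
move=> cY cH; apply: filterS2 cY cH => w Yw Hw.
have [A A0 YA] := cpath_bound T Yw.
have [C C0 HC] := cpath_bound T Hw.
have bH := cpath_bounded_meas T Hw.
pose g n s := lsum T (fun k => Y (k%:R / n%:R) w) n s * H s w.
have gE n : \sum_(k < nbr n) Y (k%:R / n%:R) w *
    (\int[mu]_(s in `[0, k.+1%:R / n%:R]) H s w - \int[mu]_(s in `[0, k%:R / n%:R]) H s w) =
    \int[mu]_(s in `[0, T]) g n s.
  rewrite /g /lsum; under [RHS]eq_Rintegral do rewrite mulr_suml.
  have bk k : bounded_meas T (fun s => \1_(`]k%:R / n%:R, k.+1%:R / n%:R]) s * H s w).
    by apply: bounded_measM => //; exact: bounded_meas_indic.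
  rewrite Rintegral_sum => [|k]; last first.
    by under eq_fun do rewrite -mulrA; apply: bounded_measM => //; exact: bounded_meas_cst.
  apply: eq_bigr => k _; have kn := ltn_ord k.
  rewrite (Rintegral_incr bH) ?tick_ge0 ?tick_nd ?tick_le//.
  rewrite -RintegralZl//; last exact: bounded_meas_integrable.
  by apply: eq_Rintegral => s _; rewrite mulrA.
under eq_fun do rewrite gE.
apply: (@bounded_cvg _ T g (fun s => Y s w * H s w) (A * C)).
- by move=> n; apply: bounded_measM => //; exact: lsum_bounded_meas.
- move=> n s /andP[s0 sT]; rewrite normrM; apply: ler_pM => //; last by apply: HC; rewrite !ltW.
  apply: lsum_bound => // k kn; apply: YA.
  by rewrite tick_ge0 tick_le// ltnW.
- by case: (cpath_bounded_meas T (cpathM Yw Hw)).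
- move=> s sT; have /andP[s0 sT'] := sT; apply: cvgM; last exact: cvg_cst.
  apply: (lsum_cvg (x := fun n k => Y (k%:R / n%:R) w) (h := Y ^~ w)) => //.
    exact: (cpath_cvg Yw).
  by apply: nearW.
Qed.

End ItoRiemann.

(** * Short-time behaviour of an Ito integral *)

Section LocalIncrement.
Context {R : realType} {d : measure_display} {Omega : measurableType d}.
Variable P : probability Omega R.
Hypothesis complete_P : measure_is_complete P.
Variables (F : R -> set (set Omega)) (W : R -> Omega -> R).
Hypotheses (FF : filtration F) (FW : filtered_wiener P F W).
Variable t : R.
Hypothesis t0 : 0 < t.
Local Notation mu := (@lebesgue_measure R).
Local Notation ito := (ito_integral P F W).

Lemma step_single T (xi : Omega -> R) u v : 0 <= u -> u <= v -> v <= T ->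
  preimages xi `<=` F u ->
  step F W T (fun s w => xi w * \1_(`]u, v]) s) (fun w => xi w * (W v w - W u w)).
Proof.
move=> u0 uv vT mxi; exists unit, (fun=> u), (fun=> v), (fun=> xi); split => //.
  by move=> s w; rewrite (big_pred1 tt)// => -[].
by move=> w; rewrite (big_pred1 tt)// => -[].
Qed.

Definition gap n : R := t / n.+1%:R.
Definition before n : R := t - gap n.

Lemma gap_gt0 n : 0 < gap n. Proof. by rewrite divr_gt0. Qed.

Lemma before_ge0 n : 0 <= before n.
Proof. by rewrite subr_ge0 /gap ler_pdivrMr ?ltr0n// ler_peMr ?ler1n// ltW. Qed.

Lemma before_lt n : before n < t.
Proof. by rewrite ltrBlDr ltrDl gap_gt0. Qed.

Lemma gap_small (e : R) : 0 < e -> \forall n \near \oo, gap n < e.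
Proof.
move=> e0; have et : 0 < e / t by rewrite divr_gt0.
have [N _ HN] := inv_small et; exists N => // n /= Nn.
have [_] := HN n.+1 (leqW Nn); rewrite /gap ltr_pdivlMr// => H.
by rewrite mulrC.
Qed.

Lemma before_cvg : before n @[n --> \oo] --> t.
Proof.
apply/cvgrPdist_lt => e e0; apply: filterS (gap_small e0) => n.
by rewrite /before opprB subrKC ger0_norm// ltW// gap_gt0.
Qed.

Section increment.
Variable H : R -> Omega -> R.
Hypotheses (aH : adapted F H) (cH : continuous_paths P H).

(** The horizon exceeds [t], so that every time up to [t] lies in a cell of each left-point process;
    [tick_exists] asks for [s + 1 / n <= T]. *)
Let T := t + 1.
Let T0 : 0 < T. Proof. by rewrite addr_gt0. Qed.
Let tT : t <= T. Proof. by rewrite lerDl. Qed.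
Let S m := left_process FF T aH m.
Let c n : R := (Num.sqrt (gap n))^-1.

Let L n w := c n * (ito H t w - ito H (before n) w -
  H (before n) w * (W t w - W (before n) w)).

Let J n m w := c n * (1 * (simple_integral (S m) W t w - simple_integral (S m) W (before n) w)
  - H (before n) w * (W t w - W (before n) w)).

Let JL n : cip P (J n) (L n).
Proof.
have b0 := before_ge0 n; have bt := ltW (before_lt n).
have bT := le_trans bt tT.
have mito x : 0 <= x -> x <= T -> measurable_fun setT (ito H x).
  by move=> *; exact: (ito_integral_measurable complete_P FF FW T0 aH cH).
apply: (cipM complete_P).
- exact: measurable_cst.
- apply: measurable_funB; first by apply: measurable_funB; apply: mito => //; exact: ltW.
  apply: measurable_funM; first exact: (adapted_measurable FF aH).
  by apply: measurable_funB; apply: (fwiener_measurable FF FW) => //; exact: ltW.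
- exact: cip_cst.
- apply: cipB; last exact: cip_cst.
  have H1 := ito_integral_cip complete_P FF FW T0 aH cH (ltW t0) tT.
  have H2 := ito_integral_cip complete_P FF FW T0 aH cH b0 bT.
  by have := cipB H1 H2; apply: cip_ae_eq => [m|]; apply: aeW => w //; rewrite mul1r.
Qed.

Let f n m s w := c n * (1 * \1_(`]before n, t]) s * simple_val (S m) s w
  - H (before n) w * \1_(`]before n, t]) s).

Let fJ n m : step F W T (f n m) (J n m).
Proof.
have b0 := before_ge0 n; have bt := ltW (before_lt n).
apply: (stepZ FF); apply: (stepB FF).
  apply: (simple_step W FF _ (eta := cst 1)) => //.
  by apply/(preimagesP FF); exact: measurable_cst.
by apply: step_single => //; exact: aH.
Qed.

(** After division by [sqrt (gap n)], the squared integrand is an average over the interval from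
    [before n] to [t] of the squared distance between the left-point process and [H (before n)].
    Both tend to [H t] by continuity at [t]. *)
Lemma ito_increment :
  cip P (fun n w => (Num.sqrt (gap n))^-1 * (ito H t w - ito H (before n) w -
    H (before n) w * (W t w - W (before n) w))) (fun=> 0).
Proof.
have [m [nm JL0]] := cip_diag JL.
suff J0 : cip P (fun n => J n (m n)) (fun=> 0).
  have := cipB J0 JL0; apply: cip_ae_eq => [n|]; apply: aeW => w; last by rewrite subrr.
  by rewrite opprB subrKC.
apply: (step_ae_cip complete_P FF FW (ltW T0) (fun n => fJ n (m n))).
apply: filterS cH => w Hw.
have [M M0 HM] := cpath_bound T Hw.
apply/cvgrPdist_le => e e0.
(* The difference is split through [H t] into two parts of size at most [r / 2], so its square is at
   most [e]. Half of [del] is spent on the gap, half on the mesh. *)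
pose r := Num.sqrt e.
have r0 : 0 < r by rewrite sqrtr_gt0.
have r2 : 0 < r / 2 by rewrite divr_gt0.
have /cvgrPdist_le/(_ _ r2)[del /= del0 Hdel] := cpath_cvg Hw t0.
have del2 : 0 < del / 2 by rewrite divr_gt0.
have big : \forall n \near \oo, M <= n%:R.
  exists (Num.truncn M).+1 => // n /= Mn.
  by rewrite (le_trans (ltW (truncnS_gt M)))// ler_nat.
have mge (Q : nat -> Prop) : (\forall n \near \oo, Q n) -> \forall n \near \oo, Q (m n).
  by move=> [N _ QN]; exists N => // n Nn; apply: QN; exact: leq_trans (nm n).
apply: filterS3 (gap_small del2) (mge _ (inv_small del2)) (mge _ big) => n gn [m0 md] Mm.
rewrite sub0r normrN ger0_norm; last by apply: Rintegral_ge0 => s _; exact: sqr_ge0.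
have b0 := before_ge0 n; have bt := before_lt n; have g0 := gap_gt0 n.
have close x : `|t - x| < del -> `|H t w - H x w| <= r / 2 by exact: Hdel.
have main s : before n < s <= t -> `|simple_val (S (m n)) s w - H (before n) w| <= r.
  move=> /andP[bs st].
  have s0 : 0 < s by exact: le_lt_trans bs.
  have [|k kn ks] := tick_exists (T := T) m0 s0.
    rewrite lerD// (le_trans (y := (1%:R)^-1))// ?invr1//.
    by rewrite invf_le1 ?ler1n ?ltr0n.
  rewrite (left_process_val FF T aH) /lclip (lsum_at _ kn ks).
  have kT : `|H (k%:R / (m n)%:R) w| <= M.
    by apply: HM; rewrite tick_ge0 tick_le// ltnW.
  rewrite (clip_id (le_trans kT Mm)).
  have /andP[k1 k2] := ks; rewrite -natr1 mulrDl mul1r in k2.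
  have h1 : `|H t w - H (k%:R / (m n)%:R) w| <= r / 2.
    apply: close; rewrite /before in bs.
    by rewrite ger0_norm ?subr_ge0 ?(le_trans (ltW k1))//; lra.
  have h2 : `|H t w - H (before n) w| <= r / 2.
    by apply: close; rewrite /before opprB subrKC ger0_norm ?ltW//; lra.
  set x := H (_ / _) w in h1 *; rewrite (_ : x - _ = (H t w - H (before n) w) - (H t w - x)); last by ring.
  by rewrite (le_trans (ler_normB _ _))//; lra.
have c2 : c n ^+ 2 = (gap n)^-1 by rewrite /c exprVn sqr_sqrtr// ltW.
have bf : bounded_meas T (fun s => f n (m n) s w) by exact: step_bounded (fJ n (m n)).
apply: (@le_trans _ _ (\int[mu]_(s in `[0, T]) (e / gap n * \1_(`]before n, t]) s))).
  apply: le_Rintegral => //.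
  - exact: bounded_meas_integrable (bounded_measX2 bf).
  - apply: bounded_meas_integrable; apply: bounded_measM; first exact: bounded_meas_cst.
    exact: bounded_meas_indic.
  - move=> s _; pose D := simple_val (S (m n)) s w - H (before n) w.
    have -> : f n (m n) s w = c n * (\1_(`]before n, t]) s * D) by rewrite /f /D; ring.
    rewrite !exprMn c2 indic_oc.
    have [bs|_] := boolP (before n < s <= t); last by rewrite /= expr0n/= mul0r !mulr0.
    rewrite /= expr1n mul1r mulr1 mulrC ler_wpM2r ?invr_ge0 ?(ltW g0)//.
    rewrite -[leLHS]real_normK ?num_real//.
    have -> : e = r ^+ 2 by rewrite sqr_sqrtr// ltW.
    by rewrite ler_pXn2r ?nnegrE ?(ltW r0)//; exact: main.
rewrite (Rintegral_indic_itv _ b0 (ltW bt) tT) /before opprB subrKC.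
by rewrite divfK// gt_eqF.
Qed.

End increment.
End LocalIncrement.

(** * Ito processes *)

Section ItoProcess.
Context {R : realType} {d : measure_display} {Omega : measurableType d}.
Variable P : probability Omega R.
Hypothesis complete_P : measure_is_complete P.
Variables (F : R -> set (set Omega)) (W B : R -> Omega -> R).
Hypotheses (FF : filtration F) (FW : filtered_wiener P F W)
  (FB : filtered_wiener P F B).
Local Notation leb := (@lebesgue_measure R).

Definition regular (H : R -> Omega -> R) : Prop := adapted F H /\ continuous_paths P H.

Lemma regularM Y H : regular Y -> regular H -> regular (fun s w => Y s w * H s w).
Proof.
move=> [aY cY] [aH cH]; split; first exact: adaptedM.
exact: continuous_pathsM.
Qed.

Lemma regular_cst (c : R) : regular (fun _ _ => c).
Proof.
split; first by move=> t _; apply/(preimagesP FF); exact: measurable_cst.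
by apply: aeW => w; exact: cpath_cst.
Qed.

Lemma regularD Y H : regular Y -> regular H -> regular (fun s w => Y s w + H s w).
Proof.
move=> [aY cY] [aH cH]; split; last by apply: filterS2 cY cH => w; exact: cpathD.
move=> t t0; apply/(preimagesP FF).
by apply: measurable_funD; apply/(preimagesP FF); [exact: aY|exact: aH].
Qed.

Lemma regular_sqrt Y : regular Y -> regular (fun s w => Num.sqrt (Y s w)).
Proof.
move=> [aY cY]; split; last by apply: filterS cY => w; exact: cpath_sqrt.
move=> t t0; apply/(preimagesP FF).
apply: (@measurableT_comp _ _ _ _ _ _ (@Num.sqrt R)).
  by apply: continuous_measurable_fun; exact: sqrt_continuous.
by apply/(preimagesP FF); exact: aY.
Qed.

Lemma regular_measurable H (t : R) : regular H -> 0 <= t -> measurable_fun setT (H t).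
Proof. by move=> [aH _]; exact: (adapted_measurable FF). Qed.

(** Left-point sums against [ds] are measurable and converge along almost every path; the factor 1
    puts the integral in the form of [drift_riemann_sum]. *)
Lemma path_integral_measurable H (t : R) : regular H -> 0 <= t ->
  measurable_fun setT (fun w => \int[leb]_(s in `[0, t]) H s w).
Proof.
move=> rH; rewrite le_eqVlt => /predU1P[<-|t0].
  by under eq_fun do rewrite set_itv1 Rintegral_set1; exact: measurable_cst.
have H1 := drift_riemann_sum t0 rH.2 (regular_cst 1).2.
have -> : (fun w => \int[leb]_(s in `[0, t]) H s w) =
    (fun w => \int[leb]_(s in `[0, t]) (H s w * 1)).
  by apply/funext => w; apply: eq_Rintegral => s _; rewrite mulr1.
 apply: (ae_lim_measurable complete_P) H1 => n.
apply: measurable_sum => k; apply: measurable_funM; last exact: measurable_cst.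
by apply: regular_measurable rH _; exact: tick_ge0.
Qed.

Lemma regular_ito_measurable V H (t : R) : filtered_wiener P F V -> regular H -> 0 <= t ->
  measurable_fun setT (ito_integral P F V H t).
Proof.
move=> FV [aH cH] t0.
have T0 : 0 < t + 1 by rewrite ltr_wpDl.
by apply: (ito_integral_measurable complete_P FF FV T0 aH cH) => //; rewrite lerDl.
Qed.

Lemma ito_diff_measurable mu phi psi (t : R) : regular mu -> regular phi -> regular psi ->
  0 <= t -> measurable_fun setT (ito_diff P F W B mu phi psi t).
Proof.
move=> rmu rphi rpsi t0; apply: measurable_funD; first apply: measurable_funD.
- exact: path_integral_measurable.
- exact: regular_ito_measurable.
- exact: regular_ito_measurable.
Qed.

Variables (Z mu phi psi : R -> Omega -> R).
Hypotheses (rmu : regular mu) (rphi : regular phi) (rpsi : regular psi)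
  (ZE : forall t, 0 <= t -> {ae P, forall w,
    Z t w = Z 0 w + ito_diff P F W B mu phi psi t w}).

Lemma ito_process_riemann_sum Y (T : R) : regular Y -> 0 < T ->
  cip P (fun n w => \sum_(k < Num.truncn (n%:R * T)) Y (k%:R / n%:R) w *
      (Z (k.+1%:R / n%:R) w - Z (k%:R / n%:R) w))
    (ito_diff_integral P F W B Y mu phi psi T).
Proof.
move=> rY T0.
have c1 := ito_riemann_sum complete_P FF FW T0 rY.1 rY.2 rphi.1 rphi.2.
have c2 := ito_riemann_sum complete_P FF FB T0 rY.1 rY.2 rpsi.1 rpsi.2.
have c0 : cip P (fun n w => \sum_(k < Num.truncn (n%:R * T)) Y (k%:R / n%:R) w *
    (\int[leb]_(s in `[0, k.+1%:R / n%:R]) mu s w - \int[leb]_(s in `[0, k%:R / n%:R]) mu s w))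
    (fun w => \int[leb]_(s in `[0, T]) (Y s w * mu s w)).
  apply: (ae_cip complete_P); last exact: (drift_riemann_sum T0 rY.2 rmu.2).
  move=> n; apply: measurable_sum => k; apply: measurable_funM.
    by apply: regular_measurable rY _; exact: tick_ge0.
  by apply: measurable_funB; apply: path_integral_measurable rmu _; exact: tick_ge0.
have := cipD (cipD c0 c1) c2; apply: cip_ae_eq => [n|]; last exact: aeW.
(* The equation for [Z] holds at each time off a null set of its own; only the countably many ticks
   are used here. *)
have ZE' k : {ae P, forall w, Z (k%:R / n%:R) w =
    Z 0 w + ito_diff P F W B mu phi psi (k%:R / n%:R) w} by apply: ZE; exact: tick_ge0.
have := ae_foralln ZE'; apply: filterS => w Zw.
rewrite -!big_split/=; apply: eq_bigr => k _; rewrite (Zw k) (Zw k.+1) /ito_diff; ring.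
Qed.

Hypothesis psi0 : forall s w, psi s w = 0.

(** The drift contributes at most a multiple of [gap], which is [o(sqrt gap)]. The [B] integral goes
    through [ito_increment] as well, with leading term 0 because [psi] vanishes. *)
Lemma ito_process_increment (t : R) : 0 < t ->
  cip P (fun n w => (Num.sqrt (gap t n))^-1 * (Z t w - Z (before t n) w -
    phi (before t n) w * (W t w - W (before t n) w))) (fun=> 0).
Proof.
move=> t0.
have c1 := ito_increment complete_P FF FW t0 rphi.1 rphi.2.
have c2 := ito_increment complete_P FF FB t0 rpsi.1 rpsi.2.
have b0 n := before_ge0 t0 n; have bt n := before_lt t0 n.
have c0 : cip P (fun n w => (Num.sqrt (gap t n))^-1 *
    (\int[leb]_(s in `[0, t]) mu s w - \int[leb]_(s in `[0, before t n]) mu s w)) (fun=> 0).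
  apply: (ae_cip complete_P).
    move=> n; apply: measurable_funM; first exact: measurable_cst.
    by apply: measurable_funB; apply: path_integral_measurable => //; exact: ltW.
  apply: filterS rmu.2 => w mw.
  have [M M0 muM] := cpath_bound t mw.
  have bmu := cpath_bounded_meas t mw.
  apply/cvgrPdist_le => e e0.
  have eM : 0 < (e / (M + 1)) ^+ 2 by rewrite exprn_gt0// divr_gt0// ltr_wpDl.
  apply: filterS (gap_small t0 eM) => n gn.
  have g0 := gap_gt0 t0 n; have sg0 : 0 < Num.sqrt (gap t n) by rewrite sqrtr_gt0.
  rewrite sub0r normrN normrM normfV (gtr0_norm sg0) ler_pdivrMl//.
  have := Rintegral_incr_bound bmu (b0 n) (ltW (bt n)) (lexx t) muM.
  move=> /le_trans; apply; rewrite {1}/before opprB subrKC.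
  have gq : gap t n = Num.sqrt (gap t n) * Num.sqrt (gap t n) by rewrite -expr2 sqr_sqrtr// ltW.
  rewrite [X in _ * X <= _]gq mulrCA ler_pM2l// mulrC.
  have sge : Num.sqrt (gap t n) <= e / (M + 1).
    rewrite -[leRHS]gtr0_norm; last by rewrite divr_gt0// ltr_wpDl.
    by rewrite -sqrtr_sqr ler_sqrt ?ltW.
  apply: (@le_trans _ _ (e / (M + 1) * (M + 1))).
    by apply: ler_pM => //; rewrite lerDl.
  by rewrite divfK// gt_eqF// ltr_wpDl.
have := cipD (cipD c0 c1) c2; apply: cip_ae_eq => [n|]; last by apply: aeW => w; rewrite !addr0.
apply: filterS2 (ZE (ltW t0)) (ZE (b0 n)) => w -> ->.
by rewrite /ito_diff psi0; ring.
Qed.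

(* Over [[t - h, t]] the process is [phi] times a Gaussian variable independent of
   the past, up to [o(sqrt h)], and a Gaussian variable has no atom. *)
Lemma ito_process_no_return (t : R) : regular Z -> 0 < t ->
  {ae P, forall w, phi t w != 0 -> Z t w != Z 0 w}.
Proof.
move=> rZ t0.
have b0 n := before_ge0 t0 n; have bt n := before_lt t0 n.
have small (kap : R) : 0 < kap ->
    P.-negligible [set w | Z t w = Z 0 w /\ 2 * kap <= `|phi t w|].
  move=> kap0; apply: outer_le0 => r r0.
  (* The small ball of radius [rho * sqrt gap] then has probability at most [2 * rho = r / 3]; three
     events share [r]. *)
  pose rho := r / 6; have rho0 : 0 < rho by rewrite divr_gt0.
  have r3 : 0 < r / 3 by rewrite divr_gt0.
  have phic : cip P (fun n w => phi (before t n) w) (phi t).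
    apply: (ae_cip complete_P) => [n|]; first exact: regular_measurable.
    apply: filterS rphi.2 => w cw.
    exact: (cvg_comp _ _ (before_cvg t0) (cpath_cvg cw t0)).
  have rk : 0 < rho * kap by rewrite mulr_gt0.
  have [N _ HN] := filterI (ito_process_increment t0 rk r3) (phic _ _ kap0 r3).
  have [A1 A2] := HN N (leqnn N).
  pose D w := W t w - W (before t N) w.
  (* If [Z t = Z 0], the expansion forces the increment of [W] to be close to [Q], which is known at
     time [before t N]. Where [phi] vanishes [Q] is 0; the bound is applied only where [|phi| > kap]
     at that time. *)
  pose Q w := (Z 0 w - Z (before t N) w) / phi (before t N) w.
  have g0 := gap_gt0 t0 N; have sg0 : 0 < Num.sqrt (gap t N) by rewrite sqrtr_gt0.
  have mQ : preimages Q `<=` F (before t N).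
    apply/(preimagesP FF); apply: measurable_funM.
      apply: measurable_funB; apply/(preimagesP FF).
        by apply: (preimagesS FF (lexx 0) (b0 N)); exact: rZ.1.
      exact: rZ.1.
    apply: (@measurableT_comp _ _ _ _ _ _ (fun x : R => x^-1)).
      exact: measurable_inv.
    by apply/(preimagesP FF); exact: rphi.1.
  have A3 : outer_le P [set w | `|D w - Q w| <= rho * Num.sqrt (gap t N)] (r / 3).
    have mD : measurable_fun setT D.
      by apply: measurable_funB; apply: (fwiener_measurable FF FW) => //; exact: ltW.
    have mQ' : measurable_fun setT Q.
      by apply: (filtration_measurable_fun FF (b0 N)); exact/(preimagesP FF).
    have := small_ball_incr FF FW (b0 N) (bt N) (ltW (mulr_gt0 rho0 sg0)) mQ.
    have -> : t - before t N = gap t N by rewrite /before opprB subrKC.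
    have -> : 2 * (rho * Num.sqrt (gap t N)) / Num.sqrt (gap t N) = r / 3.
      by rewrite /rho; field; rewrite gt_eqF.
    move=> HP; apply: outer_le_meas HP.
    have mDQ : measurable_fun setT (fun w => `|D w - Q w|).
      apply: (@measurableT_comp _ _ _ _ _ _ (fun x : R => `|x|)) => //.
      exact: measurable_funB.
    rewrite (_ : [set w | _] = (fun w => `|D w - Q w|) @^-1` `]-oo, rho * Num.sqrt (gap t N)]).
      by rewrite -[X in measurable X]setTI; exact: mDQ.
    by apply/seteqP; split => w; rewrite /= in_itv.
  apply: outer_leS (outer_leU (outer_leU A1 A2) A3) => [w /= [ZZ phik]|]; last lra.
  have [?|R1] := leP (rho * kap) `|(Num.sqrt (gap t N))^-1 * (Z t w - Z (before t N) w -
    phi (before t N) w * (W t w - W (before t N) w)) - 0|; [by left; left|].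
  have [?|R2] := leP kap `|phi (before t N) w - phi t w|; [by left; right|right].
  have pk : kap < `|phi (before t N) w|.
    have := ler_normD (phi (before t N) w) (phi t w - phi (before t N) w).
    by rewrite subrKC (distrC (phi t w)); lra.
  have pn : phi (before t N) w != 0 by rewrite -normr_gt0 (lt_trans kap0).
  move: R1; rewrite subr0 normrM normfV (gtr0_norm sg0) ltr_pdivrMl// => R1.
  have -> : D w - Q w = - (Z t w - Z (before t N) w - phi (before t N) w * (W t w - W (before t N) w))
      / phi (before t N) w by rewrite /D /Q ZZ; field.
  rewrite normrM normrN normfV ler_pdivrMr ?(lt_trans kap0)//.
  rewrite (le_trans (ltW R1))// mulrA (mulrC _ rho) ler_wpM2l//; last exact: ltW.
  by rewrite mulr_ge0// ltW.
have k0 (j : nat) : (0 : R) < j.+1%:R^-1 by [].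
(* The levels [kap = 1 / (j + 1)] exhaust the event [phi t != 0]. *)
have := negligible_bigcup (fun j => small _ (k0 j)).
apply: negligibleS => w /= /not_implyP[p0 /negP]; rewrite negbK => /eqP ZZ.
have p2 : 0 < `|phi t w| / 2 by rewrite divr_gt0 ?normr_gt0.
have [N _ /(_ N.+1 (leqnSn _))[_ HN]] := inv_small p2.
by exists N => //=; split => //; move: HN; rewrite ltr_pdivlMr// mulrC => /ltW.
Qed.

End ItoProcess.

(** * Least squares *)

Section LeastSquaresAlgebra.
Context {R : realType}.
Implicit Types (y z : nat -> R) (N : nat) (c a b : R).

Lemma residual_expand N y z c a b :
  \sum_(k < N) (z k - c * (a - b * y k)) ^+ 2 =
  \sum_(k < N) z k ^+ 2 - 2 * c * (a * (\sum_(k < N) z k) - b * (\sum_(k < N) y k * z k))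
  + c ^+ 2 * (a ^+ 2 * N%:R - 2 * a * b * (\sum_(k < N) y k) + b ^+ 2 * (\sum_(k < N) y k ^+ 2)).
Proof.
elim: N => [|N IH]; first by rewrite !big_ord0; ring.
by rewrite !big_ord_recr/= IH -natr1; ring.
Qed.

(** The two hypotheses are the normal equations: they cancel the first-order terms and leave the
    Gram form of the deviation. *)
Lemma residual_min N y z c a b a' b' :
  \sum_(k < N) z k = c * (N%:R * a - (\sum_(k < N) y k) * b) ->
  \sum_(k < N) y k * z k = c * ((\sum_(k < N) y k) * a - (\sum_(k < N) y k ^+ 2) * b) ->
  \sum_(k < N) (z k - c * (a' - b' * y k)) ^+ 2 =
  \sum_(k < N) (z k - c * (a - b * y k)) ^+ 2
  + c ^+ 2 * ((a' - a) ^+ 2 * N%:R - 2 * (a' - a) * (b' - b) * (\sum_(k < N) y k)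
     + (b' - b) ^+ 2 * (\sum_(k < N) y k ^+ 2)).
Proof. by move=> hU hV; rewrite !residual_expand hU hV; ring. Qed.

(* Completing the square in the Gram form of the regressors [1] and [y]. *)
Lemma gram_ge0 (n s1 s2 p q : R) : 0 < n -> s1 ^+ 2 < n * s2 ->
  0 <= p ^+ 2 * n - 2 * p * q * s1 + q ^+ 2 * s2 ?= iff ((p == 0) && (q == 0)).
Proof.
move=> n0 det0; set G := _ + _.
have nG : n * G = (n * p - q * s1) ^+ 2 + q ^+ 2 * (n * s2 - s1 ^+ 2) by rewrite /G; ring.
have d0 : 0 < n * s2 - s1 ^+ 2 by rewrite subr_gt0.
have G0 : 0 <= G by rewrite -(pmulr_rge0 _ n0) nG addr_ge0 ?sqr_ge0// mulr_ge0 ?sqr_ge0// ltW.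
apply/leifP; have [/andP[/eqP p0 /eqP q0]|pq] := ifPn; first by apply/eqP; rewrite /G p0 q0; ring.
rewrite lt_def G0 andbT; apply: contra pq => /eqP GE.
move: nG; rewrite GE mulr0 => /esym/eqP; rewrite paddr_eq0 ?sqr_ge0//; last first.
  by rewrite mulr_ge0 ?sqr_ge0// ltW.
rewrite sqrf_eq0 [X in _ && X]mulf_eq0 sqrf_eq0 (gt_eqF d0) orbF => /andP[+ /eqP q0].
by rewrite q0 mul0r subr0 mulf_eq0 (gt_eqF n0)/= eqxx andbT.
Qed.

(** The determinant is [N] times the sum of squared deviations from the mean [m], which vanishes
    only if all [y k] coincide. *)
Lemma gram_det_gt0 N y : (2 <= N)%N -> y 0%N != y 1%N ->
  (\sum_(k < N) y k) ^+ 2 < N%:R * (\sum_(k < N) y k ^+ 2).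
Proof.
case: N => [|[|N]]// _ y01; set M := N.+2; set s1 := \sum_(k < M) y k.
have M0 : 0 < M%:R :> R by rewrite ltr0n.
pose m := s1 / M%:R.
have vE : M%:R * (\sum_(k < M) y k ^+ 2) - s1 ^+ 2 = M%:R * \sum_(k < M) (y k - m) ^+ 2.
  have -> : \sum_(k < M) (y k - m) ^+ 2 = \sum_(k < M) y k ^+ 2 - 2 * m * s1 + m ^+ 2 * M%:R.
    have := residual_expand M y y 1 m 0; rewrite -/s1.
    under eq_bigr do rewrite mul0r subr0 mul1r.
    by move=> ->; ring.
  by rewrite /m; field; rewrite gt_eqF.
rewrite -subr_gt0 vE mulr_gt0// lt_def sumr_ge0 ?andbT => [|k _]; last exact: sqr_ge0.
apply: contra y01 => /eqP/psumr_eq0P H.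
have e k : (k < M)%N -> y k = m.
  move=> kM; apply/eqP; rewrite -subr_eq0 -sqrf_eq0; apply/eqP.
  by apply: (H _ (Ordinal kM)) => // i _; exact: sqr_ge0.
by rewrite !e.
Qed.

Lemma inv_lse_matrix (t p q : R) (u v : R) : t * q - p ^+ 2 != 0 ->
  mx22 t (- p) (- p) q \in unitmx /\
  invmx (mx22 t (- p) (- p) q) *m col2 u (- v) =
    (t * q - p ^+ 2)^-1 *: col2 (u * q - p * v) (u * p - t * v).
Proof.
set M := mx22 _ _ _ _; set D := _ - _ => D0.
have MN : M *m (D^-1 *: mx22 q p p t) = 1%:M.
  apply/matrixP => i j; rewrite !mxE !big_ord_recr big_ord0 /= !mxE.
  case: i => [[|[|//]]] ?; case: j => [[|[|//]]] ? /=;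
  by rewrite /= ?add0r; move: D0; rewrite /D => D0; field.
have [uM _] := mulmx1_unit MN; split => //.
have -> : invmx M = D^-1 *: mx22 q p p t.
  by rewrite -[RHS](mulKmx uM) MN mulmx1.
rewrite -scalemxAl; congr (_ *: _); apply/matrixP => i j.
rewrite !mxE !big_ord_recr big_ord0 /= !mxE.
by case: i => [[|[|//]]] ?; rewrite /=; ring.
Qed.

End LeastSquaresAlgebra.

(** * The discrete estimator in closed form *)

Section DiscreteEstimator.
Context {R : realType} {Omega : Type}.
Variables (Y X : R -> Omega -> R) (T : R).
Local Notation nbr n := (Num.truncn (n%:R * T)).

Definition left_riemann (H : R -> Omega -> R) n w : R :=
  \sum_(k < nbr n) H (k%:R / n%:R) w * n%:R^-1.

Definition left_ito (H Z : R -> Omega -> R) n w : R :=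
  \sum_(k < nbr n) H (k%:R / n%:R) w * (Z (k.+1%:R / n%:R) w - Z (k%:R / n%:R) w).

(** The determinant of the matrix [G_n] divided by [n ^ 2]. With this scaling each factor in the
    closed form of the estimator has a limit of its own. *)
Definition discrete_det n w : R :=
  left_riemann (fun _ _ => 1) n w * left_riemann (fun s w => Y s w * Y s w) n w
  - left_riemann Y n w ^+ 2.

Definition discrete_intercept Z n w : R :=
  (left_riemann (fun s w => Y s w * Y s w) n w * left_ito (fun _ _ => 1) Z n w
   - left_riemann Y n w * left_ito Y Z n w) * (discrete_det n w)^-1.

Definition discrete_slope Z n w : R :=
  (left_riemann Y n w * left_ito (fun _ _ => 1) Z n w
   - left_riemann (fun _ _ => 1) n w * left_ito Y Z n w) * (discrete_det n w)^-1.

(** The contrast is a sum of two regressions, of [Y] and of [X], with the same Gram matrix. The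
    closed forms solve the normal equations, so the excess of the contrast over its value there is a
    positive multiple of two Gram forms; distinct first two observations make both definite, hence
    the minimizer unique. *)
Lemma lse_discreteE n w : (2 <= nbr n)%N -> Y (0%:R / n%:R) w != Y (1%:R / n%:R) w ->
  lse_discrete Y X T n w = (discrete_intercept Y n w, discrete_slope Y n w,
                            discrete_intercept X n w, discrete_slope X n w).
Proof.
move=> N2 y01.
have n0 : n%:R != 0 :> R.
  by rewrite pnatr_eq0 -lt0n; apply: (@nbr_gt0 R T n 0); exact: leq_trans N2.
pose c : R := n%:R^-1; have c0 : c != 0 by rewrite invr_eq0.
pose y k := Y (k%:R / n%:R) w.
set N := nbr n in N2 *.
pose s1 := \sum_(k < N) y k; pose s2 := \sum_(k < N) y k ^+ 2.
have Nr0 : 0 < N%:R :> R by rewrite ltr0n (leq_trans _ N2).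
have det0 : s1 ^+ 2 < N%:R * s2 by exact: gram_det_gt0.
have dn0 : N%:R * s2 - s1 ^+ 2 != 0 by rewrite gt_eqF// subr_gt0.
have r1 : left_riemann Y n w = s1 * c by rewrite /left_riemann -mulr_suml.
have r0 : left_riemann (fun _ _ => 1) n w = N%:R * c.
  by rewrite /left_riemann -mulr_suml sumr_const card_ord.
have r2 : left_riemann (fun s w => Y s w * Y s w) n w = s2 * c.
  by rewrite /left_riemann -mulr_suml; congr (_ * _); apply: eq_bigr => k _; rewrite expr2.
have detE : discrete_det n w = c ^+ 2 * (N%:R * s2 - s1 ^+ 2).
  by rewrite /discrete_det r0 r1 r2; ring.
pose dz (Z : R -> Omega -> R) (k : nat) := Z (k.+1%:R / n%:R) w - Z (k%:R / n%:R) w.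
have normal_eqs Z : \sum_(k < N) dz Z k = c * (N%:R * discrete_intercept Z n w - s1 * discrete_slope Z n w) /\
    \sum_(k < N) y k * dz Z k = c * (s1 * discrete_intercept Z n w - s2 * discrete_slope Z n w).
  rewrite /discrete_intercept /discrete_slope detE r0 r1 r2.
  have -> : left_ito (fun _ _ => 1) Z n w = \sum_(k < N) dz Z k.
    by apply: eq_bigr => k _; rewrite mul1r.
  have -> : left_ito Y Z n w = \sum_(k < N) y k * dz Z k by [].
  by split; field; rewrite dn0 c0.
have contrastE th : lse_contrast Y X T n w th =
    \sum_(k < N) (dz Y k - c * (th.1.1.1 - th.1.1.2 * y k)) ^+ 2
    + \sum_(k < N) (dz X k - c * (th.1.2 - th.2 * y k)) ^+ 2.
  case: th => [[[a b] al] be]; rewrite /lse_contrast -/N big_add1/= big_mkord -big_split/=.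
  by apply: eq_bigr => k _.
set th0 := (_, _, _, _).
have diff th : lse_contrast Y X T n w th = lse_contrast Y X T n w th0 + c ^+ 2 *
    (((th.1.1.1 - th0.1.1.1) ^+ 2 * N%:R - 2 * (th.1.1.1 - th0.1.1.1) * (th.1.1.2 - th0.1.1.2) * s1
      + (th.1.1.2 - th0.1.1.2) ^+ 2 * s2) +
     ((th.1.2 - th0.1.2) ^+ 2 * N%:R - 2 * (th.1.2 - th0.1.2) * (th.2 - th0.2) * s1
      + (th.2 - th0.2) ^+ 2 * s2)).
  have [u1 v1] := normal_eqs Y; have [u2 v2] := normal_eqs X.
  rewrite !contrastE (residual_min th.1.1.1 th.1.1.2 u1 v1) (residual_min th.1.2 th.2 u2 v2).
  by rewrite /th0 /= -/s1 -/s2; ring.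
have c20 : 0 < c ^+ 2 by rewrite lt_def sqrf_eq0 c0 sqr_ge0.
apply: xget_unique => [th|th /(_ th0)].
  rewrite (diff th) lerDl mulr_ge0 ?(ltW c20)//.
  by apply: addr_ge0; apply: (gram_ge0 _ _ Nr0 det0).
rewrite (diff th) gerDl pmulr_rle0// => H.
have G1 := gram_ge0 (th.1.1.1 - th0.1.1.1) (th.1.1.2 - th0.1.1.2) Nr0 det0.
have G2 := gram_ge0 (th.1.2 - th0.1.2) (th.2 - th0.2) Nr0 det0.
move: H; rewrite -oppr_ge0.
set g1 := _ + _ in G1 *; set g2 := _ + _ in G2 *.
move=> H; have [e1 e2] : g1 == 0 /\ g2 == 0.
  have g10 : 0 <= g1 := G1.1; have g20 : 0 <= g2 := G2.1.
  by split; rewrite eq_le; apply/andP; split => //; lra.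
move: e1 e2; rewrite eq_sym G1.2 !subr_eq0 => /andP[/eqP h1 /eqP h2].
rewrite eq_sym G2.2 !subr_eq0 => /andP[/eqP h3 /eqP h4].
by case: th h1 h2 h3 h4 {diff H g1 g2 G1 G2} => [[[a b] al] be]/= -> -> -> ->.
Qed.

End DiscreteEstimator.

(** * The continuous determinant and the limits of the coordinates *)

Section Final.
Context {R : realType}.
Local Notation leb := (@lebesgue_measure R).

(** By continuity [|h - m|] stays above half its value at [s] on a short interval ending at [s]. *)
Lemma Rintegral_sq_dist_gt0 (T m s : R) (h : R -> R) : cpath h -> 0 < s < T -> h s != m ->
  0 < \int[leb]_(x in `[0, T]) (h x - m) ^+ 2.
Proof.
move=> hc /andP[s0 sT] hm.
pose e := `|h s - m| / 2.
have e0 : 0 < e by rewrite divr_gt0// normr_gt0 subr_eq0.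
have /cvgrPdist_lt/(_ _ e0)[del /= del0 Hdel] := cpath_cvg hc s0.
pose eta := Num.min (del / 2) s.
have eta0 : 0 < eta by rewrite lt_min s0 divr_gt0.
have es : eta <= s by rewrite ge_min lexx orbT.
have ed : eta < del.
  by rewrite gt_min ltr_pdivrMr// ltr_pMr// ltr1n.
have a0 : 0 <= s - eta by rewrite subr_ge0.
have as_ : s - eta <= s by rewrite gerBl ltW.
apply: (@lt_le_trans _ _ (e ^+ 2 * eta)); first by rewrite mulr_gt0// exprn_gt0.
have -> : e ^+ 2 * eta = \int[leb]_(x in `[0, T]) (e ^+ 2 * \1_(`]s - eta, s]) x).
  by rewrite (Rintegral_indic_itv _ a0 as_ (ltW sT)); congr (_ * _); ring.
apply: le_Rintegral => //.
- apply: bounded_meas_integrable; apply: bounded_measM; first exact: bounded_meas_cst.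
  exact: bounded_meas_indic.
- apply: bounded_meas_integrable; apply: bounded_measX2; apply: bounded_measB.
    exact: cpath_bounded_meas.
  exact: bounded_meas_cst.
- move=> x _; rewrite indic_oc.
  have [/andP[sx xs]|_] := boolP (s - eta < x <= s); last by rewrite mulr0 sqr_ge0.
  rewrite mulr1 -[leRHS]real_normK ?num_real// ler_pXn2r ?nnegrE ?(ltW e0)//.
  have : `|h s - h x| < e by apply: Hdel; rewrite /= ger0_norm ?subr_ge0//; lra.
  have := ler_normD (h s - h x) (h x - m); rewrite addrA subrK /e; lra.
Qed.

(** If [h] were equal to [m] on the open interval, right continuity at 0 would give
    [h 0 = m = h t]. *)
Lemma nonconstant_interior (T t m : R) (h : R -> R) : cpath h -> 0 < t < T -> h t != h 0 ->
  exists2 s, 0 < s < T & h s != m.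
Proof.
move=> hc tT ht; apply: contrapT => H.
have E s : 0 < s < T -> h s = m.
  by move=> sT; apply/eqP/negP => /negP hs; apply: H; exists s.
have /andP[t0 tT'] := tT.
have /continuous_within_itvcyP[_ h0] := hc.
have hm : h x @[x --> 0^'+] --> m.
  apply: cvg_near_cst.
  have T0 : 0 < T by exact: lt_trans tT'.
  near=> x; apply: (E x); apply/andP; split; first by near: x; exact: nbhs_right_gt.
  by near: x; exact: nbhs_right_lt.
have := cvg_unique _ hm h0 => /(_ (@Rhausdorff R)) h0m.
by move/eqP: ht; apply; rewrite E// h0m.
Unshelve. all: by end_near. Qed.

(** The continuous counterpart of [gram_det_gt0]: the difference of the two sides is [T] times the
    integral of the squared deviation from the mean [m]. *)
Lemma path_variance_gt0 (T t : R) (h : R -> R) : cpath h -> 0 < t < T -> h t != h 0 ->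
  (\int[leb]_(s in `[0, T]) h s) ^+ 2 < T * \int[leb]_(s in `[0, T]) (h s ^+ 2).
Proof.
move=> hc tT ht; have /andP[t0 tT'] := tT; have T0 : 0 < T by exact: lt_trans tT'.
set I1 := \int[leb]_(s in _) h s; set I2 := \int[leb]_(s in _) (h s ^+ 2).
pose m := I1 / T.
have [s sT hs] := nonconstant_interior m hc tT ht.
have := Rintegral_sq_dist_gt0 hc sT hs.
have bh := cpath_bounded_meas T hc.
have bl1 : bounded_meas T (fun s => (- (2 * m)) * h s).
  by apply: bounded_measM => //; exact: bounded_meas_cst.
have bl : bounded_meas T (fun s => (- (2 * m)) * h s + m ^+ 2).
  exact: bounded_measD bl1 (bounded_meas_cst _ _).
have -> : \int[leb]_(x in `[0, T]) (h x - m) ^+ 2 = I2 + (- (2 * m)) * I1 + m ^+ 2 * T.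
  transitivity (\int[leb]_(x in `[0, T]) (h x ^+ 2 + ((- (2 * m)) * h x + m ^+ 2))).
    by apply: eq_Rintegral => x _; ring.
  rewrite (RintegralD _ (bounded_meas_integrable (bounded_measX2 bh)) (bounded_meas_integrable bl))//.
  rewrite (RintegralD _ (bounded_meas_integrable bl1) (bounded_meas_integrable (bounded_meas_cst T (m ^+ 2))))//.
  rewrite (RintegralZl _ _ (bounded_meas_integrable bh))//.
  rewrite Rintegral_cst// /= lebesgue_measure_itv/= lte_fin T0/= subr0 /I1 /I2; ring.
move=> H; have H2 := mulr_gt0 T0 H.
have E : T * (I2 + - (2 * m) * I1 + m ^+ 2 * T) = T * I2 - I1 ^+ 2.
  by rewrite /m; field; rewrite gt_eqF.
by rewrite -subr_gt0 -E.
Qed.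

Context {d : measure_display} {Omega : measurableType d}.
Variable P : probability Omega R.
Hypothesis complete_P : measure_is_complete P.

Lemma ae_measurable_set (A B : set Omega) : measurable B ->
  {ae P, forall w, A w <-> B w} -> measurable A.
Proof.
move=> mB AB; pose N := ~` [set w | A w <-> B w].
have mN : measurable N by exact: complete_P.
have mI : measurable (A `&` N).
  by apply: complete_P; apply: negligibleS AB; exact: subIsetr.
have -> : A = (B `\` N) `|` (A `&` N).
  apply/seteqP; split => w /=.
    move=> Aw; have [Nw|nN] := pselect (N w); [by right|left; split => //].
    by move/contrapT : nN => [+ _]; apply.
  by move=> [[Bw /contrapT[_]]|[]//]; apply.
by apply: measurableU => //; exact: measurableD.
Qed.

(** Completeness supplies the measurability of [A], without which the value [P A] would carry no
    information. *)
Lemma ae_prob1 (A : set Omega) : {ae P, forall w, A w} -> P A = 1%E.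
Proof.
move=> aA; have mA : measurable A.
  by apply: (@ae_measurable_set _ setT) => //; apply: filterS aA.
have A0 : P (~` A) = 0%E by apply/negligibleP => //; exact: measurableC.
have : P (~` A) = (1 - P A)%E by exact: probability_setC.
have fA : P A \is a fin_num by exact: fin_num_measure.
by rewrite A0 -(fineK fA) -EFinB => -[E]; congr (_%:E); lra.
Qed.

Variables (F : R -> set (set Omega)) (W B : R -> Omega -> R).
Hypotheses (FF : filtration F) (FW : filtered_wiener P F W) (FB : filtered_wiener P F B).
Variable T : R.
Hypothesis T0 : 0 < T.

Lemma left_riemann_measurable H n : regular P F H -> measurable_fun setT (left_riemann T H n).
Proof.
move=> rH; apply: measurable_sum => k; apply: measurable_funM; last exact: measurable_cst.
by apply: (regular_measurable FF rH); exact: tick_ge0.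
Qed.

Lemma left_riemann_cip H : regular P F H ->
  cip P (left_riemann T H) (fun w => \int[leb]_(s in `[0, T]) H s w).
Proof.
move=> rH; apply: (ae_cip complete_P) => [n|]; first exact: left_riemann_measurable.
have := drift_riemann_sum T0 rH.2 (regular_cst P FF 1).2; apply: filterS => w.
under [X in _ --> X -> _]eq_Rintegral do rewrite mulr1.
apply: cvg_trans; apply: near_eq_cvg; apply: nearW => n.
apply: eq_bigr => k _; congr (_ * _).
have I1 (x : R) : 0 <= x -> \int[leb]_(s in `[0, x]) 1 = x.
  move=> x0; rewrite Rintegral_cst// /= lebesgue_measure_itv/= lte_fin mul1r.
  by case: ltP => [|x0']/=; rewrite ?subr0//; apply/eqP; rewrite eq_le x0 x0'.
by rewrite !I1 ?tick_ge0// -natr1 mulrDl mul1r addrC addKr.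
Qed.

Section pair.
Variables (Y Z : R -> Omega -> R) (IYZ : Omega -> R).
Hypotheses (rY : regular P F Y)
  (mZ : measurable_fun setT (fun w => Z T w - Z 0 w)) (mI : measurable_fun setT IYZ)
  (cU : cip P (left_ito T (fun _ _ => 1) Z) (fun w => Z T w - Z 0 w))
  (cV : cip P (left_ito T Y Z) IYZ)
  (det0 : {ae P, forall w, T * int_Y2 Y T w - int_Y Y T w ^+ 2 != 0}).

Let mI1 : measurable_fun setT (int_Y Y T).
Proof. exact: (path_integral_measurable complete_P FF rY (ltW T0)). Qed.

Let mI2 : measurable_fun setT (int_Y2 Y T).
Proof. exact: (path_integral_measurable complete_P FF (regularM FF rY rY) (ltW T0)). Qed.

Let c0 : cip P (left_riemann T (fun _ _ => 1 : R)) (fun=> T).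
Proof.
have := left_riemann_cip (regular_cst P FF 1); apply: cip_ae_eq => [n|]; first exact: aeW.
by apply: aeW => w; rewrite Rintegral_cst//= lebesgue_measure_itv/= lte_fin T0/= subr0 mul1r.
Qed.

Let c1 : cip P (left_riemann T Y) (int_Y Y T). Proof. exact: left_riemann_cip. Qed.

Let c2 : cip P (left_riemann T (fun s w => Y s w * Y s w)) (int_Y2 Y T).
Proof. exact: (left_riemann_cip (regularM FF rY rY)). Qed.

Let det w := T * int_Y2 Y T w - int_Y Y T w ^+ 2.

Let mdet : measurable_fun setT det.
Proof. by apply: measurable_funB; [exact: measurable_funM|exact: measurable_funX]. Qed.

Let cdet : cip P (fun n w => (discrete_det Y T n w)^-1) (fun w => (det w)^-1).
Proof.
apply: (cipV complete_P) => //; apply: cipB; first exact: (cipM complete_P).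
by have := cipM complete_P mI1 mI1 c1 c1; apply: cip_ae_eq => [n|]; apply: aeW => w; rewrite expr2.
Qed.

Let mdetV : measurable_fun setT (fun w => (det w)^-1).
Proof.
apply: (@measurableT_comp _ _ _ _ _ _ (fun x : R => x^-1)) mdet.
exact: measurable_inv.
Qed.

Let lse_pairE w : det w != 0 -> lse_pair Y Z IYZ T w = (det w)^-1 *: col2
  ((Z T w - Z 0 w) * int_Y2 Y T w - int_Y Y T w * IYZ w)
  ((Z T w - Z 0 w) * int_Y Y T w - T * IYZ w).
Proof. by move=> dw; have [_] := inv_lse_matrix (Z T w - Z 0 w) (IYZ w) dw. Qed.

(** The closed forms use the total inverse, so they are measurable with no case distinction; they
    agree with the matrix expression wherever the determinant is nonzero, hence almost surely. *)
Let A w := ((Z T w - Z 0 w) * int_Y2 Y T w - int_Y Y T w * IYZ w) * (det w)^-1.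
Let C w := ((Z T w - Z 0 w) * int_Y Y T w - T * IYZ w) * (det w)^-1.

Let mA : measurable_fun setT A.
Proof.
apply: measurable_funM; last exact: mdetV.
by apply: measurable_funB; exact: measurable_funM.
Qed.

Let mC : measurable_fun setT C.
Proof.
apply: measurable_funM; last exact: mdetV.
by apply: measurable_funB; exact: measurable_funM.
Qed.

Let AE : {ae P, forall w, A w = lse_pair Y Z IYZ T w 0 0}.
Proof. by apply: filterS det0 => w dw; rewrite lse_pairE// !mxE/= mulrC. Qed.

Let CE : {ae P, forall w, C w = lse_pair Y Z IYZ T w 1 0}.
Proof. by apply: filterS det0 => w dw; rewrite lse_pairE// !mxE/= mulrC. Qed.

Lemma lse_intercept_measurable : measurable_fun setT (fun w => lse_pair Y Z IYZ T w 0 0).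
Proof. exact: (ae_eq_measurable complete_P) mA AE. Qed.

Lemma lse_slope_measurable : measurable_fun setT (fun w => lse_pair Y Z IYZ T w 1 0).
Proof. exact: (ae_eq_measurable complete_P) mC CE. Qed.

Lemma discrete_intercept_cip :
  cip P (discrete_intercept Y T Z) (fun w => lse_pair Y Z IYZ T w 0 0).
Proof.
suff : cip P (discrete_intercept Y T Z) A by apply: cip_ae_eq => [n|//]; exact: aeW.
apply: (cipM complete_P) => //; first by apply: measurable_funB; exact: measurable_funM.
apply: cipB; last exact: (cipM complete_P).
have := cipM complete_P mZ mI2 cU c2; apply: cip_ae_eq => [n|]; apply: aeW => w //.
by rewrite mulrC.
Qed.

Lemma discrete_slope_cip :
  cip P (discrete_slope Y T Z) (fun w => lse_pair Y Z IYZ T w 1 0).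
Proof.
suff : cip P (discrete_slope Y T Z) C by apply: cip_ae_eq => [n|//]; exact: aeW.
apply: (cipM complete_P) => //; first by apply: measurable_funB; exact: measurable_funM.
apply: cipB; last exact: (cipM complete_P).
have := cipM complete_P mZ mI1 cU c1; apply: cip_ae_eq => [n|]; apply: aeW => w //.
by rewrite mulrC.
Qed.

End pair.
End Final.

Section Estimator.
Context {R : realType} {d : measure_display} {Omega : measurableType d}.
Variable P : probability Omega R.
Hypothesis complete_P : measure_is_complete P.

(** The norm of a product is a maximum, so the bad event is almost surely the union of those of the
    coordinates. [th n] need not be measurable for [n < N]; from [N] on, the bad event differs from
    a measurable set by a null set. *)
Lemma cvg_in_probability4 (N : nat) (th : nat -> Omega -> R * R * R * R)
    (l : Omega -> R * R * R * R) (g1 g2 g3 g4 : nat -> Omega -> R) :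
  (forall n, (N <= n)%N -> {ae P, forall w, th n w = (g1 n w, g2 n w, g3 n w, g4 n w)}) ->
  (forall n, [/\ measurable_fun setT (g1 n), measurable_fun setT (g2 n),
     measurable_fun setT (g3 n) & measurable_fun setT (g4 n)]) ->
  [/\ measurable_fun setT (fun w => (l w).1.1.1), measurable_fun setT (fun w => (l w).1.1.2),
     measurable_fun setT (fun w => (l w).1.2) & measurable_fun setT (fun w => (l w).2)] ->
  cip P g1 (fun w => (l w).1.1.1) -> cip P g2 (fun w => (l w).1.1.2) ->
  cip P g3 (fun w => (l w).1.2) -> cip P g4 (fun w => (l w).2) ->
  cvg_in_probability P th l.
Proof.
move=> thE mg [m1 m2 m3 m4] c1 c2 c3 c4 e e0.
pose A n := [set w | e <= `|th n w - l w|].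
pose D (g : nat -> Omega -> R) (u : Omega -> R) n := [set w | e <= `|g n w - u w|].
pose C n := D g1 (fun w => (l w).1.1.1) n `|` D g2 (fun w => (l w).1.1.2) n
  `|` D g3 (fun w => (l w).1.2) n `|` D g4 (fun w => (l w).2) n.
have AC n : (N <= n)%N -> {ae P, forall w, A n w <-> C n w}.
  move=> Nn; apply: filterS (thE n Nn) => w E; rewrite /A /C /D /= E.
  rewrite !prod_normE/= !le_max; split.
    by move=> /orP[/orP[/orP[?|?]|?]|?]; [left; left; left|left; left; right|left; right|right].
  by move=> [[[->|->]|->]|->]; rewrite ?orbT.
have mC n : measurable (C n).
  have [h1 h2 h3 h4] := mg n.
  by do 3 (apply: measurableU; last exact: measurable_ge_dist); exact: measurable_ge_dist.
have mA n : (N <= n)%N -> measurable (A n).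
  by move=> Nn; apply: (ae_measurable_set complete_P (mC n)); exact: AC.
have near_N : \forall n \near \oo, (N <= n)%N by exists N.
apply/fine_cvgP; split.
  by apply: filterS near_N => n Nn; apply: fin_num_measure; exact: mA.
apply/cvgrPdist_le => r r0.
(* Four coordinates use [4 r / 5]; the remainder provides the strict inequality asked by
   [outer_le_ae]. *)
have r5 : 0 < r / 5 by rewrite divr_gt0.
have Hc := filterI (filterI (c1 _ _ e0 r5) (c2 _ _ e0 r5)) (filterI (c3 _ _ e0 r5) (c4 _ _ e0 r5)).
have [K _ HK] := Hc; exists (maxn N K) => // n /=; rewrite geq_max => /andP[Nn Kn].
have [[d1 d2] [d3 d4]] := HK n Kn.
have oC : outer_le P (C n) (r / 5 + r / 5 + r / 5 + r / 5).
  by apply: outer_leU d4; apply: outer_leU d3; apply: outer_leU d2.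
have oA : outer_le P (A n) r.
  apply: outer_le_ae oC; last by lra.
  by apply: filterS (AC n Nn) => w [].
rewrite sub0r normrN ger0_norm; last by rewrite fine_ge0.
by rewrite -lee_fin fineK ?fin_num_measure//; [apply: outer_leP => //; exact: mA|exact: mA].
Qed.

Variables (F : R -> set (set Omega)) (W B : R -> Omega -> R).
Hypotheses (FF : filtration F) (FW : filtered_wiener P F W) (FB : filtered_wiener P F B).
Variables (Y Z mu phi psi : R -> Omega -> R) (T : R).
Hypotheses (rY : regular P F Y) (rZ : regular P F Z)
  (rmu : regular P F mu) (rphi : regular P F phi) (rpsi : regular P F psi)
  (ZE : forall t, 0 <= t -> {ae P, forall w,
    Z t w = Z 0 w + ito_diff P F W B mu phi psi t w})
  (T0 : 0 < T)
  (det0 : {ae P, forall w, T * int_Y2 Y T w - int_Y Y T w ^+ 2 != 0}).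

Let I := ito_diff_integral P F W B Y mu phi psi T.

Let rY1 : regular P F (fun _ _ => 1). Proof. exact: regular_cst. Qed.

Let mI : measurable_fun setT I.
Proof.
by apply: (ito_diff_measurable complete_P FF FW FB) (ltW T0); apply: (regularM FF).
Qed.

Let mZ : measurable_fun setT (fun w => Z T w - Z 0 w).
Proof. by apply: measurable_funB; apply: (regular_measurable FF rZ) => //; exact: ltW. Qed.

Let cV : cip P (left_ito T Y Z) I.
Proof. exact: (ito_process_riemann_sum complete_P FF FW FB rmu rphi rpsi ZE rY T0). Qed.

(** The sum telescopes, but its limit is obtained as the integral of the constant 1 against [Z],
    which the equation for [Z] identifies with [Z T - Z 0]. *)
Let cU : cip P (left_ito T (fun _ _ => 1) Z) (fun w => Z T w - Z 0 w).
Proof.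
have := ito_process_riemann_sum complete_P FF FW FB rmu rphi rpsi ZE rY1 T0.
apply: cip_ae_eq => [n|]; first exact: aeW.
apply: filterS (ZE (ltW T0)) => w ->; rewrite addrC addKr /ito_diff_integral.
have e1 (H : R -> Omega -> R) : (fun s w => 1 * H s w) = H.
  by apply/funext => s; apply/funext => v; rewrite mul1r.
by rewrite !e1.
Qed.

Lemma process_intercept_cip :
  cip P (discrete_intercept Y T Z) (fun w => lse_pair Y Z I T w 0 0).
Proof. exact: (discrete_intercept_cip complete_P FF T0 rY mZ mI cU cV det0). Qed.

Lemma process_slope_cip :
  cip P (discrete_slope Y T Z) (fun w => lse_pair Y Z I T w 1 0).
Proof. exact: (discrete_slope_cip complete_P FF T0 rY mZ mI cU cV det0). Qed.

Lemma process_intercept_measurable : measurable_fun setT (fun w => lse_pair Y Z I T w 0 0).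
Proof. exact: (lse_intercept_measurable complete_P FF T0 rY mZ mI det0). Qed.

Lemma process_slope_measurable : measurable_fun setT (fun w => lse_pair Y Z I T w 1 0).
Proof. exact: (lse_slope_measurable complete_P FF T0 rY mZ mI det0). Qed.

Let mito (H : R -> Omega -> R) n : regular P F H -> measurable_fun setT (left_ito T H Z n).
Proof.
move=> rH; apply: measurable_sum => k; apply: measurable_funM.
  by apply: (regular_measurable FF rH); exact: tick_ge0.
by apply: measurable_funB; apply: (regular_measurable FF rZ); exact: tick_ge0.
Qed.

Let mriem (H : R -> Omega -> R) n : regular P F H -> measurable_fun setT (left_riemann T H n).
Proof. exact: left_riemann_measurable. Qed.

Let mdetV n : measurable_fun setT (fun w => (discrete_det Y T n w)^-1).
Proof.
apply: (@measurableT_comp _ _ _ _ _ _ (fun x : R => x^-1)); first exact: measurable_inv.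
apply: measurable_funB; last by apply: measurable_funX; exact: mriem.
by apply: measurable_funM; apply: mriem => //; exact: (regularM FF).
Qed.

Lemma discrete_measurable n : measurable_fun setT (discrete_intercept Y T Z n) /\
  measurable_fun setT (discrete_slope Y T Z n).
Proof.
have rYY := regularM FF rY rY.
split; apply: measurable_funM (mdetV n); apply: measurable_funB; apply: measurable_funM;
  by [exact: mriem|exact: mito].
Qed.

End Estimator.

Theorem proposition3p1 (R : realType) (d : measure_display)
    (Omega : measurableType d) (P : probability Omega R)
    (a b alpha beta sigma1 sigma2 rho : R) (W B Y X : R -> Omega -> R)
    (complete_P : measure_is_complete P)
    (a_gt0 : 0 < a) (sigma1_gt0 : 0 < sigma1) (sigma2_gt0 : 0 < sigma2)
    (rho_bounds : -1 < rho < 1)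
    (wiener_WB : wiener_process2 P W B)
    (initial_meas : measurable_fun setT (Y 0) /\ measurable_fun setT (X 0))
    (initial_indep : indep_systems P (sigma_initial (Y 0) (X 0))
                                     (sigma_noise `[0, +oo[ W B))
    (solution_YX :
       heston_solution P a b alpha beta sigma1 sigma2 rho W B Y X)
    (Y0_gt0 : P [set w | 0 < Y 0 w] = 1%E)
    (T : R) (T_gt0 : 0 < T) :
  let IYdY := int_Y_dY P a b sigma1 W B Y X T in
  let IYdX := int_Y_dX P alpha beta sigma2 rho W B Y X T in
  let det w := T * int_Y2 Y T w - int_Y Y T w ^+ 2 in
  [/\ P [set w | T * int_Y2 Y T w > int_Y Y T w ^+ 2] = 1%E,
      P [set w | [/\ lse_matrix Y T w \in unitmx,
          lse_pair Y Y IYdY T w =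
            (det w)^-1 *: col2
              ((Y T w - Y 0 w) * int_Y2 Y T w - int_Y Y T w * IYdY w)
              ((Y T w - Y 0 w) * int_Y Y T w - T * IYdY w)
        & lse_pair Y X IYdX T w =
            (det w)^-1 *: col2
              ((X T w - X 0 w) * int_Y2 Y T w - int_Y Y T w * IYdX w)
              ((X T w - X 0 w) * int_Y Y T w - T * IYdX w)]] = 1%E
    & cvg_in_probability P (lse_discrete Y X T) (lse Y X IYdY IYdX T)].
Proof.
move=> IYdY IYdX det; have [wW wB WB] := wiener_WB; have [mY0 mX0] := initial_meas.
pose F := augmented_filtration P W B (Y 0) (X 0).
have mW t : 0 <= t -> measurable_fun setT (W t) by exact: (wiener_measurable wW).
have mB t : 0 <= t -> measurable_fun setT (B t) by exact: (wiener_measurable wB).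
have FF : filtration F by exact: (filtration_augmented complete_P wW mB mY0 mX0).
have FW : filtered_wiener P F W by exact: (filtered_wiener_augmented complete_P wW mB mY0 mX0 WB initial_indep).
have FB : filtered_wiener P F B.
  rewrite /F augmented_filtrationC; apply: filtered_wiener_augmented => //.
    exact: indep_systemsC.
  by rewrite /sigma_noise setUC.
have [aY aX cY cX Y_ge0 YE XE] := solution_YX.
have rY : regular P F Y by [].
have rX : regular P F X by [].
have rdrift (c e : R) : regular P F (fun s w => c - e * Y s w).
  have -> : (fun s w => c - e * Y s w) = (fun s w => c + (- e) * Y s w).
    by apply/funext => s; apply/funext => w; rewrite mulNr.
  by apply: (regularD FF); [exact: regular_cst|apply: (regularM FF) => //; exact: regular_cst].
have rsqrt := regular_sqrt FF rY.
have rc (c : R) : regular P F (fun _ _ => c) by exact: regular_cst.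
have rmuY : regular P F (heston_driftY a b Y) by exact: rdrift.
have rmuX : regular P F (heston_driftX alpha beta Y) by exact: rdrift.
have rphiY : regular P F (heston_diffYW sigma1 Y) by exact: (regularM FF (rc sigma1) rsqrt).
have rpsiY : regular P F heston_diffYB by exact: rc.
have rphiX : regular P F (heston_diffXW sigma2 rho Y).
  exact: (regularM FF (regularM FF (rc sigma2) rsqrt) (rc rho)).
have rpsiX : regular P F (heston_diffXB sigma2 rho Y).
  exact: (regularM FF (regularM FF (rc sigma2) rsqrt) (rc _)).
have Y0_pos : {ae P, forall w, 0 < Y 0 w}.
  pose pos := [set w | 0 < Y 0 w].
  have mpos : measurable pos.
    have := mY0 measurableT _ (measurable_itv `]0, +oo[).
    rewrite setTI (_ : _ @^-1` _ = pos)//.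
    by apply/seteqP; split => w; rewrite /= in_itv/= andbT.
  apply/negligibleP; first exact: measurableC.
  have : P (~` pos) = (1 - P pos)%E by exact: probability_setC.
  by rewrite Y0_gt0 subee.
(* Also at [t = 1 / n]: [Y 0 <> Y (1 / n)] makes the minimizer unique, without
   which [lse_discrete], an arbitrary choice, need not even be measurable. *)
have no_return t : 0 < t -> {ae P, forall w, Y t w != Y 0 w}.
  move=> t0; have := ito_process_no_return complete_P FF FW FB rmuY rphiY rpsiY YE (fun _ _ => erefl) rY t0.
  (* On the event [Y t = Y 0] the diffusion coefficient at time [t] is [sigma1 * sqrt (Y 0)], which
     is nonzero, so [ito_process_no_return] contradicts the equality. *)
  apply: filterS2 Y0_pos => w Yw nr; apply/negP => /eqP YY.
  have pn : heston_diffYW sigma1 Y t w != 0.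
    by rewrite /heston_diffYW YY mulf_neq0// gt_eqF// sqrtr_gt0.
  by have := nr pn; rewrite YY eqxx.
(* [path_variance_gt0] asks for one time strictly inside the interval at which the path differs from
   its starting value; the midpoint serves. *)
have T2 : 0 < T / 2 < T by rewrite divr_gt0//= ltr_pdivrMr// ltr_pMr// ltr1n.
have det_pos : {ae P, forall w, int_Y Y T w ^+ 2 < T * int_Y2 Y T w}.
  have T20 : 0 < T / 2 by case/andP: T2.
  by apply: filterS2 cY (no_return _ T20) => w cw; exact: path_variance_gt0.
have det_neq0 : {ae P, forall w, det w != 0}.
  by apply: filterS det_pos => w; rewrite -subr_gt0 => /gt_eqF ->.
split.
- exact: ae_prob1.
- apply: (ae_prob1 complete_P); apply: filterS det_neq0 => w dw.
  have [uM EY] := inv_lse_matrix (Y T w - Y 0 w) (IYdY w) dw.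
  by have [_ EX] := inv_lse_matrix (X T w - X 0 w) (IYdX w) dw.
have [N _ HN] : \forall n \near \oo, (2 <= Num.truncn (n%:R * T))%N.
  have T20 : 0 < T / 2 by case/andP: T2.
  apply: filterS (inv_small T20) => n [n0 nT].
  rewrite truncn_ge_nat ?mulr_ge0 ?(ltW T_gt0)//.
  move: nT; rewrite ltr_pdivlMr// mulrC ltr_pdivrMr ?ltr0n// mulrC => /ltW.
  by rewrite mulrC.
apply: (cvg_in_probability4 complete_P (N := N)
  (g1 := discrete_intercept Y T Y) (g2 := discrete_slope Y T Y)
  (g3 := discrete_intercept Y T X) (g4 := discrete_slope Y T X)).
- move=> n Nn; have n2 := HN n Nn.
  have n0 : (0 < n)%N by apply: (@nbr_gt0 R T n 0); exact: leq_trans n2.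
  have n1 : (0 : R) < 1%:R / n%:R by rewrite divr_gt0// ltr0n.
  apply: filterS (no_return _ n1) => w yw; apply: lse_discreteE => //.
  by rewrite mul0r eq_sym.
- move=> n; have [? ?] := discrete_measurable FF T rY rY n.
  by have [? ?] := discrete_measurable FF T rY rX n.
- split.
  + exact: (process_intercept_measurable complete_P FF FW FB rY rY rmuY rphiY rpsiY T_gt0 det_neq0).
  + exact: (process_slope_measurable complete_P FF FW FB rY rY rmuY rphiY rpsiY T_gt0 det_neq0).
  + exact: (process_intercept_measurable complete_P FF FW FB rY rX rmuX rphiX rpsiX T_gt0 det_neq0).
  + exact: (process_slope_measurable complete_P FF FW FB rY rX rmuX rphiX rpsiX T_gt0 det_neq0).
- exact: (process_intercept_cip complete_P FF FW FB rY rY rmuY rphiY rpsiY YE T_gt0 det_neq0).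
- exact: (process_slope_cip complete_P FF FW FB rY rY rmuY rphiY rpsiY YE T_gt0 det_neq0).
- exact: (process_intercept_cip complete_P FF FW FB rY rX rmuX rphiX rpsiX XE T_gt0 det_neq0).
- exact: (process_slope_cip complete_P FF FW FB rY rX rmuX rphiX rpsiX XE T_gt0 det_neq0).
Qed.
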